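(* Let $n\ge2$, $r>1/2$, and let $F=\{f_1,\dots,f_n\}$ be a family of holomorphic functions on $B_r\subset\mathbb{C}^n$ such that, for some $M>0$, $$\sup_{B_r}\log|F|\le0\quad\text{and}\quad\inf_{\partial B_{1/2}}\log|F|\ge-M .$$ Assume that all zeros of $|F|^2$ are elliptic, and let $k$ be the number of zeros of $|F|^2$ in $B_{1/2}$ counted with their multiplicities. Let $\omega\subset B(x,t)$ be a compact set of class $\mathcal{A}(d,a)$ with $\mathcal{H}^d(\omega)\ge\epsilon>0$, and assume that $B(x,4r^2t)\subset B_{1/2}$. Then there is a constant $c=c(r,F)>0$ (depending only on $r$ and $F$) such that $$\sup_{B(x,t)}\log|F|\le\sup_{\omega}\log|F|+k\log\frac{16\,e\,r\,t\,a^{1/d}}{c\,(d\epsilon)^{1/d}} .$$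
   Context: $B(x,t)$ is the open Euclidean ball in $\mathbb{C}^n$ with center $x$ and radius $t$, and $B_s=B(0,s)$. $|F|^2=|f_1|^2+\dots+|f_n|^2$. $\mathcal{H}^d$ is the $d$-dimensional Hausdorff measure. For $d>0$, $a>0$, a compact set $K\subset\mathbb{C}^n\cong\mathbb{R}^{2n}$ belongs to $\mathcal{A}(d,a)$ if $\mathcal{H}^d(K\cap B(y,s))\le a s^d$ for all $y\in K$ and $0<s\le\operatorname{diam}(K)$. Elliptic zeros: let $h$ be a nonnegative (real-)analytic function with a finite number of zeros defined on an open set $U\subset\mathbb{R}^N$. A zero $x$ of $h$ is elliptic if the Taylor expansion of $h$ at $x$ has the form $h(x+t\theta)=t^{m}g(\theta)+o(t^{m})$ with $\inf_{S^{N-1}}g>0$; here $t>0$ and $\theta$ belongs to the unit sphere $S^{N-1}$ of $\mathbb{R}^N$. This is applied to $h=|F|^2$ with $\mathbb{C}^n\cong\mathbb{R}^{2n}$. The condition on $\partial B_{1/2}$ means that the system $F=0$ has only discrete zeros in a neighbourhood of the closed ball $\overline{B_{1/2}}$. The multiplicity of a zero of $|F|^2$ is the degree of the map $F$ at that zero.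
   Formalization: The assumption k ≥ 1 (|F|² has a zero in B_{1/2}) is added: for k = 0 the inequality reads sup_{B(x,t)} log|F| ≤ sup_ω log|F|, which fails, e.g. for n = 2, r = 1, F = ((2+z₁)/4, 0), x = 0, t = 1/8 and ω a small closed ball about 0. *)

(* Defs.v *)
From HB Require Import structures.
From mathcomp Require Import all_boot all_order all_algebra.
From mathcomp Require Import complex.
From mathcomp Require Import all_classical all_reals all_analysis.

Set Implicit Arguments.
Unset Strict Implicit.
Unset Printing Implicit Defensive.

Import Order.TTheory GRing.Theory Num.Theory numFieldNormedType.Exports.

Local Open Scope classical_set_scope.
Local Open Scope ring_scope.

(* [R[i]^o] rather than [R[i]]: the normed module structure is canonical
   on the former only. *)
Notation "''Cv[' R ]_ n" := 'rV[R[i]^o]_n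
  (at level 0, n at level 2, format "''Cv[' R ]_ n").

Section ComplexSpace.
Variables (R : realType) (n : nat).
Implicit Types (z : 'Cv[R]_n) (A : set 'Cv[R]_n).

(* The library norm on row vectors is the sup norm, hence this definition. *)
Definition hnorm z : R := Num.sqrt (\sum_(i < n) Normc.normc (z 0 i) ^+ 2).

Definition hball z (s : R) : set 'Cv[R]_n := [set y | hnorm (y - z) < s].

Definition hsphere z (s : R) : set 'Cv[R]_n := [set y | hnorm (y - z) = s].

(* 0 is adjoined so that [hdiam set0 = 0]. *)
Definition hdiam A : \bar R :=
  ereal_sup ([set 0%E] `|` [set (hnorm (x - y))%:E | x in A & y in A]).

(* Hausdorff measure, without a dimensional normalising factor. *)
Definition hausdorff (d : R) A : \bar R :=
  ereal_sup [set
    ereal_inf [set (\sum_(0 <= i <oo) hdiam (U i) `^ d)%E |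
      U in [set U : nat -> set 'Cv[R]_n |
        A `<=` \bigcup_i U i /\ forall i, (hdiam (U i) <= delta%:E)%E]] |
    delta in [set delta : R | 0 < delta]].

Definition class_A (d a : R) A : Prop :=
  compact A /\
  forall y (s : R), A y -> 0 < s -> (s%:E <= hdiam A)%E ->
    (hausdorff d (A `&` hball y s) <= (a * s `^ d)%:E)%E.

(* [lne 0 = -oo], whereas [ln 0 = 0]. *)
Definition lognorm (F : 'Cv[R]_n -> 'Cv[R]_n) z : \bar R :=
  lne (hnorm (F z))%:E.

Definition holomorphic_on (D : set 'Cv[R]_n) (F : 'Cv[R]_n -> 'Cv[R]_n) :
    Prop :=
  forall z, D z -> differentiable F z.

Definition to_real z : 'rV[R]_(n + n) :=
  row_mx (\row_i complex.Re (z 0 i)) (\row_i complex.Im (z 0 i)).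

Definition of_real (u : 'rV[R]_(n + n)) : 'Cv[R]_n :=
  \row_i (u 0 (lshift n i) +i* u 0 (rshift n i))%C.

Definition real_map (F : 'Cv[R]_n -> 'Cv[R]_n) :
    'rV[R]_(n + n) -> 'rV[R]_(n + n) :=
  fun u => to_real (F (of_real u)).

Definition sqr_hnorm_map (F : 'Cv[R]_n -> 'Cv[R]_n) : 'rV[R]_(n + n) -> R :=
  fun u => hnorm (F (of_real u)) ^+ 2.

End ComplexSpace.

Section RealSpace.
Variables (R : realType) (N : nat).

Definition rnorm (u : 'rV[R]_N) : R := Num.sqrt (\sum_(i < N) u 0 i ^+ 2).

(* The o(t^m) of the Taylor expansion is uniform in the direction theta. *)
Definition elliptic_zero (h : 'rV[R]_N -> R) (x : 'rV[R]_N) : Prop :=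
  h x = 0 /\
  exists (m : nat) (g : 'rV[R]_N -> R),
    (0 < ereal_inf [set (g theta)%:E | theta in [set v | rnorm v = 1%R]])%E /\
    forall eps : R, 0 < eps ->
      \forall t \near (0 : R)^'+, forall theta, rnorm theta = 1 ->
        `|h (x + t *: theta) - t ^+ m * g theta| <= eps * t ^+ m.

(* The local (Brouwer) degree of f at x: for every small ball D around x and
   every regular value w of f on D close enough to f x, the preimages of w
   in D are finitely many and m is the sum of their orientation signs. *)
Definition local_degree (f : 'rV[R]_N -> 'rV[R]_N) (x : 'rV[R]_N) (m : int) :
    Prop :=
  \forall delta \near (0 : R)^'+, \forall w \near f x,
    let preim := [set y | rnorm (y - x) < delta /\ f y = w] in
    (forall y, preim y -> \det (jacobian f y) != 0) ->
    exists s : seq 'rV[R]_N,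
      [/\ uniq s, forall y, y \in s <-> preim y &
          m = \sum_(y <- s) sgz (\det (jacobian f y))].

End RealSpace.

(* k is the number of zeros of F in D, each counted with its degree. *)
Definition zero_count (R : realType) (n : nat) (F : 'Cv[R]_n -> 'Cv[R]_n)
    (D : set 'Cv[R]_n) (k : nat) : Prop :=
  exists (s : seq 'Cv[R]_n) (mu : 'Cv[R]_n -> int),
    [/\ uniq s,
        forall z, z \in s <-> D z /\ F z = 0,
        forall z, z \in s -> local_degree (real_map F) (to_real z) (mu z) &
        k%:Z = \sum_(z <- s) mu z].

(* Main.v *)
Require Import Defs.
From HB Require Import structures.
From mathcomp Require Import all_boot all_order all_algebra.
From mathcomp Require Import complex.
From mathcomp Require Import all_classical all_reals all_analysis.
From mathcomp Require Import ring lra zify.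

Import Order.TTheory GRing.Theory Num.Theory numFieldNormedType.Exports.
Local Open Scope classical_set_scope.
Local Open Scope ring_scope.

(* Near a zero b of order p (|F|^2 = t^(2p) g + o(t^(2p)) by ellipticity) one has
   |F(z)| ~ |z - b|^p, and p is at most the local degree at b: F is close to its
   leading form P, homogeneous of degree p, so the p points xi^j z (xi^p = 1) at
   which P agrees give p preimages of every w in some small open ball; by a
   quantitative Sard argument one such w is a regular value, and all its
   preimages count +1 since the real Jacobian of F is |det F'|^2. Hence
   |F| ~ prod_b |z - b|^(p b) on the closed ball, with sum_b p b <= k.
   On the other hand omega is not covered by #zeros balls of radius delta / 2,
   delta ~ (eps / a)^(1/d), centred at the zeros, as each carries measure at most
   a delta^d. So some y in omega is at distance at least delta / 2 from all zeros,
   and |F(z)| <= C (6 t / delta)^k |F(y)| on B(x,t). Analyticity of F is recovered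
   from complex differentiability by Goursat's theorem. *)

Set Implicit Arguments.
Unset Strict Implicit.
Unset Printing Implicit Defensive.

(** An inequality between p and the degree suffices: each exponent enters through a factor X^p with
    X = 6 t / delta >= 1, so the sum of the p b may be raised to k. As the degree is only accessible
    through regular values close to F(b), its lower bound needs a value that is both regular and
    attained p times; producing p preimages for a whole open ball of values leaves room to choose a
    regular one. No integral is used: Cauchy's theorem is proved for dyadic Riemann sums,
    transported to circles by the exponential, and Taylor coefficients are limits of such sums. The
    class A controls measure only in balls of radius at most diam omega. Hence delta must first be
    compared with the diameter, which costs a covering number; Q is larger than both this number and
    the number of zeros. The resulting factor (Q d)^(1/d) is at most e^Q, so that c does not depend
    on d. *)

Local Notation normc := Normc.normc.

(** * Cauchy-Schwarz and Minkowski inequalities for finite real sums *)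

Section Minkowski.
Variables (R : realType) (I : finType).
Implicit Types a b : I -> R.

(** Multiplied by 2 A B, the gap between the two sides is the sum of the squares (B a_i - A b_i)^2.
    The cases A = 0 and B = 0 are split off so that this factor can be cancelled. *)
Lemma CauchySchwarz_sum a b :
  \sum_i a i * b i <= Num.sqrt (\sum_i a i ^+ 2) * Num.sqrt (\sum_i b i ^+ 2).
Proof.
set A := Num.sqrt (\sum_i a i ^+ 2); set B := Num.sqrt _.
have sq_ge0 (f : I -> R) : 0 <= \sum_i f i ^+ 2.
  by apply: sumr_ge0 => i _; exact: sqr_ge0.
have A2 : A ^+ 2 = \sum_i a i ^+ 2 by rewrite sqr_sqrtr.
have B2 : B ^+ 2 = \sum_i b i ^+ 2 by rewrite sqr_sqrtr.
have zero (f g : I -> R) : Num.sqrt (\sum_i f i ^+ 2) = 0 -> \sum_i f i * g i = 0.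
  move=> /eqP; rewrite sqrtr_eq0 => f0.
  have /eqP : \sum_i f i ^+ 2 == 0 by rewrite eq_le f0 sq_ge0.
  move=> /psumr_eq0P f00; apply: big1 => i _.
  have /eqP := f00 (fun i _ => sqr_ge0 (f i)) i isT.
  by rewrite sqrf_eq0 => /eqP ->; rewrite mul0r.
have [A0|A0] := eqVneq A 0; first by rewrite zero // A0 mul0r.
have [B0|B0] := eqVneq B 0.
  by under eq_bigr do rewrite mulrC; rewrite zero // B0 mulr0.
have Ap : 0 < A by rewrite lt_def A0 sqrtr_ge0.
have Bp : 0 < B by rewrite lt_def B0 sqrtr_ge0.
suff : 2 * (A * B) * (A * B - \sum_i a i * b i) >= 0.
  by rewrite pmulr_rge0 ?subr_ge0// !mulr_gt0.
have -> : 2 * (A * B) * (A * B - \sum_i a i * b i) =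
  \sum_i (B * a i - A * b i) ^+ 2.
  under [RHS]eq_bigr do rewrite sqrrB !exprMn.
  rewrite big_split sumrB /= -!mulr_sumr -A2 -B2 !mulrBr.
  have -> : \sum_i (B * a i * (A * b i)) *+ 2 = 2 * (A * B) * \sum_i a i * b i.
    by rewrite mulr_sumr; apply: eq_bigr => i _; ring.
  ring.
by apply: sumr_ge0 => i _; exact: sqr_ge0.
Qed.

Lemma Minkowski_sum a b :
  Num.sqrt (\sum_i (a i + b i) ^+ 2) <=
  Num.sqrt (\sum_i a i ^+ 2) + Num.sqrt (\sum_i b i ^+ 2).
Proof.
rewrite -ler_sqr ?nnegrE ?sqrtr_ge0 ?addr_ge0 ?sqrtr_ge0//.
have sq_ge0 (f : I -> R) : 0 <= \sum_i f i ^+ 2.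
  by apply: sumr_ge0 => i _; exact: sqr_ge0.
rewrite sqrrD !sqr_sqrtr//.
under eq_bigr do rewrite sqrrD.
rewrite !big_split /= lerD2r lerD2l -mulr2n lerMn2r /=.
exact: CauchySchwarz_sum.
Qed.

End Minkowski.

(** * The Euclidean norm on C^n *)

Section Hnorm.
Variables (R : realType) (n : nat).
Implicit Types (x y z : 'Cv[R]_n) (c : R[i]).

Lemma normc_ge0 c : 0 <= normc c.
Proof. by case: c => a b; exact: sqrtr_ge0. Qed.

Lemma normrE_normc c : `|c| = (normc c)%:C%C.
Proof. by []. Qed.

Lemma normc_real (a : R) : normc (a%:C)%C = `|a|.
Proof. by rewrite /normc /= expr0n addr0 sqrtr_sqr. Qed.

Lemma normc_eq0 c : (normc c == 0) = (c == 0).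
Proof.
by apply/eqP/eqP => [/Normc.eq0_normc//|->]; exact: Normc.normc0.
Qed.

Lemma normc_gt0 c : (0 < normc c) = (c != 0).
Proof. by rewrite lt_def normc_eq0 normc_ge0 andbT. Qed.

Lemma normcX c k : normc (c ^+ k) = normc c ^+ k.
Proof.
by elim: k => [|k IH]; rewrite ?Normc.normc1// !exprS Normc.normcM IH.
Qed.

Lemma hnorm_ge0 z : 0 <= hnorm z.
Proof. exact: sqrtr_ge0. Qed.

Lemma hnorm_sqr z : hnorm z ^+ 2 = \sum_(i < n) normc (z 0 i) ^+ 2.
Proof. by rewrite sqr_sqrtr// sumr_ge0// => i _; exact: sqr_ge0. Qed.

Lemma hnormZ c z : hnorm (c *: z) = normc c * hnorm z.
Proof.
apply/eqP; rewrite -(eqrXn2 (n := 2)) ?mulr_ge0 ?hnorm_ge0 ?normc_ge0//.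
rewrite exprMn !hnorm_sqr mulr_sumr; apply/eqP/eq_bigr => i _.
by rewrite mxE Normc.normcM exprMn.
Qed.

Lemma hnorm_eq0 z : (hnorm z == 0) = (z == 0).
Proof.
apply/eqP/eqP => [z0|->].
  have := hnorm_sqr z; rewrite z0 expr0n /= => /esym/psumr_eq0P.
  move=> /(_ (fun i _ => sqr_ge0 _)) zi0; apply/rowP => i; rewrite mxE.
  by have /eqP := zi0 i isT; rewrite sqrf_eq0 => /eqP/Normc.eq0_normc.
by rewrite -(scale0r (0 : 'Cv[R]_n)) hnormZ Normc.normc0 mul0r.
Qed.

Lemma hnorm0 : hnorm (0 : 'Cv[R]_n) = 0.
Proof. by apply/eqP; rewrite hnorm_eq0. Qed.

Lemma hnorm_gt0 z : (0 < hnorm z) = (z != 0).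
Proof. by rewrite lt_def hnorm_eq0 hnorm_ge0 andbT. Qed.

Lemma hnormN z : hnorm (- z) = hnorm z.
Proof. by rewrite -scaleN1r hnormZ normcN Normc.normc1 mul1r. Qed.

Lemma hnormBC x y : hnorm (x - y) = hnorm (y - x).
Proof. by rewrite -hnormN opprB. Qed.

Lemma ler_hnormD x y : hnorm (x + y) <= hnorm x + hnorm y.
Proof.
apply: le_trans (Minkowski_sum _ _).
apply: ler_wsqrtr.
apply: ler_sum => i _; rewrite mxE ler_sqr ?nnegrE ?addr_ge0 ?normc_ge0//.
exact: le_normcD.
Qed.

Lemma ltr_hnormD x y (a b : R) :
  hnorm x < a -> hnorm y < b -> hnorm (x + y) < a + b.
Proof. by move=> xa yb; apply: le_lt_trans (ler_hnormD _ _) (ltrD xa yb). Qed.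

Lemma ler_hnormB x y : hnorm (x - y) <= hnorm x + hnorm y.
Proof. by rewrite -(hnormN y) ler_hnormD. Qed.

Lemma lerB_hnorm x y : hnorm x - hnorm y <= hnorm (x + y).
Proof. by rewrite lerBlDr -(hnormN y) -{1}(addrK y x) ler_hnormD. Qed.

Lemma ler_hnorm_dist x y z : hnorm (x - z) <= hnorm (x - y) + hnorm (y - z).
Proof. by rewrite -{1}(subrK y x) -addrA ler_hnormD. Qed.

Lemma ler_hnorm_sum (I : Type) (s : seq I) (f : I -> 'Cv[R]_n) :
  hnorm (\sum_(i <- s) f i) <= \sum_(i <- s) hnorm (f i).
Proof.
elim/big_ind2: _ => [|a b c d ab cd|//]; first by rewrite hnorm0.
by apply: le_trans (ler_hnormD _ _) _; exact: lerD.
Qed.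

Lemma normc_sqr c : normc c ^+ 2 = complex.Re c ^+ 2 + complex.Im c ^+ 2.
Proof. by case: c => a b; rewrite /normc sqr_sqrtr// addr_ge0 ?sqr_ge0. Qed.

Lemma hnorm_parallelogram x y :
  hnorm (x + y) ^+ 2 + hnorm (x - y) ^+ 2 = 2 * hnorm x ^+ 2 + 2 * hnorm y ^+ 2.
Proof.
rewrite !hnorm_sqr !mulr_sumr -!big_split; apply: eq_bigr => i _ /=.
rewrite !mxE !normc_sqr; case: (x 0 i) => a b; case: (y 0 i) => c d /=; ring.
Qed.

Lemma normc_coord z i : normc (z 0 i) <= hnorm z.
Proof.
rewrite -ler_sqr ?nnegrE ?normc_ge0 ?hnorm_ge0// hnorm_sqr (bigD1 i)//=.
by rewrite lerDl sumr_ge0// => j _; exact: sqr_ge0.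
Qed.

Lemma hnorm_le_sum z : hnorm z <= \sum_(i < n) normc (z 0 i).
Proof.
have {1}-> : z = \sum_(i < n) z 0 i *: delta_mx 0 i by exact: row_sum_delta.
apply: le_trans (ler_hnorm_sum _ _) _; apply: ler_sum => i _.
rewrite hnormZ ler_piMr ?normc_ge0// -ler_sqr ?nnegrE ?hnorm_ge0//.
rewrite hnorm_sqr (bigD1 i)//= big1 => [|j ji].
  by rewrite mxE !eqxx Normc.normc1 addr0.
by rewrite mxE (negbTE ji) andbF Normc.normc0 expr0n.
Qed.

End Hnorm.
#[global] Hint Resolve hnorm_ge0 normc_ge0 : core.

Ltac pos := solve [repeat first
  [ by [] | assumption | by apply: ltW | exact: hnorm_ge0 | exact: normc_ge0
  | exact: pi_gt0 | apply: divr_gt0 | apply: divr_ge0 | apply: mulr_gt0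
  | apply: mulr_ge0 | apply: exprn_gt0 | apply: exprn_ge0 | apply: addr_gt0
  | apply: addr_ge0 | apply: mulrn_wge0 | apply: ltW]].

(** * Identification of C^n with R^(2n) *)

Section RealCoordinates.
Variables (R : realType) (n : nat).
Implicit Types (z : 'Cv[R]_n) (u : 'rV[R]_(n + n)).

Lemma to_realK : cancel (@to_real R n) (@of_real R n).
Proof.
move=> z; apply/rowP => i; rewrite mxE row_mxEl row_mxEr !mxE.
by case: (z 0 i).
Qed.

Lemma of_realK : cancel (@of_real R n) (@to_real R n).
Proof.
move=> u; apply/rowP => i; rewrite -(splitK i); case: (fintype.split i) => j /=.
  by rewrite row_mxEl !mxE.
by rewrite row_mxEr !mxE.
Qed.

Lemma to_realD z y : to_real (z + y) = to_real z + to_real y.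
Proof.
by rewrite /to_real add_row_mx; congr row_mx; apply/rowP => i;
   rewrite !mxE; case: (z 0 i) => ? ?; case: (y 0 i).
Qed.

Lemma to_realZ (a : R) z : to_real ((a%:C)%C *: z) = a *: to_real z.
Proof.
by rewrite /to_real scale_row_mx; congr row_mx; apply/rowP => i;
   rewrite !mxE; case: (z 0 i) => ? ? /=; ring.
Qed.

Lemma of_realD u v : of_real (u + v) = of_real u + of_real v.
Proof. by apply: (can_inj to_realK); rewrite to_realD !of_realK. Qed.

Lemma of_realZ (a : R) u : of_real (a *: u) = (a%:C)%C *: of_real u.
Proof. by apply: (can_inj to_realK); rewrite to_realZ !of_realK. Qed.

Lemma of_realB u v : of_real (u - v) = of_real u - of_real v.
Proof.
by rewrite -scaleN1r of_realD of_realZ rmorphN rmorph1 scaleN1r.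
Qed.

Lemma to_realB z y : to_real (z - y) = to_real z - to_real y.
Proof. by apply: (can_inj of_realK); rewrite of_realB !to_realK. Qed.

Lemma rnorm_to_real z : rnorm (to_real z) = hnorm z.
Proof.
rewrite /rnorm /hnorm big_split_ord /=; congr Num.sqrt.
rewrite -big_split; apply: eq_bigr => i _ /=.
by rewrite row_mxEl row_mxEr !mxE normc_sqr.
Qed.

Lemma hnorm_of_real u : hnorm (of_real u) = rnorm u.
Proof. by rewrite -rnorm_to_real of_realK. Qed.

End RealCoordinates.

Local Notation ci := (0 +i* 1)%C.

(** * Nested intervals *)

Section NestedIntervals.
Variable R : realType.
Implicit Types C e : R.

Lemma nested_intervals (a b : nat -> R) :
  (forall j, a j <= a j.+1) -> (forall j, b j.+1 <= b j) ->
  (forall j, a j <= b j) -> exists c, forall j, a j <= c <= b j.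
Proof.
move=> a_inc b_dec ab.
have amono : {homo a : i j / (i <= j)%N >-> i <= j}.
  by apply: homo_leq => //; exact: le_trans.
have bmono : {homo b : i j / (i <= j)%N >-> j <= i}.
  by apply: homo_leq => // x y z xy yz; exact: le_trans yz xy.
have aleb i j : a i <= b j.
  have [ij|/ltnW ji] := leqP i j; first exact: le_trans (amono _ _ ij) (ab j).
  exact: le_trans (ab i) (bmono _ _ ji).
have ubb j : ubound (range a) (b j) by move=> _ [i _ <-].
exists (sup (range a)) => j; apply/andP; split.
  by apply: ub_le_sup; [exists (b 0%N) | exists j].
by apply: ge_sup => //; exists (a 0%N), 0%N.
Qed.

Lemma half_pow_small (C e : R) : 0 < e -> exists j : nat, C / 2 ^+ j < e.
Proof.
move=> e0; have [j Hj] : exists j : nat, C / e < j%:R.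
  exists (Num.bound `|C / e|); apply: le_lt_trans (ler_norm _) _.
  exact: archi_boundP.
exists j; rewrite ltr_pdivrMr ?exprn_gt0// mulrC -ltr_pdivrMr//.
apply: lt_trans Hj _; rewrite -natrX ltr_nat; exact: ltn_expl.
Qed.

End NestedIntervals.

(** * Goursat's theorem for dyadic Riemann sums *)

Section DiscreteGoursat.
Variables (R : realType) (n : nat).
Local Notation E := 'Cv[R]_n.
Implicit Types (f g : R -> E) (u v : R -> R -> E) (x y s t a b L X Y B e : R).

(** With 2^N nodes, halving the interval is an exact identity that lowers N by one. Bisection
    arguments therefore work on the sums themselves, before any limit. *)
Definition riemann_sum g a L N : E :=
  ((L / 2 ^+ N)%:C)%C *: \sum_(j < 2 ^ N) g (a + L * (j%:R / 2 ^+ N)).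

Lemma riemann_sum_split g a L N : riemann_sum g a L N.+1 =
  riemann_sum g a (L / 2) N + riemann_sum g (a + L / 2) (L / 2) N.
Proof.
have p2 : (2 : R) ^+ N != 0 by rewrite expf_eq0 pnatr_eq0 andbF.
have -> : riemann_sum g a L N.+1 =
  ((L / 2 / 2 ^+ N)%:C)%C *: \sum_(j < 2 ^ N + 2 ^ N) g (a + L * (j%:R / 2 ^+ N.+1)).
  rewrite /riemann_sum addnn -mul2n -expnS; congr (_%:C%C *: _).
  by rewrite exprS; field.
rewrite big_split_ord /= scalerDr; congr (_ *: _ + _ *: _);
  apply: eq_bigr => j _; congr (g _); rewrite ?natrD ?natrX exprS; field => //.
Qed.

Lemma riemann_sumB f g a L N :
  riemann_sum (f \- g) a L N = riemann_sum f a L N - riemann_sum g a L N.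
Proof. by rewrite /riemann_sum -scalerBr sumrB. Qed.

Lemma riemann_sum_cst c a L N : riemann_sum (cst c) a L N = (L%:C)%C *: c.
Proof.
rewrite /riemann_sum /= sumr_const card_ord -[X in _ *: X]scaler_nat scalerA; congr (_ *: _).
rewrite -(rmorph_nat (real_complex R)) -rmorphM natrX; congr (_%:C)%C.
by rewrite mulfVK// expf_eq0 pnatr_eq0 andbF.
Qed.

Lemma eq_riemann_sum f g a L N : f =1 g ->
  riemann_sum f a L N = riemann_sum g a L N.
Proof. by move=> fg; rewrite /riemann_sum; under eq_bigr do rewrite fg. Qed.

Lemma riemann_sum_le g a L N B : 0 <= L ->
  (forall t, a <= t <= a + L -> hnorm (g t) <= B) ->
  hnorm (riemann_sum g a L N) <= L * B.
Proof.
move=> L0 gB; rewrite /riemann_sum hnormZ normc_real.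
have p2 : 0 < (2 : R) ^+ N by rewrite exprn_gt0.
rewrite ger0_norm ?divr_ge0 ?exprn_ge0//.
have -> : L * B = L / 2 ^+ N * (2 ^+ N * B) by rewrite mulrA mulfVK ?gt_eqF.
apply: ler_wpM2l; first by rewrite divr_ge0 ?exprn_ge0.
apply: le_trans (ler_hnorm_sum _ _) _.
have -> : 2 ^+ N * B = \sum_(j < 2 ^ N) B.
  by rewrite sumr_const card_ord -[B *+ _]mulr_natl natrX.
apply: ler_sum => j _; apply: gB.
rewrite lerDl mulr_ge0 ?divr_ge0 ?exprn_ge0//=.
by rewrite lerD2l ler_piMr// ler_pdivrMr// mul1r -natrX ler_nat ltnW.
Qed.

(* Left Riemann sum, with 2^N nodes on each side, of the integral of
   [u dw], [w = s + i t], along the boundary of [x, x + X] * [y, y + Y]. *)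
Definition rect_sum u x y X Y N : E :=
  riemann_sum (u^~ y \- u^~ (y + Y)) x X N +
  ci *: riemann_sum (u (x + X) \- u x) y Y N.

Lemma rect_sum_split u x y X Y N : rect_sum u x y X Y N.+1 =
  (rect_sum u x y (X / 2) (Y / 2) N + rect_sum u (x + X / 2) y (X / 2) (Y / 2) N)
  + (rect_sum u x (y + Y / 2) (X / 2) (Y / 2) N +
     rect_sum u (x + X / 2) (y + Y / 2) (X / 2) (Y / 2) N).
Proof.
have half a L : a + L / 2 + L / 2 = a + L :> R by field.
rewrite /rect_sum !riemann_sum_split !riemann_sumB !half.
do ![match goal with |- context [riemann_sum ?g ?a ?L ?N] =>
  generalize (riemann_sum g a L N); intro end].
by apply/rowP => i; rewrite !mxE; ring.
Qed.

Lemma rect_sum_le u x y X Y N B : 0 <= X -> 0 <= Y ->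
  (forall s t, x <= s <= x + X -> y <= t <= y + Y -> hnorm (u s t) <= B) ->
  hnorm (rect_sum u x y X Y N) <= 2 * (X + Y) * B.
Proof.
move=> X0 Y0 uB; apply: le_trans (ler_hnormD _ _) _.
rewrite hnormZ {1}/normc /= expr0n expr1n add0r sqrtr1 mul1r.
have -> : 2 * (X + Y) * B = X * (B + B) + Y * (B + B) by ring.
have xI : x <= x <= x + X by rewrite lexx lerDl.
have xI' : x <= x + X <= x + X by rewrite lexx lerDl X0.
have yI : y <= y <= y + Y by rewrite lexx lerDl.
have yI' : y <= y + Y <= y + Y by rewrite lexx lerDl Y0.
by apply: lerD; apply: riemann_sum_le => // t tI /=;
   apply: le_trans (ler_hnormB _ _) _; apply: lerD; apply: uB.
Qed.

Lemma rect_sumB u v x y X Y N :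
  rect_sum (fun s t => u s t - v s t) x y X Y N =
  rect_sum u x y X Y N - rect_sum v x y X Y N.
Proof.
rewrite /rect_sum !riemann_sumB.
do ![match goal with |- context [riemann_sum ?g ?a ?L ?N] =>
  generalize (riemann_sum g a L N); intro end].
by apply/rowP => i; rewrite !mxE; ring.
Qed.

(** The difference of an affine function between two opposite sides is constant, so its Riemann sums
    are exact for every N; the two pairs of sides contribute - i X Y C and i X Y C. *)
Lemma rect_sum_affine (A C : E) x0 y0 x y X Y N :
  rect_sum (fun s t => A + ((s - x0) +i* (t - y0))%C *: C) x y X Y N = 0.
Proof.
rewrite /rect_sum.
rewrite [Z in Z + _](_ : _ = (X%:C)%C *: ((0 +i* - Y)%C *: C)); last first.
  rewrite -(riemann_sum_cst _ x X N); apply: eq_riemann_sum => t /=.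
  rewrite opprD addrACA subrr add0r -scalerBl; congr (_ *: _).
  by apply/eqP; rewrite eq_complex /=; apply/andP; split; apply/eqP; ring.
rewrite [Z in _ + _ *: Z](_ : _ = (Y%:C)%C *: ((X%:C)%C *: C)); last first.
  rewrite -(riemann_sum_cst _ y Y N); apply: eq_riemann_sum => t /=.
  rewrite opprD addrACA subrr add0r -scalerBl; congr (_ *: _).
  by apply/eqP; rewrite eq_complex /=; apply/andP; split; apply/eqP; ring.
rewrite !scalerA -scalerDl -[RHS](scale0r C); congr (_ *: _).
by apply/eqP; rewrite eq_complex /=; apply/andP; split; apply/eqP; ring.
Qed.

(** Complex differentiability at x0 + i y0 in real coordinates: the increment acts on C as a complex
    scalar, which encodes the Cauchy-Riemann equations. *)
Definition cdiff2 u x0 y0 := exists C : E, forall e, 0 < e ->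
  exists2 d : R, 0 < d & forall x y, `|x - x0| < d -> `|y - y0| < d ->
  hnorm (u x y - u x0 y0 - ((x - x0) +i* (y - y0))%C *: C) <=
    e * (`|x - x0| + `|y - y0|).

(** If the sums do not become smaller than e, those of some quarter do not become smaller than e /
    4. Iterating, the rectangles shrink to a point where u is differentiable; there the affine part
    contributes 0 and the remainder is small against the squared perimeter, that is, against 4^-j,
    uniformly in N. *)
Lemma goursat u x y X Y : 0 < X -> 0 < Y ->
  (forall s t, x <= s <= x + X -> y <= t <= y + Y -> cdiff2 u s t) ->
  forall e, 0 < e -> \forall N \near \oo, hnorm (rect_sum u x y X Y N) < e.
Proof.
move=> X0 Y0 du e e0; apply: contrapT => bad0.
pose bad j (p : R * R) := ~ \forall N \near \oo,
  hnorm (rect_sum u p.1 p.2 (X / 2 ^+ j) (Y / 2 ^+ j) N) < e / 4 ^+ j.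
pose Xj j := X / 2 ^+ j; pose Yj j := Y / 2 ^+ j.
have p2 j : 0 < (2 : R) ^+ j by rewrite exprn_gt0.
have p4 j : 0 < (4 : R) ^+ j by rewrite exprn_gt0.
have XS j : Xj j / 2 = Xj j.+1 by rewrite /Xj exprS; field; rewrite gt_eqF.
have YS j : Yj j / 2 = Yj j.+1 by rewrite /Yj exprS; field; rewrite gt_eqF.
have step j p : exists q, bad j p -> bad j.+1 q /\
   (q.1 = p.1 \/ q.1 = p.1 + Xj j.+1) /\ (q.2 = p.2 \/ q.2 = p.2 + Yj j.+1).
  have [badp|nbad] := pselect (bad j p); last by exists p.
  case: p badp => a b badp.
  apply: contrapT => /forallNP none; apply: badp.
  have good q : (q.1 = a \/ q.1 = a + Xj j.+1) -> (q.2 = b \/ q.2 = b + Yj j.+1) ->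
     \forall N \near \oo, hnorm (rect_sum u q.1 q.2 (Xj j.+1) (Yj j.+1) N) < e / 4 ^+ j.+1.
    move=> q1 q2; apply: contrapT => bq; apply: (none q) => _; split=> //.
  have := good (a, b) (or_introl erefl) (or_introl erefl).
  have := good (a + Xj j.+1, b) (or_intror erefl) (or_introl erefl).
  have := good (a, b + Yj j.+1) (or_introl erefl) (or_intror erefl).
  have := good (a + Xj j.+1, b + Yj j.+1) (or_intror erefl) (or_intror erefl).
  move=> /= g4 g3 g2 g1; apply: near_inftyS.
  apply: filterS (filterI (filterI g1 g2) (filterI g3 g4)) => N [[h1 h2] [h3 h4]].
  rewrite -/(Xj j) -/(Yj j) rect_sum_split XS YS.
  have -> : e / 4 ^+ j = (e / 4 ^+ j.+1 + e / 4 ^+ j.+1) + (e / 4 ^+ j.+1 + e / 4 ^+ j.+1).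
    by rewrite exprS; field; rewrite gt_eqF.
  exact: ltr_hnormD (ltr_hnormD h1 h2) (ltr_hnormD h3 h4).
have {}step j : exists f : R * R -> R * R, forall p, bad j p -> bad j.+1 (f p) /\
   ((f p).1 = p.1 \/ (f p).1 = p.1 + Xj j.+1) /\ ((f p).2 = p.2 \/ (f p).2 = p.2 + Yj j.+1).
  by have [f fP] := choice (step j); exists f.
have [f fP] := choice step.
pose s := fix s j := if j is j'.+1 then f j' (s j') else (x, y).
have sbad j : bad j (s j).
  elim: j => [|j /fP[]//]; rewrite /bad /= !expr0 !divr1; exact: bad0.
have sP j := (fP j _ (sbad j)).2.
have Xj0 j : 0 < Xj j by rewrite divr_gt0.
have Yj0 j : 0 < Yj j by rewrite divr_gt0.
have [cx cxP] : exists c, forall j, (s j).1 <= c <= (s j).1 + Xj j.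
  apply: nested_intervals => j; last by rewrite lerDl ltW.
    by rewrite /=; have [[] -> _] := sP j; rewrite ?lerDl ?(ltW (Xj0 _)).
  by rewrite /=; have := Xj0 j.+1; have := XS j; have [[] -> _] := sP j; lra.
have [cy cyP] : exists c, forall j, (s j).2 <= c <= (s j).2 + Yj j.
  apply: nested_intervals => j; last by rewrite lerDl ltW.
    by rewrite /=; have [_ [] ->] := sP j; rewrite ?lerDl ?(ltW (Yj0 _)).
  by rewrite /=; have := Yj0 j.+1; have := YS j; have [_ [] ->] := sP j; lra.
have [C dB] : cdiff2 u cx cy.
  apply: du; [have := cxP 0%N | have := cyP 0%N]; by rewrite /Xj /Yj /= expr0 divr1.
(* On the j-th rectangle the remainder contributes at most 2 eta (X + Y)^2 / 4^j, which this choice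
   keeps below e / 4^j. *)
pose eta := e / (2 * (X + Y) ^+ 2 + 1).
have den0 : 0 < 2 * (X + Y) ^+ 2 + 1 by have := sqr_ge0 (X + Y); lra.
have eta0 : 0 < eta by rewrite divr_gt0.
have [d d0 dP] := dB _ eta0.
have [j jd] := half_pow_small (X + Y) d0.
apply: (sbad j); apply: nearW => N; rewrite -/(Xj j) -/(Yj j).
pose v a b := u cx cy + ((a - cx) +i* (b - cy))%C *: C.
have -> : rect_sum u (s j).1 (s j).2 (Xj j) (Yj j) N =
          rect_sum (fun a b => u a b - v a b) (s j).1 (s j).2 (Xj j) (Yj j) N.
  by rewrite rect_sumB rect_sum_affine subr0.
apply: (@le_lt_trans _ _ (2 * (Xj j + Yj j) * (eta * (Xj j + Yj j)))).
  apply: rect_sum_le; rewrite ?ltW// => a b aI bI.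
  have ax : `|a - cx| <= Xj j.
    by rewrite ler_norml; move: (cxP j) aI; clear; lra.
  have by_ : `|b - cy| <= Yj j.
    by rewrite ler_norml; move: (cyP j) bI; clear; lra.
  have XYd : Xj j + Yj j < d by rewrite /Xj /Yj -mulrDl.
  rewrite /v opprD addrA; apply: le_trans (dP a b _ _) _.
  - by apply: le_lt_trans ax _; have := Yj0 j; lra.
  - by apply: le_lt_trans by_ _; have := Xj0 j; lra.
  - by rewrite ler_pM2l// lerD.
have -> : 2 * (Xj j + Yj j) * (eta * (Xj j + Yj j)) =
   (2 * (X + Y) ^+ 2) / (2 * (X + Y) ^+ 2 + 1) * (e / 4 ^+ j).
  have -> : (4 : R) ^+ j = 2 ^+ j * 2 ^+ j.
    by rewrite -exprMn; congr (_ ^+ _); ring.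
  by rewrite /Xj /Yj /eta; field; rewrite !gt_eqF.
by rewrite gtr_pMl ?divr_gt0// ltr_pdivrMr// mul1r ltrDl.
Qed.

(** Interior points count twice and endpoints once. Unlike the indicator of the closed interval,
    this is additive under halving, and it still vanishes only off the closed interval. *)
Definition endpoint_count (a L t : R) : nat :=
  ((a <= t < a + L)%R + (a < t <= a + L)%R)%N.

Lemma endpoint_count_split a L t : 0 < L -> endpoint_count a L t =
  (endpoint_count a (L / 2) t + endpoint_count (a + L / 2) (L / 2) t)%N.
Proof.
move=> L0; rewrite /endpoint_count.
have -> : a + L / 2 + L / 2 = a + L by field.
have e1 : (a <= t < a + L) = ((a <= t < a + L / 2)%R + (a + L / 2 <= t < a + L)%R)%N :> nat.
  by case: (leP a t) => h1; case: (ltP t (a + L)) => h2;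
     case: (ltP t (a + L / 2)) => h3 //; exfalso; lra.
have e2 : (a < t <= a + L) = ((a < t <= a + L / 2)%R + (a + L / 2 < t <= a + L)%R)%N :> nat.
  by case: (ltP a t) => h1; case: (leP t (a + L)) => h2;
     case: (leP t (a + L / 2)) => h3 //; exfalso; lra.
by rewrite e1 e2 addnACA.
Qed.

Lemma endpoint_count_eq0 a L t : 0 < L -> endpoint_count a L t = 0%N ->
  ~ (a <= t <= a + L).
Proof.
move=> L0 + /andP[at_ ta]; rewrite /endpoint_count ta at_ /= andbT.
by case: (ltP t (a + L)) => // taL; have -> : a < t by lra.
Qed.

(* [weight] counts the cells of the current subdivision that touch an
   exceptional point; it is invariant under subdivision, while the perimeter
   of the cells is halved. *)
Lemma goursat_bounded (pts : seq (R * R)) u B x y X Y : 0 < X -> 0 < Y -> 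
  (forall s t, x <= s <= x + X -> y <= t <= y + Y -> hnorm (u s t) <= B) ->
  (forall s t, x <= s <= x + X -> y <= t <= y + Y -> (s, t) \notin pts ->
     cdiff2 u s t) ->
  forall e, 0 < e -> \forall N \near \oo, hnorm (rect_sum u x y X Y N) < e.
Proof.
pose weight x y X Y := (\sum_(p <- pts) endpoint_count x X p.1 * endpoint_count y Y p.2)%N.
move=> X0 Y0 uB du e e0.
suff H j : forall x y X Y, 0 < X -> 0 < Y ->
  (forall s t, x <= s <= x + X -> y <= t <= y + Y -> hnorm (u s t) <= B) ->
  (forall s t, x <= s <= x + X -> y <= t <= y + Y -> (s, t) \notin pts ->
     cdiff2 u s t) ->
  forall e, 0 < e -> \forall N \near \oo, hnorm (rect_sum u x y X Y N) <
     2 * (X + Y) * B / 2 ^+ j * (weight x y X Y)%:R + e.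
  have [j jP] := half_pow_small (2 * (X + Y) * B * (weight x y X Y)%:R) (divr_gt0 e0 (ltr0Sn R 1)).
  have e2 : 0 < e / 2 by rewrite divr_gt0.
  apply: filterS (H j x y X Y X0 Y0 uB du _ e2) => N /lt_trans; apply.
  by rewrite mulrAC; lra.
elim: j => [|j IH] {}x {}y {}X {}Y {}X0 {}Y0 {}uB {}du {}e {}e0.
  rewrite expr0 divr1.
  have B0 : 0 <= B.
    by apply: le_trans (hnorm_ge0 (u x y)) (uB _ _ _ _); rewrite lexx lerDl ltW.
  (* Weight 0 means that the closed rectangle has no exceptional point, and [goursat] applies; with
     weight at least 1 the trivial bound by perimeter times B is enough. *)
  have [w0|w0] := posnP (weight x y X Y).
    rewrite w0 mulr0 add0r; apply: goursat => // s t sI tI; apply: du => //.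
    apply/negP => pin; move/eqP: w0; rewrite sum_nat_seq_eq0 => /allP/(_ _ pin) /=.
    by rewrite muln_eq0 => /orP[]/eqP/endpoint_count_eq0; apply.
  apply: nearW => N; apply: le_lt_trans (rect_sum_le N (ltW X0) (ltW Y0) uB) _.
  rewrite ltr_pwDr// ler_peMr//; last by rewrite (ler_nat _ 1).
  by rewrite !mulr_ge0 ?addr_ge0 ?(ltW X0) ?(ltW Y0).
have X2 : 0 < X / 2 by rewrite divr_gt0.
have Y2 : 0 < Y / 2 by rewrite divr_gt0.
have e4 : 0 < e / 4 by rewrite divr_gt0.
have quarter a b : (a = x \/ a = x + X / 2) -> (b = y \/ b = y + Y / 2) ->
  \forall N \near \oo, hnorm (rect_sum u a b (X / 2) (Y / 2) N) <
     2 * (X / 2 + Y / 2) * B / 2 ^+ j * (weight a b (X / 2) (Y / 2))%:R + e / 4.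
  move=> ax by_; apply: IH => // s t sI tI; [apply: uB|apply: du];
  by [case: ax sI => ->; lra|case: by_ tI => ->; lra].
have := quarter _ _ (or_introl erefl) (or_introl erefl).
have := quarter _ _ (or_intror erefl) (or_introl erefl).
have := quarter _ _ (or_introl erefl) (or_intror erefl).
have := quarter _ _ (or_intror erefl) (or_intror erefl).
move=> g4 g3 g2 g1; apply: near_inftyS.
apply: filterS (filterI (filterI g1 g2) (filterI g3 g4)) => N [[h1 h2] [h3 h4]].
rewrite rect_sum_split.
have -> : weight x y X Y = (weight x y (X / 2) (Y / 2) +
   weight (x + X / 2)%R y (X / 2) (Y / 2) + (weight x (y + Y / 2)%R (X / 2) (Y / 2)
   + weight (x + X / 2)%R (y + Y / 2)%R (X / 2) (Y / 2)))%N.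
  rewrite /weight -!big_split /=; apply: eq_bigr => p _.
  by rewrite (endpoint_count_split _ _ X0) (endpoint_count_split _ _ Y0); clear; lia.
apply: lt_le_trans (ltr_hnormD (ltr_hnormD h1 h2) (ltr_hnormD h3 h4)) _.
rewrite !natrD exprS.
have -> : 2 * (X + Y) * B / (2 * 2 ^+ j) = 2 * (X / 2 + Y / 2) * B / 2 ^+ j.
  by field; rewrite expf_eq0 pnatr_eq0 andbF.
move: (2 * (X / 2 + Y / 2) * B / 2 ^+ j) => C.
move: (weight _ _ _ _)%:R (weight _ _ _ _)%:R => w1 w2.
move: (weight _ _ _ _)%:R (weight _ _ _ _)%:R => w3 w4.
by rewrite le_eqVlt; apply/orP; left; apply/eqP; field.
Qed.

End DiscreteGoursat.

Section DifferentialEstimate.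
Variables (K : numFieldType) (V W : normedModType K).

Lemma differentiable_near (f : V -> W) x : differentiable f x ->
  forall e, 0 < e -> \forall h \near (0 : V), `|f (h + x) - f x - 'd f x h| <= e * `|h|.
Proof.
move=> /diff_locally /eqaddoP df e e0; apply: filterS (df e e0) => h /=.
by rewrite /= opprD addrA.
Qed.

End DifferentialEstimate.

(** * The complex exponential as polar coordinates *)

Section ComplexExponential.
Variable R : realType.
Implicit Types x y s t e : R.

(** The exponential of x + i y. It maps [x1, x2] * [0, 2 pi] onto an annulus, which turns statements
    on rectangles into statements on circles. *)
Definition cexp x y : R[i] := (expR x * cos y +i* (expR x * sin y))%C.

Lemma cexpD x y s t : cexp (x + s) (y + t) = cexp x y * cexp s t.
Proof.
by apply/eqP; rewrite eq_complex /= expRD cosD sinD;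
   apply/andP; split; apply/eqP; ring.
Qed.

Lemma normc_cexp x y : normc (cexp x y) = expR x.
Proof.
by rewrite /normc /= !exprMn -mulrDr cos2Dsin2 mulr1 sqrtr_sqr ger0_norm ?expR_ge0.
Qed.

Lemma cexp_periodic x y : cexp x (y + pi *+ 2) = cexp x y.
Proof. by rewrite /cexp cosD2pi sinD2pi. Qed.

Lemma is_derive_near (f : R -> R) x l : is_derive x 1 f l ->
  forall e, 0 < e -> exists2 d : R, 0 < d & forall h, `|h| < d ->
    `|f (x + h) - f x - l * h| <= e * `|h|.
Proof.
move=> [df dfl] e e0.
have /differentiable_near /(_ _ e0) /nbhs_norm0P [d /= d0 dP] : differentiable f x.
  exact/derivable1_diffP.
exists d => // h hd; have := dP h hd.
by rewrite diff1E ?derive1E ?dfl ?[h + x]addrC ?[l * h]mulrC//; exact/derivable1_diffP.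
Qed.

Lemma normc_le_ReIm (z : R[i]) : normc z <= `|complex.Re z| + `|complex.Im z|.
Proof.
rewrite -ler_sqr ?nnegrE ?addr_ge0// normc_sqr sqrrD !real_normK ?num_real//.
by rewrite addrAC lerDl mulrn_wge0// mulr_ge0.
Qed.

Lemma cexp_near e : 0 < e -> exists2 d : R, 0 < d & forall h k, `|h| < d -> `|k| < d ->
  normc (cexp h k - (1 + (h +i* k))%C) <= e * (`|h| + `|k|).
Proof.
wlog e1 : e / e <= 1 => [wl e0|e0].
  have [|/ltW e1] := leP e 1; first by move=> e1; exact: wl.
  have [d d0 dP] := wl 1 (lexx _) ltr01; exists d => // h k hd kd.
  by apply: le_trans (dP _ _ hd kd) _; apply: ler_wpM2r => //; rewrite addr_ge0.
have f0 : 0 < e / 6 by rewrite divr_gt0.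
have [d1 d10 d1P] := is_derive_near (is_derive_expR 0) f0.
have [d2 d20 d2P] := is_derive_near (is_derive_cos 0) f0.
have [d3 d30 d3P] := is_derive_near (is_derive_sin 0) f0.
(* The bound e / 12 on |h| is for the cross term (E - 1) k, of modulus at most 2 |h| |k|. *)
exists (Num.min (Num.min d1 d2) (Num.min d3 (e / 12))).
  by rewrite !lt_min d10 d20 d30 divr_gt0.
move=> h k; rewrite !lt_min => /andP[/andP[h1 _] /andP[_ he]].
move=> /andP[/andP[_ k2] /andP[k3 _]].
have := d1P h h1; have := d2P k k2; have := d3P k k3.
rewrite !add0r sin0 cos0 expR0 oppr0 mul0r !mul1r !subr0 addr0.
set E := expR h; set C := cos k; set S := sin k => hS hC hE.
apply: le_trans (normc_le_ReIm _) _; rewrite /= add0r -/E -/C -/S.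
have E2 : `|E - 1| <= 2 * `|h|.
  have -> : E - 1 = (E - 1 - h) + h by ring.
  apply: le_trans (ler_normD _ _) _.
  have : e / 6 * `|h| <= `|h| by rewrite ler_piMl//; lra.
  lra.
have Eb : `|E| <= 2.
  have -> : E = (E - 1) + 1 by ring.
  apply: le_trans (ler_normD _ _) _; rewrite normr1; lra.
have -> : E * C - (1 + h) = E * (C - 1) + (E - 1 - h) by ring.
have -> : E * S - k = E * (S - k) + (E - 1) * k by ring.
have a1 : `|E * (C - 1)| <= 2 * (e / 6 * `|k|) by rewrite normrM ler_pM.
have a2 : `|E * (S - k)| <= 2 * (e / 6 * `|k|) by rewrite normrM ler_pM.
have a3 : `|(E - 1) * k| <= e / 6 * `|k|.
  rewrite normrM ler_wpM2r//; lra.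
have := ler_normD (E * (C - 1)) (E - 1 - h).
have := ler_normD (E * (S - k)) ((E - 1) * k).
have := normr_ge0 k; have := normr_ge0 h; nra.
Qed.

Lemma cos_eq1 (z : R) : cos z = 1 -> `|z| <= pi *+ 2 -> z = 0 \/ z = pi *+ 2 \/ z = - (pi *+ 2).
Proof.
have half (s : R) : 0 < s -> s < pi *+ 2 -> cos s <> 1.
  move=> s0 s2 cs; have : 0 < sin (s / 2).
    by apply: sin_gt0_pi; rewrite divr_gt0//= ltr_pdivrMr// mulr_natr.
  have := cos2Dsin2 (s / 2); have := cos_mulr2n (s / 2).
  rewrite -[s / 2 *+ 2]mulr_natr mulfVK ?pnatr_eq0// cs => c1 c2 s3.
  have := mulr_gt0 s3 s3; lra.
move=> cz; rewrite ler_norml => /andP[z1 z2].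
have [->|z0] := eqVneq z 0; [by left|right].
have [->|zp] := eqVneq z (pi *+ 2); [by left|right].
apply/eqP; apply/negPn/negP => zn.
have [zlt|zgt|zz] := ltgtP z 0; last by rewrite zz eqxx in z0.
  by apply: (half (- z)); rewrite ?cosN ?oppr_gt0// ltrNl lt_neqAle eq_sym zn z1.
by apply: (half z) => //; rewrite lt_neqAle zp.
Qed.

(** Supplies the exceptional points of [goursat_bounded] when only the point a of the annulus is
    singular. Both edges y = 0 and y = 2 pi belong to the strip, hence the translates by 2 pi in the
    list. *)
Lemma cexp_fiber (a : R[i]) : exists pts : seq (R * R), forall x y,
  0 <= y <= pi *+ 2 -> cexp x y = a -> (x, y) \in pts.
Proof.
have [[s [t [t2 st]]]|none] := pselect (exists s t, 0 <= t <= pi *+ 2 /\ cexp s t = a);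
  last by exists [::] => x y yI xya; case: none; exists x, y.
exists [:: (s, t); (s, t + pi *+ 2); (s, t - pi *+ 2)] => x y yI xya.
have -> : x = s by apply: expR_inj; rewrite -(normc_cexp x y) xya -st normc_cexp.
have [] : cexp 0 (y - t) = 1.
  have st0 : cexp s t != 0 by rewrite -normc_eq0 normc_cexp gt_eqF ?expR_gt0.
  apply: (mulfI st0); rewrite mulr1 -cexpD addr0 subrKC st -xya; congr cexp.
  by apply: expR_inj; rewrite -(normc_cexp s t) -(normc_cexp x y) xya st.
rewrite expR0 mul1r => c1 _.
have := cos_eq1 c1; rewrite !inE !xpair_eqE eqxx /= => /(_ _) [].
- by rewrite ler_norml; move: yI t2; lra.
- by move=> /eqP; rewrite subr_eq0 => ->.
- by case=> /eqP; rewrite subr_eq addrC => ->; rewrite !orbT.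
Qed.

End ComplexExponential.

(** * Riemann sums on circles and their independence of the radius *)

Section CircleMeans.
Variables (R : realType) (n : nat).
Local Notation E := 'Cv[R]_n.
Implicit Types (f g : R[i] -> E) (a z : R[i]) (x e B M rho : R).

Definition cderivable f z := exists D : E, forall e, 0 < e ->
  exists2 d : R, 0 < d & forall w, normc (w - z) < d ->
  hnorm (f w - f z - (w - z) *: D) <= e * normc (w - z).

Lemma cdiff2_cexp f x y : cderivable f (cexp x y) ->
  cdiff2 (fun s t => f (cexp s t)) x y.
Proof.
move=> [D fD]; exists (cexp x y *: D) => e e0.
set r := expR x; have r0 : 0 < r := expR_gt0 x.
have DM : 0 < hnorm D + 1 by rewrite ltr_wpDl ?hnorm_ge0.
(* Half of e pays for the first order error of f, half for that of the exponential; e1 <= 1 also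
   bounds |cexp s t - z| by 2 r (|h| + |k|). *)
pose e1 := Num.min 1 (e / (2 * r * (hnorm D + 1))).
have e10 : 0 < e1 by rewrite lt_min ltr01 divr_gt0 ?mulr_gt0.
have e20 : 0 < e / (4 * r) by rewrite divr_gt0 ?mulr_gt0.
have [d1 d10 d1P] := cexp_near e10.
have [d2 d20 d2P] := fD _ e20.
exists (Num.min d1 (d2 / (4 * r))); first by rewrite lt_min d10 divr_gt0 ?mulr_gt0.
move=> s t; rewrite !lt_min => /andP[s1 s2] /andP[t1 t2].
set h := s - x in s1 s2 *; set k := t - y in t1 t2 *.
have st : cexp s t = cexp x y * cexp h k.
  by rewrite -cexpD /h /k !subrKC.
set z := cexp x y in fD d2P st *.
have nz : normc z = r by rewrite normc_cexp.
have A1 := d1P h k s1 t1.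
have stz : cexp s t - z = z * (cexp h k - 1) by rewrite st mulrBr mulr1.
have e11 : e1 <= 1 by rewrite ge_min lexx.
have e12 : r * e1 * hnorm D <= e / 2.
  have : e1 * (2 * r * (hnorm D + 1)) <= e.
    by rewrite -ler_pdivlMr ?mulr_gt0// ge_min lexx orbT.
  have := hnorm_ge0 D; have := mulr_gt0 r0 e10; nra.
have hk0 : 0 <= `|h| + `|k| by rewrite addr_ge0.
have nw : normc (cexp s t - z) <= 2 * r * (`|h| + `|k|).
  have -> : 2 * r * (`|h| + `|k|) = r * (2 * (`|h| + `|k|)) by ring.
  rewrite stz Normc.normcM nz; apply: ler_wpM2l; first exact: ltW.
  have -> : cexp h k - 1 = (cexp h k - (1 + (h +i* k))%C) + (h +i* k)%C by ring.
  apply: le_trans (le_normcD _ _) _.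
  have : normc (h +i* k)%C <= `|h| + `|k| := normc_le_ReIm _.
  have : e1 * (`|h| + `|k|) <= `|h| + `|k| by rewrite ler_piMl.
  lra.
have r4 : 0 < 4 * r by rewrite mulr_gt0.
have nwd : normc (cexp s t - z) < d2.
  apply: le_lt_trans nw _; move: s2 t2; rewrite !ltr_pdivlMr//; lra.
have A2 := d2P _ nwd.
have -> : f (cexp s t) - f z - (h +i* k)%C *: (z *: D) =
  (f (cexp s t) - f z - (cexp s t - z) *: D) + (z * (cexp h k - (1 + (h +i* k))%C)) *: D.
  rewrite stz; move: (f (cexp s t)) (f z) (cexp h k) (h +i* k)%C => u v w b.
  by apply/rowP => i; rewrite !mxE; ring.
apply: le_trans (ler_hnormD _ _) _.
rewrite hnormZ Normc.normcM nz.
have B1 : e / (4 * r) * normc (cexp s t - z) <= e / 2 * (`|h| + `|k|).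
  have -> : e / 2 * (`|h| + `|k|) = e / (4 * r) * (2 * r * (`|h| + `|k|)).
    by field; rewrite gt_eqF.
  by apply: ler_wpM2l nw; exact: ltW.
have B2 : r * normc (cexp h k - (1 + (h +i* k))%C) * hnorm D <= e / 2 * (`|h| + `|k|).
  apply: (@le_trans _ _ (r * (e1 * (`|h| + `|k|)) * hnorm D)).
    by rewrite ler_wpM2r ?hnorm_ge0// ler_wpM2l ?(ltW r0).
  have -> : r * (e1 * (`|h| + `|k|)) * hnorm D = r * e1 * hnorm D * (`|h| + `|k|) by ring.
  by rewrite ler_wpM2r.
by have := le_trans A2 B1; lra.
Qed.

(** Approximates the integral of f against d theta = dz / (i z) on the circle of radius e^x. This is
    why Cauchy kernels appear below as z / (z - a). *)
Definition circle_sum f x N : E := riemann_sum (fun t => f (cexp x t)) 0 (pi *+ 2) N.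

Lemma circle_sum_le f x N B : (forall z, normc z = expR x -> hnorm (f z) <= B) ->
  hnorm (circle_sum f x N) <= pi *+ 2 * B.
Proof.
move=> fB; apply: riemann_sum_le => [|t _]; first by rewrite mulrn_wge0 ?pi_ge0.
by apply: fB; rewrite normc_cexp.
Qed.

(** Apply [goursat_bounded] to f o exp on [x1, x2] * [0, 2 pi]: the sides y = 0 and y = 2 pi cancel
    by periodicity, and the other two are the circle sums. Boundedness at a is what allows a to be
    singular. *)
Lemma circle_sum_indep f a B x1 x2 : x1 < x2 ->
  (forall z, expR x1 <= normc z <= expR x2 -> hnorm (f z) <= B) ->
  (forall z, expR x1 <= normc z <= expR x2 -> z != a -> cderivable f z) ->
  forall e, 0 < e -> \forall N \near \oo,
    hnorm (circle_sum f x2 N - circle_sum f x1 N) < e.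
Proof.
move=> x12 fB df e e0; have [pts ptsP] := cexp_fiber a.
have ann s t : x1 <= s <= x1 + (x2 - x1) -> expR x1 <= normc (cexp s t) <= expR x2.
  by rewrite normc_cexp !ler_expR subrKC.
have : \forall N \near \oo, hnorm (rect_sum (fun s t => f (cexp s t)) x1 0 (x2 - x1) (pi *+ 2) N) < e.
  apply: (@goursat_bounded _ _ pts _ B) => //.
  - by rewrite subr_gt0.
  - by rewrite pmulrn_lgt0 ?pi_gt0.
  - by move=> s t /ann sI tI; apply: fB.
  - move=> s t /ann sI; rewrite add0r => tI; move/negP=> npts.
    apply: cdiff2_cexp; apply: df => //; apply/eqP => sta.
    by apply: npts; apply: ptsP.
apply: filterS => N; rewrite /rect_sum.
have -> : riemann_sum ((fun s => f (cexp s 0)) \- (fun s => f (cexp s (0 + pi *+ 2)))) x1 (x2 - x1) N = 0.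
  rewrite /riemann_sum big1 ?scaler0// => j _ /=.
  by rewrite cexp_periodic subrr.
rewrite add0r hnormZ {1}/normc /= expr0n expr1n add0r sqrtr1 mul1r subrKC.
by rewrite riemann_sumB.
Qed.

End CircleMeans.

(** * Convergence of sequences in C^n *)

Section Convergence.
Variables (R : realType) (n : nat).
Local Notation E := 'Cv[R]_n.
Implicit Types (u v : nat -> E) (L : E) (e : R).

Definition hcvg u L := forall e, 0 < e -> \forall N \near \oo, hnorm (u N - L) < e.

Lemma hcvgD u v L L' : hcvg u L -> hcvg v L' -> hcvg (fun N => u N + v N) (L + L').
Proof.
move=> uL vL e e0; have e2 : 0 < e / 2 by rewrite divr_gt0.
apply: filterS (filterI (uL _ e2) (vL _ e2)) => N [h1 h2].
by rewrite opprD addrACA [e]splitr; exact: ltr_hnormD.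
Qed.

Lemma hcvgZ (c : R[i]) u L : hcvg u L -> hcvg (fun N => c *: u N) (c *: L).
Proof.
move=> uL e e0; have c1 : 0 < normc c + 1 by rewrite ltr_wpDl ?normc_ge0.
have ec : 0 < e / (normc c + 1) by rewrite divr_gt0.
apply: filterS (uL _ ec) => N; rewrite ltr_pdivlMr// => h.
rewrite -scalerBr hnormZ; apply: le_lt_trans h; rewrite mulrC.
by rewrite ler_wpM2l ?hnorm_ge0// lerDl.
Qed.

Lemma hcvg_sum (I : Type) (s : seq I) (u : I -> nat -> E) (L : I -> E) :
  (forall i, hcvg (u i) (L i)) ->
  hcvg (fun N => \sum_(i <- s) u i N) (\sum_(i <- s) L i).
Proof.
move=> uL; elim: s => [|i s IH].
  by move=> e e0; apply: nearW => N; rewrite !big_nil subr0 hnorm0.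
have := hcvgD (uL i) IH; rewrite /hcvg big_cons => h e e0.
by apply: filterS (h e e0) => N; rewrite big_cons.
Qed.

Lemma hcvg_le u L a B : hcvg u L ->
  (forall e, 0 < e -> \forall N \near \oo, hnorm (u N - a) <= B + e) ->
  hnorm (L - a) <= B.
Proof.
move=> uL uB; apply/ler_addgt0Pr => e e0; have e2 : 0 < e / 2 by rewrite divr_gt0.
have [N [h1 h2]] := filter_ex (filterI (uL _ e2) (uB _ e2)).
have -> : L - a = (L - u N) + (u N - a) by rewrite addrA subrK.
apply: le_trans (ler_hnormD _ _) _; rewrite hnormBC in h1; lra.
Qed.

Lemma real_cauchy_cvg (w : nat -> R) :
  (forall e, 0 < e -> exists l, \forall N \near \oo, `|w N - l| < e) ->
  exists l, forall e, 0 < e -> \forall N \near \oo, `|w N - l| < e.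
Proof.
move=> wC; have /cauchy_cvgP wcv : cauchy (w @ \oo).
  apply: cauchy_exP => e e0; have [l lP] := wC _ e0; exists l.
  by apply: filterS lP => N /=; rewrite /ball /= distrC.
exists (lim (w @ \oo)) => e e0.
by move/cvgrPdist_lt : wcv => /(_ _ e0); apply: filterS => N; rewrite distrC.
Qed.

(** The Cauchy criterion with an approximate limit depending on e, which is the form that
    [laurent_sum_cvg] and [holo_limit] provide. *)
Lemma hcvg_complete u :
  (forall e, 0 < e -> exists L, \forall N \near \oo, hnorm (u N - L) < e) ->
  exists L, hcvg u L.
Proof.
move=> uC.
have reC i : exists l, forall e, 0 < e -> \forall N \near \oo, `|complex.Re (u N 0 i) - l| < e.
  apply: real_cauchy_cvg => e e0; have [L LP] := uC _ e0; exists (complex.Re (L 0 i)).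
  apply: filterS LP => N; apply: le_lt_trans.
  apply: le_trans (normc_coord _ i); rewrite !mxE -ler_sqr ?nnegrE// normc_sqr.
  rewrite real_normK ?num_real//; case: (u N 0 i) (L 0 i) => a b [c d] /=.
  by rewrite lerDl sqr_ge0.
have imC i : exists l, forall e, 0 < e -> \forall N \near \oo, `|complex.Im (u N 0 i) - l| < e.
  apply: real_cauchy_cvg => e e0; have [L LP] := uC _ e0; exists (complex.Im (L 0 i)).
  apply: filterS LP => N; apply: le_lt_trans.
  apply: le_trans (normc_coord _ i); rewrite !mxE -ler_sqr ?nnegrE// normc_sqr.
  rewrite real_normK ?num_real//; case: (u N 0 i) (L 0 i) => a b [c d] /=.
  by rewrite lerDr sqr_ge0.
have [re reP] := choice reC; have [im imP] := choice imC.
exists (\row_i (re i +i* im i)%C) => e e0.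
(* The coordinates give 2 n real errors; the additional 1 keeps the denominator positive for n = 0
   and the final inequality strict. *)
have e1 : 0 < e / (2 * n%:R + 1).
  by rewrite divr_gt0 // ltr_wpDl// mulr_ge0.
have : \forall N \near \oo, forall i : 'I_n, `|complex.Re (u N 0 i) - re i| < e / (2 * n%:R + 1)
    /\ `|complex.Im (u N 0 i) - im i| < e / (2 * n%:R + 1).
  apply: filter_forall => i; exact: filterI (reP i _ e1) (imP i _ e1).
apply: filterS => N uN; apply: le_lt_trans (hnorm_le_sum _) _.
apply: (@le_lt_trans _ _ (\sum_(i < n) 2 * (e / (2 * n%:R + 1)))).
  apply: ler_sum => i _; rewrite !mxE; apply: le_trans (normc_le_ReIm _) _.
  by have [] := uN i; case: (u N 0 i) => a b /=; lra.
rewrite sumr_const card_ord -[_ *+ n]mulr_natl.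
have -> : n%:R * (2 * (e / (2 * n%:R + 1))) = e * ((2 * n%:R) / (2 * n%:R + 1)) :> R.
  by field; rewrite gt_eqF// ltr_wpDl// mulr_ge0.
by rewrite gtr_pMr// ltr_pdivrMr ?mul1r ?ltrDl// ltr_wpDl// mulr_ge0.
Qed.

End Convergence.

(** * The Cauchy kernel *)

Section Cauchy.
Variables (R : realType) (n : nat).
Local Notation E := 'Cv[R]_n.
Implicit Types (f g : R[i] -> E) (v : E) (a z w : R[i]) (x e B M rho : R).

(** Product rule with its remainder in closed form: w / (w - a) has derivative - a / (w - a)^2, p
    stands for the first order error of f, and q for f z - v. *)
Lemma kernel_expand (p q D : E) a z h : z - a != 0 -> z + h - a != 0 ->
  ((z + h) / (z + h - a)) *: (p + q + h *: D) - (z / (z - a)) *: q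
    - h *: ((z / (z - a)) *: D - (a / (z - a) ^+ 2) *: q) =
  ((z + h) / (z + h - a)) *: p +
  ((a * h ^+ 2 / ((z - a) ^+ 2 * (z + h - a))) *: q
    - (a * h ^+ 2 / ((z - a) * (z + h - a))) *: D).
Proof.
move=> za zha; apply/rowP => i; rewrite !mxE; field.
by rewrite za zha.
Qed.

Lemma cderivable_kernel f z a v : cderivable f z -> z != a ->
  cderivable (fun w => (w / (w - a)) *: (f w - v)) z.
Proof.
move=> [D fD] za; have za0 : z - a != 0 by rewrite subr_eq0.
exists ((z / (z - a)) *: D - (a / (z - a) ^+ 2) *: (f z - v)) => e e0.
pose r : R := normc (z - a); have r0 : 0 < r by rewrite normc_gt0.
have r10 : 0 < r + 1 by rewrite addr_gt0.
pose P := normc z + 1; have P0 : 0 < P by rewrite ltr_wpDl ?normc_ge0.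
pose A := normc a + 1; have A0 : 0 < A by rewrite ltr_wpDl ?normc_ge0.
pose Q := hnorm (f z - v) + hnorm D + 1.
have Q0 : 0 < Q by rewrite ltr_wpDl ?addr_ge0 ?hnorm_ge0.
have e1 : 0 < e * r / (4 * P) by rewrite divr_gt0 ?mulr_gt0.
have [d d0 dP] := fD _ e1.
pose d' := Num.min (Num.min d 1) (Num.min (r / 2) (e * r ^+ 3 / (8 * A * Q * (r + 1)))).
exists d'.
  rewrite /d' !lt_min d0 ltr01 /=; apply/andP; split; first by rewrite divr_gt0.
  by rewrite divr_gt0 ?mulr_gt0 ?exprn_gt0.
move=> w; rewrite !lt_min => /andP[/andP[wd w1] /andP[wr we]].
have fw := dP w wd.
set h := w - z in wd w1 wr we fw *.
have wE : w = z + h by rewrite /h subrKC.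
have wa : r / 2 <= normc (w - a).
  have -> : w - a = (z - a) - (- h) by rewrite wE; ring.
  have := le_normcD (z - a - - h) (- h); rewrite subrK normcN -/r; lra.
have wa_gt0 : 0 < normc (w - a) by apply: lt_le_trans wa; rewrite divr_gt0.
have wa0 : w - a != 0 by rewrite -normc_gt0.
(* First order expansion of [w / (w - a)] at z, with its exact remainder. *)
have expand : (w / (w - a)) *: (f w - v) - (z / (z - a)) *: (f z - v)
    - h *: ((z / (z - a)) *: D - (a / (z - a) ^+ 2) *: (f z - v)) =
  (w / (w - a)) *: (f w - f z - h *: D) +
  ((a * h ^+ 2 / ((z - a) ^+ 2 * (w - a))) *: (f z - v)
    - (a * h ^+ 2 / ((z - a) * (w - a))) *: D).
  have -> : f w - v = (f w - f z - h *: D) + (f z - v) + h *: D.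
    by rewrite addrAC subrK addrA subrK.
  by rewrite wE; apply: kernel_expand => //; rewrite -wE.
rewrite /= expand.
have nP : normc (w / (w - a)) <= 2 * P / r.
  rewrite Normc.normcM Normc.normcV ler_pdivrMr//.
  have : normc w <= P by rewrite wE /P; apply: le_trans (le_normcD _ _) _; rewrite lerD2l ltW.
  move=> wP; apply: le_trans wP _.
  rewrite {1}(_ : P = 2 * P / r * (r / 2)); last by field; rewrite gt_eqF.
  by rewrite ler_wpM2l// divr_ge0 ?mulr_ge0 ?(ltW r0)// ltW.
have h0 := normc_ge0 h.
have T1 : hnorm ((w / (w - a)) *: (f w - f z - h *: D)) <= e / 2 * normc h.
  rewrite hnormZ; apply: le_trans (ler_pM _ _ nP fw) _; rewrite ?normc_ge0 ?hnorm_ge0//.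
  rewrite le_eqVlt; apply/orP; left; apply/eqP; field.
  by rewrite !gt_eqF.
have K1 : normc h * (8 * A * Q * (r + 1)) <= e * r ^+ 3.
  by rewrite -ler_pdivlMr ?mulr_gt0// ltW.
(* One bound for both quadratic remainders, whose denominators contain k of modulus c = r^2 or c =
   r; the condition c (r + 1) >= r^2 covers the two cases. *)
have T23 (c : R) (q : E) k : hnorm q <= Q -> 0 < c -> normc k = c -> 
   c * (r + 1) >= r ^+ 2 -> 
   hnorm ((a * h ^+ 2 / (k * (w - a))) *: q) <= e / 4 * normc h.
  move=> qQ c0 kc cr.
  rewrite hnormZ !Normc.normcM Normc.normcV Normc.normcM kc.
  have kw0 : 0 < c * normc (w - a) by rewrite mulr_gt0.
  rewrite mulrAC ler_pdivrMr//.
  have aA : normc a <= A by rewrite /A lerDl.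
  apply: (@le_trans _ _ (A * (normc h * normc h) * Q)).
    by rewrite ler_pM ?mulr_ge0 ?hnorm_ge0 ?normc_ge0// ler_wpM2r ?mulr_ge0 ?normc_ge0.
  apply: (@le_trans _ _ (e / 4 * normc h * (c * (r / 2)))); last first.
    by rewrite ler_wpM2l ?ler_wpM2l ?(ltW c0)// mulr_ge0// divr_ge0// ltW.
  have -> : A * (normc h * normc h) * Q = normc h * (A * Q * normc h) by ring.
  have -> : e / 4 * normc h * (c * (r / 2)) = normc h * (e * c * r / 8) by field.
  rewrite ler_wpM2l// -(ler_pM2r (_ : 0 < 8 * (r + 1))) ?mulr_gt0//.
  have -> : A * Q * normc h * (8 * (r + 1)) = normc h * (8 * A * Q * (r + 1)) by ring.
  apply: le_trans K1 _.
  have -> : e * c * r / 8 * (8 * (r + 1)) = e * r * (c * (r + 1)) by field.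
  have -> : e * r ^+ 3 = e * r * r ^+ 2 by ring.
  by rewrite ler_wpM2l// mulr_ge0 ?(ltW r0) ?(ltW e0).
have T2 : hnorm ((a * h ^+ 2 / ((z - a) ^+ 2 * (w - a))) *: (f z - v)) <= e / 4 * normc h.
  apply: (T23 (r ^+ 2)); rewrite ?exprn_gt0 ?normcX//.
    by rewrite /Q; move: (hnorm_ge0 D); clear; lra.
  by rewrite ler_peMr ?sqr_ge0// lerDr ltW.
have T3 : hnorm ((a * h ^+ 2 / ((z - a) * (w - a))) *: D) <= e / 4 * normc h.
  apply: (T23 r) => //.
    by rewrite /Q; move: (hnorm_ge0 (f z - v)); clear; lra.
  by rewrite expr2 ler_wpM2l ?(ltW r0)// lerDl.
apply: le_trans (ler_hnormD _ _) _.
have := ler_hnormB ((a * h ^+ 2 / ((z - a) ^+ 2 * (w - a))) *: (f z - v))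
  ((a * h ^+ 2 / ((z - a) * (w - a))) *: D); move: T1 T2 T3; clear; lra.
Qed.

Lemma cderivable_continuous f z : cderivable f z -> forall e, 0 < e ->
  exists2 d : R, 0 < d & forall w, normc (w - z) < d -> hnorm (f w - f z) < e.
Proof.
move=> [D fD] e e0; have [d d0 dP] := fD 1 ltr01.
have D0 : 0 < hnorm D + 1 by rewrite ltr_wpDl ?hnorm_ge0.
exists (Num.min d (e / (hnorm D + 1))); first by rewrite lt_min d0 divr_gt0.
move=> w; rewrite lt_min ltr_pdivlMr// => /andP[wd we].
have -> : f w - f z = (f w - f z - (w - z) *: D) + (w - z) *: D by rewrite subrK.
apply: le_lt_trans (ler_hnormD _ _) _; rewrite hnormZ.
by have := dP w wd; lra.
Qed.

Lemma circle_sumB f g x N :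
  circle_sum (fun z => f z - g z) x N = circle_sum f x N - circle_sum g x N.
Proof. exact: (@riemann_sumB _ _ (fun t => f (cexp x t)) (fun t => g (cexp x t))). Qed.

End Cauchy.

(** * Cauchy's formula and Taylor expansion on a disc *)

Section Taylor.
Variables (R : realType) (n : nat).
Local Notation E := 'Cv[R]_n.
Implicit Types (f g : R[i] -> E) (v : E) (a z w : R[i]) (x e B M rho : R).

Lemma eq_circle_sum f g x N : (forall z, normc z = expR x -> f z = g z) ->
  circle_sum f x N = circle_sum g x N.
Proof.
move=> fg; apply: eq_riemann_sum => t; apply: fg; exact: normc_cexp.
Qed.

Lemma circle_sumD f g x N :
  circle_sum (fun z => f z + g z) x N = circle_sum f x N + circle_sum g x N.
Proof.
apply/eqP; rewrite -subr_eq -circle_sumB; apply/eqP/eq_circle_sum => z _.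
by rewrite addrK.
Qed.

Lemma circle_sumZ (c : R[i]) f x N :
  circle_sum (fun z => c *: f z) x N = c *: circle_sum f x N.
Proof.
by rewrite /circle_sum /riemann_sum -scaler_sumr !scalerA mulrC.
Qed.

Lemma circle_sum_sum (I : Type) (s : seq I) (f : I -> R[i] -> E) x N :
  circle_sum (fun z => \sum_(i <- s) f i z) x N = \sum_(i <- s) circle_sum (f i) x N.
Proof.
elim: s => [|i s IH].
  rewrite big_nil (@eq_circle_sum _ (cst 0)); last by move=> z _; rewrite big_nil.
  by rewrite /circle_sum /riemann_sum big1 ?scaler0.
rewrite big_cons -IH -circle_sumD; apply: eq_circle_sum => z _.
by rewrite big_cons.
Qed.

Lemma circle_sum_cst v x N : circle_sum (cst v) x N = ((pi *+ 2)%:C)%C *: v.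
Proof. exact: riemann_sum_cst. Qed.

Lemma normc_kernel a z : normc a < normc z ->
  normc (z / (z - a)) <= normc z / (normc z - normc a).
Proof.
move=> az; rewrite Normc.normcM Normc.normcV ler_wpM2l ?normc_ge0//.
have h : normc z - normc a <= normc (z - a).
  by have := le_normcD (z - a) a; rewrite subrK; lra.
have h0 : 0 < normc z - normc a by rewrite subr_gt0.
by rewrite lef_pV2// posrE// (lt_le_trans h0 h).
Qed.

(** The circle can be enlarged without crossing a, and on a large circle z / (z - a) - 1 = a / (z -
    a) is small. *)
Lemma circle_kernel_cvg v a rho : normc a < rho ->
  hcvg (circle_sum (fun z => (z / (z - a)) *: v) (ln rho)) (((pi *+ 2)%:C)%C *: v).
Proof.
move=> arho e e0.
have a0 := normc_ge0 a; have v0 := hnorm_ge0 v.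
have rho0 : 0 < rho by apply: le_lt_trans arho.
have pi0 := pi_gt0 R.
pose C := pi *+ 2 * (normc a * hnorm v).
have C0 : 0 <= C by rewrite /C; pos.
(* On the circle of radius rho' + 1 the sums of (a / (z - a)) v are at most C / (rho' + 1 - |a|) <=
   e / 2. *)
pose rho' := rho + normc a + 2 * C / e.
have Ce0 : 0 <= 2 * C / e by rewrite divr_ge0 ?(mulr_ge0 _ C0) ?(ltW e0).
have rr' : rho < rho' + 1 by rewrite /rho'; lra.
have ar' : normc a < rho' + 1 by rewrite /rho'; lra.
have r'0 : 0 < rho' + 1 by lra.
have e2 : 0 < e / 2 by rewrite divr_gt0.
have el : expR (ln rho) = rho by rewrite lnK.
have el' : expR (ln (rho' + 1)) = rho' + 1 by rewrite lnK.
have ra : 0 < rho - normc a by rewrite subr_gt0.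
have : \forall N \near \oo, hnorm (circle_sum (fun z => (z / (z - a)) *: (v - 0)) (ln (rho' + 1)) N
   - circle_sum (fun z => (z / (z - a)) *: (v - 0)) (ln rho) N) < e / 2.
  apply: (@circle_sum_indep _ _ _ a ((rho' + 1) / (rho - normc a) * hnorm v)) => //.
  - by rewrite ltr_ln.
  - move=> z; rewrite el el' subr0 => /andP[z1 z2].
    have az : normc a < normc z by lra.
    rewrite hnormZ ler_wpM2r ?hnorm_ge0//; apply: le_trans (normc_kernel az) _.
    rewrite ler_pM ?normc_ge0 ?invr_ge0 ?subr_ge0 ?(ltW az)//.
    by rewrite lef_pV2 ?posrE ?subr_gt0// lerD2r.
  - move=> z _ za; apply: (@cderivable_kernel _ _ (cst v)) => //.
    exists 0 => e' e'0; exists 1 => // w _; rewrite /= subrr scaler0 subr0 hnorm0.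
    by rewrite mulr_ge0 ?normc_ge0// ltW.
have far N : hnorm (circle_sum (fun z => (z / (z - a)) *: (v - 0)) (ln (rho' + 1)) N -
    ((pi *+ 2)%:C)%C *: v) <= e / 2.
  rewrite -(circle_sum_cst v (ln (rho' + 1)) N) -circle_sumB.
  apply: le_trans (_ : pi *+ 2 * (normc a / (rho' + 1 - normc a) * hnorm v) <= _); last first.
    have d0 : 0 < rho' + 1 - normc a by rewrite subr_gt0.
    have -> : pi *+ 2 * (normc a / (rho' + 1 - normc a) * hnorm v) = C / (rho' + 1 - normc a).
      by rewrite /C; field; rewrite gt_eqF.
    rewrite ler_pdivrMr//; have : 2 * C <= e * (rho' + 1 - normc a).
      by rewrite [leRHS]mulrC -ler_pdivrMr// /rho'; lra.
    lra.
  apply: circle_sum_le => z; rewrite el' => zr.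
  have za0 : z - a != 0.
    by apply/eqP => /eqP; rewrite subr_eq0 => /eqP za; move: ar'; rewrite -zr za ltxx.
  have -> : (z / (z - a)) *: (v - 0) - cst v z = (a / (z - a)) *: v.
    by rewrite subr0 /= -[X in _ - X]scale1r -scalerBl; congr (_ *: _); field.
  rewrite hnormZ ler_wpM2r ?hnorm_ge0// Normc.normcM Normc.normcV ler_wpM2l ?normc_ge0//.
  rewrite lef_pV2 ?posrE ?subr_gt0 ?normc_gt0//.
  by have := le_normcD (z - a) a; rewrite subrK zr; lra.
apply: filterS => N h.
have -> : circle_sum (fun z => (z / (z - a)) *: v) (ln rho) N =
   circle_sum (fun z => (z / (z - a)) *: (v - 0)) (ln rho) N.
  by apply: eq_circle_sum => z _; rewrite subr0.
have := far N; move: h.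
move: (circle_sum _ _ N) (circle_sum _ _ N) (_ *: v) => p q s h1 h2.
have -> : p - s = (q - s) - (q - p) by apply/rowP => i; rewrite !mxE; ring.
apply: le_lt_trans (ler_hnormB _ _) _; lra.
Qed.

Section OnDisc.
Variables (f : R[i] -> E) (rho M : R).
Hypothesis rho0 : 0 < rho.
Hypothesis df : forall z, normc z <= rho -> cderivable f z.
Hypothesis fM : forall z, normc z <= rho -> hnorm (f z) <= M.

(** Cauchy's formula. Subtracting f a keeps the kernel bounded near a, so the radius may be shrunk
    past |a|; on tiny circles around 0, which stay away from a as a is nonzero, the factor z makes
    the sums small. *)
Lemma circle_cauchy_cvg a : a != 0 -> normc a < rho ->
  hcvg (circle_sum (fun z => (z / (z - a)) *: f z) (ln rho)) (((pi *+ 2)%:C)%C *: f a).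
Proof.
move=> a0 arho; rewrite -normc_gt0 in a0.
have pi0 := pi_gt0 R.
have M0 : 0 <= M by apply: le_trans (hnorm_ge0 _) (fM (ltW arho)).
pose G z := (z / (z - a)) *: (f z - f a).
suff G0 : hcvg (circle_sum G (ln rho)) 0.
  have := hcvgD G0 (circle_kernel_cvg (f a) arho); rewrite add0r.
  move=> h e e0; apply: filterS (h e e0) => N; rewrite -circle_sumD.
  rewrite (@eq_circle_sum _ (fun z => (z / (z - a)) *: f z))// => z _.
  by rewrite /G -scalerDr subrK.
have [D fD] := df (ltW arho).
have [d d0 dP] := fD 1 ltr01.
have el : expR (ln rho) = rho by rewrite lnK.
have GB z : normc z <= rho -> hnorm (G z) <= rho * (1 + hnorm D) + rho / d * (2 * M).
  move=> zr; have [->|za] := eqVneq z a.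
    by rewrite {1}/G [f a - f a]subrr scaler0 hnorm0; pos.
  rewrite /G hnormZ Normc.normcM Normc.normcV.
  have za0 : 0 < normc (z - a) by rewrite normc_gt0 subr_eq0.
  have [zd|zd] := ltP (normc (z - a)) d.
    apply: (@le_trans _ _ (rho * (1 + hnorm D))); last first.
      by rewrite lerDl mulr_ge0 ?divr_ge0 ?mulr_ge0// ltW.
    have h : hnorm (f z - f a) <= (1 + hnorm D) * normc (z - a).
      have -> : f z - f a = (f z - f a - (z - a) *: D) + (z - a) *: D by rewrite subrK.
      apply: le_trans (ler_hnormD _ _) _; rewrite hnormZ.
      by have := dP _ zd; lra.
    rewrite -mulrA ler_pM ?normc_ge0 ?mulr_ge0 ?invr_ge0 ?normc_ge0 ?hnorm_ge0//.
    by rewrite mulrC ler_pdivrMr.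
  apply: (@le_trans _ _ (rho / d * (2 * M))); last first.
    by rewrite lerDr mulr_ge0 ?addr_ge0 ?hnorm_ge0// ltW.
  rewrite ler_pM ?mulr_ge0 ?invr_ge0 ?normc_ge0 ?hnorm_ge0//.
    by rewrite ler_pM ?invr_ge0 ?normc_ge0// lef_pV2 ?posrE.
  apply: le_trans (ler_hnormB _ _) _.
  by have := fM zr; have := fM (ltW arho); lra.
move=> e e0; pose rho1 := Num.min (normc a / 2) (e * normc a / (16 * pi * (M + 1))).
have M1 : 0 < M + 1 by rewrite ltr_wpDl.
have r10 : 0 < rho1 by rewrite lt_min !divr_gt0 ?mulr_gt0.
have r1a : rho1 <= normc a / 2 by rewrite ge_min lexx.
have r1r : rho1 < rho by lra.
have el1 : expR (ln rho1) = rho1 by rewrite lnK.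
have e2 : 0 < e / 2 by rewrite divr_gt0.
have near N : hnorm (circle_sum G (ln rho1) N) <= e / 2.
  apply: le_trans (_ : pi *+ 2 * (rho1 / (normc a / 2) * (2 * M)) <= _).
    apply: circle_sum_le => z; rewrite el1 => zr.
    rewrite hnormZ Normc.normcM Normc.normcV zr.
    rewrite ler_pM ?mulr_ge0 ?invr_ge0 ?normc_ge0 ?hnorm_ge0 ?(ltW r10)//.
      have h : normc a / 2 <= normc (z - a).
        by have := le_normcD (z - a) (- z); rewrite addrAC subrr add0r !normcN zr; lra.
      have h0 : 0 < normc a / 2 by rewrite divr_gt0.
      by rewrite ler_wpM2l ?(ltW r10)// lef_pV2 ?posrE// (lt_le_trans h0 h).
    apply: le_trans (ler_hnormB _ _) _.
    have zr' : normc z <= rho by rewrite zr ltW.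
    by have := fM zr'; have := fM (ltW arho); lra.
  have h : rho1 * (16 * pi * (M + 1)) <= e * normc a.
    by rewrite -ler_pdivlMr ?mulr_gt0// ge_min lexx orbT.
  have -> : pi *+ 2 * (rho1 / (normc a / 2) * (2 * M)) = rho1 * (8 * pi * M) / normc a.
    by field; rewrite gt_eqF.
  rewrite ler_pdivrMr//.
  have : 0 <= rho1 * pi by rewrite mulr_ge0 ?(ltW r10)// ltW.
  nra.
have : \forall N \near \oo, hnorm (circle_sum G (ln rho) N - circle_sum G (ln rho1) N) < e / 2.
  apply: (@circle_sum_indep _ _ _ a (rho * (1 + hnorm D) + rho / d * (2 * M))) => //.
  - by rewrite ltr_ln.
  - by move=> z; rewrite el => /andP[_]; exact: GB.
  - by move=> z; rewrite el => /andP[_ zr] za; apply: cderivable_kernel => //; exact: df.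
apply: filterS => N h; rewrite subr0 -(subrK (circle_sum G (ln rho1) N) (circle_sum G (ln rho) N)).
by apply: le_lt_trans (ler_hnormD _ _) _; have := near N; lra.
Qed.

(** Tends to 2 pi times the k-th Taylor coefficient of f at 0. *)
Definition laurent_sum k N : E := circle_sum (fun z => z ^- k *: f z) (ln rho) N.

(** On the circle, z / (z - a) is the geometric sum of the (a / z)^k for k < K plus the tail (a /
    z)^K z / (z - a), whose circle sum gives the first error term. *)
Lemma cauchy_expansion a K : a != 0 -> normc a < rho -> forall e, 0 < e ->
  \forall N \near \oo, hnorm (((pi *+ 2)%:C)%C *: f a - \sum_(k < K) a ^+ k *: laurent_sum k N)
    <= pi *+ 2 * (M * (normc a / rho) ^+ K / (1 - normc a / rho)) + e.
Proof.
move=> a0 arho e e0; apply: filterS (circle_cauchy_cvg a0 arho e0) => N.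
have el : expR (ln rho) = rho by rewrite lnK.
pose T := circle_sum (fun z => ((a / z) ^+ K * (z / (z - a))) *: f z) (ln rho) N.
have -> : circle_sum (fun z => (z / (z - a)) *: f z) (ln rho) N =
   \sum_(k < K) a ^+ k *: laurent_sum k N + T.
  under eq_bigr do rewrite -circle_sumZ.
  rewrite -circle_sum_sum -circle_sumD; apply: eq_circle_sum => z; rewrite el => zr.
  have z0 : z != 0 by rewrite -normc_gt0 zr.
  have za : z - a != 0.
    by apply/eqP => /eqP; rewrite subr_eq0 => /eqP za; move: arho; rewrite -zr za ltxx.
  under eq_bigr do rewrite scalerA -expr_div_n.
  rewrite -scaler_suml -scalerDl; congr (_ *: _).
  have az : 1 - a / z != 0.
    by rewrite -(mulfV z0) -mulrBl mulf_neq0// invr_eq0.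
  have -> : z / (z - a) = (1 - a / z)^-1 by field; rewrite z0 za.
  have := subrX1 (a / z) K; move: (\sum_(i < K) _) => S h.
  apply: (mulfI az); rewrite mulrDr mulfV// [X in _ + X]mulrCA mulfV// mulr1.
  have -> : (1 - a / z) * S = - ((a / z - 1) * S) by ring.
  by rewrite -h; ring.
move=> h; rewrite hnormBC.
move: h; move: (_ *: f a) (\sum_(k < K) _) => p q h.
have -> : q - p = (q + T - p) - T by rewrite addrAC addrK.
apply: le_trans (ler_hnormB _ _) _; rewrite addrC lerD ?(ltW h)//.
have ar : 0 < 1 - normc a / rho by rewrite subr_gt0 ltr_pdivrMr// mul1r.
apply: circle_sum_le => z; rewrite el => zr.
have az : normc a < normc z by rewrite zr.
rewrite hnormZ Normc.normcM normcX Normc.normcM Normc.normcV zr.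
rewrite [leRHS](_ : _ = (normc a / rho) ^+ K * (rho / (rho - normc a)) * M); last first.
  by field; rewrite !gt_eqF// subr_gt0.
rewrite ler_pM ?mulr_ge0 ?hnorm_ge0 ?normc_ge0 ?exprn_ge0 ?divr_ge0 ?normc_ge0 ?(ltW rho0)//.
  rewrite ler_wpM2l ?exprn_ge0 ?divr_ge0 ?normc_ge0 ?(ltW rho0)//.
  by have := normc_kernel az; rewrite zr.
by apply: fM; rewrite zr.
Qed.

Lemma laurent_sum_le k N : hnorm (laurent_sum k N) <= pi *+ 2 * (M / rho ^+ k).
Proof.
apply: circle_sum_le => z; rewrite lnK// => zr.
rewrite hnormZ Normc.normcV normcX zr mulrC ler_wpM2r ?invr_ge0 ?exprn_ge0 ?(ltW rho0)//.
by apply: fM; rewrite zr.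
Qed.

(** Induction on k. In the expansion at a small a = t, cut after order k, the terms below k
    converge; dividing by t^k shows that the k-th sums eventually stay within O(t) of a fixed
    vector, and t is arbitrary. *)
Lemma laurent_sum_cvg k : exists L, hcvg (laurent_sum k) L.
Proof.
elim/ltn_ind: k => k IH.
have pi0 := pi_gt0 R.
have M0 : 0 <= M by apply: le_trans (hnorm_ge0 _) (@fM 0 _); rewrite Normc.normc0 ltW.
have [L LP] : exists L : nat -> E, forall j, (j < k)%N -> hcvg (laurent_sum j) (L j).
  have : forall j, exists L, (j < k)%N -> hcvg (laurent_sum j) L.
    move=> j; have [jk|jk] := ltnP j k; last by exists 0.
    by have [L] := IH j jk; exists L.
  by move=> h; have [L LP] := choice h; exists L.
apply: hcvg_complete => e e0.
pose C := pi *+ 2 * M * 2 / rho ^+ k.+1.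
have C0 : 0 <= C by rewrite /C; pos.
pose t := Num.min (rho / 2) (e / (4 * (C + 1))).
have C1 : 0 < C + 1 by rewrite ltr_wpDl.
have t0 : 0 < t by rewrite lt_min !divr_gt0 ?mulr_gt0.
have tr : t <= rho / 2 by rewrite ge_min lexx.
have tC : C * t <= e / 4.
  have : t * (4 * (C + 1)) <= e by rewrite -ler_pdivlMr ?mulr_gt0// ge_min lexx orbT.
  nra.
pose a : R[i] := (t%:C)%C.
have na : normc a = t by rewrite normc_real ger0_norm// ltW.
have a0 : a != 0 by rewrite -normc_gt0 na.
have arho : normc a < rho by rewrite na; lra.
have tk : 0 < t ^+ k by rewrite exprn_gt0.
have ek : 0 < e / 4 * t ^+ k by rewrite mulr_gt0// divr_gt0.
exists (a ^- k *: (((pi *+ 2)%:C)%C *: f a - \sum_(j < k) a ^+ j *: L j)).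
have h1 := cauchy_expansion k.+1 a0 arho ek.
have h2 : hcvg (fun N => \sum_(j < k) a ^+ j *: laurent_sum j N) (\sum_(j < k) a ^+ j *: L j).
  by apply: hcvg_sum => j; apply: hcvgZ; exact: LP.
apply: filterS (filterI h1 (h2 _ ek)) => N [{}h1 {}h2].
have npow (p : E) : t ^+ k * hnorm p = hnorm (a ^+ k *: p) by rewrite hnormZ normcX na.
have kk (p : E) : a ^+ k *: (a ^- k *: p) = p.
  rewrite scalerA [X in X *: _](_ : _ = 1) ?scale1r//.
  by apply: (@mulfV R[i]); rewrite expf_neq0.
rewrite -(ltr_pM2l tk) npow scalerBr kk; move: h1 h2; rewrite na big_ord_recr /=.
move: (laurent_sum k N) (_ *: f a) (\sum_(j < k) _) (\sum_(j < k) _) => u p s q.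
have hb : pi *+ 2 * (M * (t / rho) ^+ k.+1 / (1 - t / rho)) <= C * t * t ^+ k.
  have tr2 : 1 / 2 <= 1 - t / rho by rewrite lerBrDl -lerBrDr ler_pdivrMr//; lra.
  have tr0 : 0 < 1 - t / rho by lra.
  rewrite mulrA ler_pdivrMr//.
  have -> : pi *+ 2 * (M * (t / rho) ^+ k.+1) = C * t * t ^+ k * (1 / 2).
    rewrite /C expr_div_n [t ^+ k.+1]exprS; field.
    by rewrite expf_eq0 gt_eqF// andbF.
  by apply: ler_wpM2l tr2; apply: mulr_ge0 (ltW tk); exact: mulr_ge0 C0 (ltW t0).
move=> h1 h2; have hc := ler_wpM2r (ltW tk) tC.
have tri : hnorm (a ^+ k *: u - (p - s)) <= hnorm (p - (q + a ^+ k *: u)) + hnorm (q - s).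
  rewrite -(hnormN (p - _)) -(hnormN (q - _)); apply: le_trans (ler_hnormD _ _).
  rewrite le_eqVlt; apply/orP; left; apply/eqP; congr hnorm.
  by apply/rowP => i; rewrite !mxE; ring.
by apply: le_lt_trans tri _; lra.
Qed.

Theorem taylor : exists c : nat -> E, (forall k, hnorm (c k) <= M / rho ^+ k) /\
  forall K a, normc a < rho ->
    hnorm (f a - \sum_(k < K) a ^+ k *: c k) <= M * (normc a / rho) ^+ K / (1 - normc a / rho).
Proof.
have pi0 := pi_gt0 R.
have pi20 : 0 < pi *+ 2 :> R by rewrite pmulrn_lgt0.
have [L LP] := choice laurent_sum_cvg.
pose c k : E := (((pi *+ 2)^-1)%:C)%C *: L k.
have LE k : L k = ((pi *+ 2)%:C)%C *: c k.
  by rewrite /c scalerA -rmorphM mulfV ?gt_eqF// scale1r.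
have npi (p : E) : hnorm (((pi *+ 2)%:C)%C *: p) = pi *+ 2 * hnorm p.
  by rewrite hnormZ normc_real ger0_norm// ltW.
have M0 : 0 <= M by apply: le_trans (hnorm_ge0 _) (@fM 0 _); rewrite Normc.normc0 ltW.
have main a K : a != 0 -> normc a < rho ->
    hnorm (f a - \sum_(k < K) a ^+ k *: c k) <= M * (normc a / rho) ^+ K / (1 - normc a / rho).
  move=> a0 ar; rewrite -(ler_pM2l pi20) -npi scalerBr hnormBC.
  have -> : ((pi *+ 2)%:C)%C *: (\sum_(k < K) a ^+ k *: c k) = \sum_(k < K) a ^+ k *: L k.
    rewrite scaler_sumr; apply: eq_bigr => k _.
    by rewrite LE scalerA mulrC -scalerA.
  have cv : hcvg (fun N => \sum_(k < K) a ^+ k *: laurent_sum k N) (\sum_(k < K) a ^+ k *: L k).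
    by apply: hcvg_sum => k; exact: hcvgZ.
  apply: (hcvg_le cv) => e e0; apply: filterS (cauchy_expansion K a0 ar e0) => N.
  by rewrite hnormBC.
exists c; split=> [k|K a ar].
  rewrite -(ler_pM2l pi20) -npi -LE -[L k]subr0.
  apply: (hcvg_le (LP k)) => e e0; apply: nearW => N; rewrite subr0.
  by apply: le_trans (laurent_sum_le k N) _; rewrite lerDl ltW.
have [az|a0] := eqVneq a 0; last exact: main.
rewrite az Normc.normc0 mul0r subr0 divr1; case: K => [|K].
  by rewrite big_ord0 subr0 expr0 mulr1 fM// Normc.normc0 ltW.
(* At a = 0 the claim is f 0 = c 0, which the expansion does not reach directly: it follows from
   [main] with K = 1 at a small b and continuity of f at 0. *)
rewrite expr0n mulr0 big_ord_recl big1 => [|i _]; last by rewrite expr0n scale0r.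
rewrite expr0 scale1r addr0; apply/ler_addgt0Pr => e e0; rewrite add0r.
have e2 : 0 < e / 2 by rewrite divr_gt0.
have d0f : cderivable f 0 by apply: df; rewrite Normc.normc0 ltW.
have [d d0 dP] := cderivable_continuous d0f e2.
have M1 : 0 < M + 1 by rewrite ltr_wpDl.
pose t := Num.min (d / 2) (Num.min (rho / 2) (e * rho / (4 * (M + 1)))).
have t0 : 0 < t by rewrite !lt_min !divr_gt0 ?mulr_gt0.
have td : t <= d / 2 by rewrite ge_min lexx.
have tr : t <= rho / 2 by rewrite !ge_min lexx orbT.
have tM : t * (4 * (M + 1)) <= e * rho.
  by rewrite -ler_pdivlMr ?mulr_gt0// !ge_min lexx !orbT.
pose b : R[i] := (t%:C)%C.
have nb : normc b = t by rewrite normc_real ger0_norm// ltW.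
have b0 : b != 0 by rewrite -normc_gt0 nb.
have := main b 1%N b0; rewrite nb big_ord_recl big_ord0 expr0 scale1r addr0 expr1.
have -> : t < rho by lra.
move=> /(_ isT) h1.
have h2 : hnorm (f b - f 0) < e / 2 by apply: dP; rewrite subr0 nb; lra.
have h3 : M * (t / rho) / (1 - t / rho) <= e / 2.
  have tr2 : t / rho <= 1 / 2 by rewrite ler_pdivrMr//; lra.
  rewrite ler_pdivrMr; last lra.
  apply: (@le_trans _ _ (e / 2 * (1 / 2))); last by rewrite ler_wpM2l ?(ltW e2)//; lra.
  rewrite mulrA ler_pdivrMr//; nra.
rewrite (_ : c (Ordinal (ltn0Sn 0)) = c 0%N)// in h1.
have -> : f 0 - c 0%N = - (f b - f 0) + (f b - c 0%N) by rewrite opprB addrA subrK.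
by apply: le_trans (ler_hnormD _ _) _; rewrite hnormN; lra.
Qed.

End OnDisc.

End Taylor.

(** * Cauchy estimates in several variables, by complex lines *)

Section SeveralVariables.
Variables (R : realType) (n : nat).
Local Notation E := 'Cv[R]_n.
Implicit Types (F G : E -> E) (x y z v h : E) (A B : 'M[R[i]^o]_n) (e d M rho : R).

Lemma hnorm_mulmx_le A h : hnorm (h *m A) <= hnorm h * \sum_(i < n) hnorm (row i A).
Proof.
rewrite mulmx_sum_row; apply: le_trans (ler_hnorm_sum _ _) _; rewrite mulr_sumr.
by apply: ler_sum => i _; rewrite hnormZ ler_wpM2r ?hnorm_ge0 ?normc_coord.
Qed.

Lemma sum_hnorm_row_ge0 A : 0 <= \sum_(i < n) hnorm (row i A).
Proof. by apply: sumr_ge0 => i _; exact: hnorm_ge0. Qed.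

Definition has_cdiff F z A := forall e, 0 < e -> exists2 d : R, 0 < d &
  forall h, hnorm h < d -> hnorm (F (z + h) - F z - h *m A) <= e * hnorm h.

Lemma has_cdiffD F G z A B : has_cdiff F z A -> has_cdiff G z B ->
  has_cdiff (fun y => F y + G y) z (A + B).
Proof.
move=> FA GB e e0; have e2 : 0 < e / 2 by rewrite divr_gt0.
have [d1 d10 d1P] := FA _ e2; have [d2 d20 d2P] := GB _ e2.
exists (Num.min d1 d2); first by rewrite lt_min d10.
move=> h; rewrite lt_min => /andP[h1 h2].
have -> : F (z + h) + G (z + h) - (F z + G z) - h *m (A + B) =
  (F (z + h) - F z - h *m A) + (G (z + h) - G z - h *m B).
  rewrite mulmxDr; move: (F _) (F _) (G _) (G _) (_ *m A) (_ *m B) => a b c f g k.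
  by apply/rowP => i; rewrite !mxE; ring.
by apply: le_trans (ler_hnormD _ _) _; move: (d1P h h1) (d2P h h2); clear; lra.
Qed.

Lemma has_cdiff_affine F z A (c l : R[i]) a b :
  has_cdiff F (a + l *: z) A ->
  has_cdiff (fun y => c *: F (a + l *: y) - b) z ((c * l) *: A).
Proof.
move=> FA e e0.
have C0 : 0 < normc c * normc l + 1 by rewrite ltr_wpDl ?mulr_ge0 ?normc_ge0.
have L0 : 0 < normc l + 1 by rewrite ltr_wpDl ?normc_ge0.
have e1 : 0 < e / (normc c * normc l + 1) by rewrite divr_gt0.
have [d d0 dP] := FA _ e1; exists (d / (normc l + 1)); first by rewrite divr_gt0.
move=> h; rewrite ltr_pdivlMr// => hd.
have lh : hnorm (l *: h) < d.
  rewrite hnormZ; apply: le_lt_trans hd; rewrite mulrC ler_wpM2l ?hnorm_ge0//.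
  by rewrite lerDl.
have -> : c *: F (a + l *: (z + h)) - b - (c *: F (a + l *: z) - b) - h *m ((c * l) *: A)
  = c *: (F (a + l *: z + l *: h) - F (a + l *: z) - (l *: h) *m A).
  rewrite scalerDr addrA -scalemxAr -scalemxAl.
  move: (F _) (F _) (h *m A) => p q s.
  by apply/rowP => i; rewrite !mxE; ring.
rewrite hnormZ; apply: le_trans (ler_wpM2l (normc_ge0 c) (dP _ lh)) _.
rewrite hnormZ.
have -> : normc c * (e / (normc c * normc l + 1) * (normc l * hnorm h)) =
   (normc c * normc l) / (normc c * normc l + 1) * (e * hnorm h).
  by field; rewrite gt_eqF.
rewrite ler_piMl ?mulr_ge0 ?hnorm_ge0 ?(ltW e0)//.
by rewrite ler_pdivrMr// mul1r lerDl.
Qed.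

Lemma has_cdiff_linear A y z : has_cdiff (fun w => (w - y) *m A) z A.
Proof.
move=> e e0; exists 1 => // h _; rewrite -mulmxBl -mulmxBl.
have -> : z + h - y - (z - y) - h = 0 by apply/rowP => i; rewrite !mxE; ring.
by rewrite mul0mx hnorm0 mulr_ge0 ?hnorm_ge0// ltW.
Qed.

Lemma has_cdiff_continuous F z A : has_cdiff F z A -> forall e, 0 < e ->
  exists2 d : R, 0 < d & forall y, hnorm (y - z) < d -> hnorm (F y - F z) < e.
Proof.
move=> FA e e0; have [d d0 dP] := FA 1 ltr01.
set S := \sum_(i < n) hnorm (row i A).
have S0 : 0 < S + 1 by rewrite ltr_wpDl ?sum_hnorm_row_ge0.
exists (Num.min d (e / (S + 1))); first by rewrite lt_min d0 divr_gt0.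
move=> y; rewrite lt_min ltr_pdivlMr// => /andP[yd ye].
have := dP _ yd; rewrite subrKC => h1; have h2 := hnorm_mulmx_le A (y - z).
have -> : F y - F z = (F y - F z - (y - z) *m A) + (y - z) *m A by rewrite subrK.
apply: le_lt_trans (ler_hnormD _ _) _; rewrite -/S in h2; lra.
Qed.

Lemma has_cdiff_slice F z A (v : E) (zeta : R[i]) :
  has_cdiff F (z + zeta *: v) A -> cderivable (fun w => F (z + w *: v)) zeta.
Proof.
move=> FA; exists (v *m A) => e e0.
have V0 : 0 < hnorm v + 1 by rewrite ltr_wpDl ?hnorm_ge0.
have e1 : 0 < e / (hnorm v + 1) by rewrite divr_gt0.
have [d d0 dP] := FA _ e1; exists (d / (hnorm v + 1)); first by rewrite divr_gt0.
move=> w; rewrite ltr_pdivlMr// => wd.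
have wv : hnorm ((w - zeta) *: v) < d.
  by rewrite hnormZ; apply: le_lt_trans wd; rewrite ler_wpM2l ?normc_ge0// lerDl.
have := dP _ wv; rewrite -scalemxAl.
have -> : z + zeta *: v + (w - zeta) *: v = z + w *: v.
  by rewrite -addrA -scalerDl subrKC.
move/le_trans; apply; rewrite hnormZ.
have -> : e / (hnorm v + 1) * (normc (w - zeta) * hnorm v) =
  hnorm v / (hnorm v + 1) * (e * normc (w - zeta)) by field; rewrite gt_eqF.
rewrite ler_piMl ?mulr_ge0 ?normc_ge0 ?(ltW e0)//.
by rewrite ler_pdivrMr// mul1r lerDl.
Qed.

Definition bounded_holo F z rho M := forall y, hnorm (y - z) < rho ->
  (exists A, has_cdiff F y A) /\ hnorm (F y) <= M.

Lemma bounded_holo_sub F z rho M y rho' : bounded_holo F z rho M ->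
  hnorm (y - z) + rho' <= rho -> bounded_holo F y rho' M.
Proof.
move=> FM yz w wy; apply: FM; apply: le_lt_trans (ler_hnorm_dist w y z) _; lra.
Qed.

Lemma slice_taylor F z rho M v s : bounded_holo F z rho M -> 0 < s ->
  s * hnorm v < rho ->
  exists c : nat -> E, (forall k, hnorm (c k) <= M / s ^+ k) /\
  forall K a, normc a < s -> hnorm (F (z + a *: v) - \sum_(k < K) a ^+ k *: c k) <=
     M * (normc a / s) ^+ K / (1 - normc a / s).
Proof.
move=> FM s0 sv.
have inball w : normc w <= s -> hnorm (z + w *: v - z) < rho.
  move=> ws; rewrite addrC addrA addNr add0r hnormZ; apply: le_lt_trans sv.
  by rewrite ler_wpM2r ?hnorm_ge0.
apply: (@taylor _ _ (fun w => F (z + w *: v)) s M s0).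
  by move=> w ws; have [[A FA] _] := FM _ (inball w ws); exact: has_cdiff_slice FA.
by move=> w ws; have [] := FM _ (inball w ws).
Qed.

(** Uniqueness of first order expansions: at a = t the expansion with K = 2 and the differential of
    F give a c_1 and a v A up to o(t). *)
Lemma slice_coef01 F z A v (c : nat -> E) s M : 0 < s -> 0 <= M -> has_cdiff F z A ->
  (forall K a, normc a < s -> hnorm (F (z + a *: v) - \sum_(k < K) a ^+ k *: c k) <=
     M * (normc a / s) ^+ K / (1 - normc a / s)) ->
  c 0%N = F z /\ c 1%N = v *m A.
Proof.
move=> s0 M0 FA cP.
have c0 : c 0%N = F z.
  have := cP 1%N 0; rewrite Normc.normc0 scale0r addr0 mul0r expr1 mulr0 mul0r.
  move=> /(_ s0); rewrite big_ord_recl big_ord0 expr0 scale1r addr0 => h.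
  by apply/esym/eqP; rewrite -subr_eq0 -hnorm_eq0 eq_le h hnorm_ge0.
split=> //; apply/eqP; rewrite -subr_eq0 -hnorm_eq0 eq_le hnorm_ge0 andbT.
apply/ler_addgt0Pr => e e0; rewrite add0r.
have V0 : 0 < hnorm v + 1 by rewrite ltr_wpDl ?hnorm_ge0.
have e1 : 0 < e / (2 * (hnorm v + 1)) by rewrite divr_gt0 ?mulr_gt0.
have [d d0 dP] := FA _ e1.
have M1 : 0 < M + 1 by rewrite ltr_wpDl.
pose t := Num.min (s / 2) (Num.min (d / (hnorm v + 1) / 2) (e * s ^+ 2 / (8 * (M + 1)))).
have t0 : 0 < t by rewrite !lt_min !divr_gt0 ?mulr_gt0 ?exprn_gt0.
have ts : t <= s / 2 by rewrite ge_min lexx.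
have td : t <= d / (hnorm v + 1) / 2 by rewrite !ge_min lexx orbT.
have te : t * (8 * (M + 1)) <= e * s ^+ 2.
  by rewrite -ler_pdivlMr ?mulr_gt0// !ge_min lexx !orbT.
pose a : R[i] := (t%:C)%C.
have na : normc a = t by rewrite normc_real ger0_norm// ltW.
have tl : t < s by lra.
have h1 := cP 2%N a; rewrite na in h1; move: (h1 tl) => {}h1.
rewrite !big_ord_recl big_ord0 expr0 scale1r expr1 addr0 /= c0 in h1.
have h2 : hnorm (F (z + a *: v) - F z - a *: (v *m A)) <= e / 2 * t.
  have avd : hnorm (a *: v) < d.
    rewrite hnormZ na; have dv : 0 < d / (hnorm v + 1) by rewrite divr_gt0.
    have : t < d / (hnorm v + 1) by lra.
    rewrite ltr_pdivlMr//; lra.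
  have := dP _ avd; rewrite -scalemxAl => /le_trans; apply; rewrite hnormZ na.
  have -> : e / (2 * (hnorm v + 1)) * (t * hnorm v) =
    hnorm v / (hnorm v + 1) * (e / 2 * t) by field; rewrite gt_eqF.
  rewrite ler_piMl ?mulr_ge0 ?divr_ge0 ?(ltW e0) ?(ltW t0)//.
  by rewrite ler_pdivrMr// mul1r lerDl.
have h3 : M * (t / s) ^+ 2 / (1 - t / s) <= e / 2 * t.
  have ts2 : t / s <= 1 / 2 by rewrite ler_pdivrMr//; lra.
  rewrite ler_pdivrMr; last by move: ts2; clear; lra.
  apply: (@le_trans _ _ (e / 2 * t * (1 / 2))); last first.
    by rewrite ler_wpM2l ?mulr_ge0 ?divr_ge0 ?(ltW e0) ?(ltW t0)//; move: ts2; clear; lra.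
  have -> : M * (t / s) ^+ 2 = t * (t * M / s ^+ 2) by field; rewrite gt_eqF.
  have -> : e / 2 * t * (1 / 2) = t * (e / 4) by field.
  rewrite ler_wpM2l ?(ltW t0)// ler_pdivrMr ?exprn_gt0//; nra.
have : t * hnorm (c 1%N - v *m A) <= t * e.
  rewrite -{1}na -hnormZ scalerBr.
  apply: le_trans (_ : hnorm (F (z + a *: v) - F z - a *: (v *m A)) +
     hnorm (F (z + a *: v) - (F z + a *: c 1%N)) <= _); last lra.
  rewrite -(hnormN (_ - (_ + _))); apply: le_trans (ler_hnormD _ _).
  rewrite le_eqVlt; apply/orP; left; apply/eqP; congr hnorm.
  by move: (F _) (F _) => p q; apply/rowP => i; rewrite !mxE; ring.
by rewrite ler_pM2l.
Qed.

(** The Taylor expansion along the line of h is evaluated at a = 1. The radius s = 3 rho / (4 |h|)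
    stays inside the ball, and |h| <= rho / 2 gives 1 / s <= 2 / 3, so the geometric tail costs a
    factor 3. *)
Lemma holo_estimates F z rho M A : 0 < rho -> bounded_holo F z rho M ->
  has_cdiff F z A -> forall h, hnorm h <= rho / 2 ->
  [/\ hnorm (F (z + h) - F z - h *m A) <= 16 * M / rho ^+ 2 * hnorm h ^+ 2,
      hnorm (h *m A) <= 2 * M / rho * hnorm h &
      hnorm (F (z + h) - F z) <= 4 * M / rho * hnorm h].
Proof.
move=> rho0 FM FA h hr.
have M0 : 0 <= M.
  by have [|_] := FM z; [rewrite subrr hnorm0|exact/le_trans/hnorm_ge0].
have [->|hn0] := eqVneq h 0.
  by rewrite addr0 mul0mx subrr subr0 hnorm0 expr0n !mulr0; split.
have h0 : 0 < hnorm h by rewrite hnorm_gt0.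
pose s := 3 / 4 * rho / hnorm h.
have s0 : 0 < s by rewrite /s; pos.
have sh : s * hnorm h < rho by rewrite /s mulfVK ?gt_eqF//; lra.
have [c [cM cP]] := slice_taylor FM s0 sh.
have [c0 c1] := slice_coef01 s0 M0 FA cP.
have s1 : 1 < s by rewrite /s ltr_pdivlMr//; lra.
have q : 1 / s <= 2 / 3.
  by rewrite /s; rewrite ler_pdivrMr// mulrA ler_pdivlMr//; lra.
have q1 : 1 / s = 4 / 3 * (hnorm h / rho) by rewrite /s; field; rewrite !gt_eqF.
have q0 : 0 < 1 / s by rewrite divr_gt0.
have P K := cP K 1; have {}P K : hnorm (F (z + h) - \sum_(k < K) c k) <= 3 * M * (1 / s) ^+ K.
  have := P K; rewrite Normc.normc1 scale1r => /(_ s1).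
  under eq_bigr do rewrite expr1n scale1r.
  move/le_trans; apply; rewrite ler_pdivrMr; last by lra.
  have : 0 <= M * (1 / s) ^+ K by rewrite mulr_ge0 ?exprn_ge0// ltW.
  by nra.
split.
- have := P 2%N; rewrite !big_ord_recl big_ord0 addr0 /= c0 c1 opprD addrA.
  move/le_trans; apply; rewrite q1.
  rewrite [leLHS](_ : _ = 16 / 3 * (M / rho ^+ 2 * hnorm h ^+ 2)); last by field; rewrite gt_eqF.
  have : 0 <= M / rho ^+ 2 * hnorm h ^+ 2 by pos.
  lra.
- rewrite -c1; apply: le_trans (cM 1%N) _; rewrite expr1 -[M / s]mulr1 -mulrA -[_ * 1]mulrC q1.
  rewrite [leLHS](_ : _ = 4 / 3 * (M / rho * hnorm h)); last by field; rewrite gt_eqF.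
  have : 0 <= M / rho * hnorm h by pos.
  lra.
- have := P 1%N; rewrite !big_ord_recl big_ord0 addr0 c0 expr1 q1.
  move/le_trans; apply.
  by rewrite le_eqVlt; apply/orP; left; apply/eqP; field; rewrite gt_eqF.
Qed.

(** Weierstrass' theorem. Cauchy estimates for G_k - G_l make the derivatives converge, and the
    quadratic remainder bound, uniform in k, passes to the limit. *)
Lemma holo_limit (G : nat -> E -> E) F z rho M (eps : nat -> R) :
  (forall k, bounded_holo (G k) z rho M) ->
  (forall k y, hnorm (y - z) < rho -> hnorm (G k y - F y) <= eps k) ->
  (forall e, 0 < e -> \forall k \near \oo, eps k < e) ->
  bounded_holo F z rho M.
Proof.
move=> GM GF eps0 y yz.
have Gcv y' : hnorm (y' - z) < rho -> hcvg (G^~ y') (F y').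
  move=> y'z e e0; apply: filterS (eps0 e e0) => k; exact: le_lt_trans (GF k y' y'z).
split; last first.
  rewrite -[F y]subr0; apply: (hcvg_le (Gcv y yz)) => e e0; apply: nearW => k.
  by rewrite subr0; have [_] := GM k y yz; have := ltW e0; lra.
pose r := rho - hnorm (y - z); have r0 : 0 < r by rewrite subr_gt0.
have GMy k : bounded_holo (G k) y r M by apply: bounded_holo_sub (GM k) _; rewrite /r; lra.
have [A AP] : exists A : nat -> 'M[R[i]^o]_n, forall k, has_cdiff (G k) y (A k).
  have Ak k : exists A, has_cdiff (G k) y A by have [] := GM k y yz.
  by have [A AP] := choice Ak; exists A.
have diff k l h : hnorm h <= r / 2 ->
   hnorm (h *m (A k - A l)) <= 2 * (eps k + eps l) / r * hnorm h.
  have Hd F1 F2 y1 A1 A2 : has_cdiff F1 y1 A1 -> has_cdiff F2 y1 A2 ->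
     has_cdiff (fun w => F1 w - F2 w) y1 (A1 - A2).
    move=> H1 H2; apply: has_cdiffD H1 _.
    have := @has_cdiff_affine F2 y1 A2 (-1) 1 0 0; rewrite add0r scale1r mulr1 scaleN1r.
    move=> /(_ H2) H3 e e0; have [d d0 dP] := H3 e e0; exists d => // h' /dP.
    by rewrite !add0r !scale1r !subr0 !scaleN1r.
  move=> hr.
  have BH : bounded_holo (fun w => G k w - G l w) y r (eps k + eps l).
    move=> w wy; have wz : hnorm (w - z) < rho.
      by apply: le_lt_trans (ler_hnorm_dist w y z) _; rewrite /r in wy; lra.
    split.
      have [[A1 H1] _] := GM k w wz; have [[A2 H2] _] := GM l w wz.
      by exists (A1 - A2); exact: Hd.
    have -> : G k w - G l w = (G k w - F w) - (G l w - F w).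
      by rewrite opprB addrA subrK.
    by apply: le_trans (ler_hnormB _ _) _; rewrite lerD ?GF.
  by have [] := holo_estimates r0 BH (Hd _ _ _ _ _ (AP k) (AP l)) hr.
have rowcv i : exists L, hcvg (fun k => row i (A k)) L.
  apply: hcvg_complete => e e0.
  have e1 : 0 < e / 8 * r by rewrite mulr_gt0 ?divr_gt0.
  have := eps0 _ e1 => epsN; have [l lP] := filter_ex epsN; exists (row i (A l)).
  have dn : hnorm (delta_mx 0 i : E) = 1.
    apply/eqP; rewrite -(eqrXn2 (n := 2)) ?hnorm_ge0// hnorm_sqr (bigD1 i)//= big1.
      by rewrite mxE !eqxx Normc.normc1 addr0 expr1n.
    by move=> j ji; rewrite mxE (negbTE ji) andbF Normc.normc0 expr0n.
  apply: filterS epsN => k kP.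
  have hr : hnorm (((r / 2)%:C)%C *: (delta_mx 0 i : E)) <= r / 2.
    by rewrite hnormZ dn mulr1 normc_real ger0_norm// divr_ge0// ltW.
  have := diff k l _ hr; rewrite -scalemxAl -rowE hnormZ.
  have -> : row i (A k - A l) = row i (A k) - row i (A l) by rewrite linearB.
  rewrite normc_real ger0_norm ?divr_ge0 ?(ltW r0)// hnormZ dn mulr1 normc_real ger0_norm ?divr_ge0 ?(ltW r0)//.
  have r2 : 0 < r / 2 by rewrite divr_gt0.
  rewrite [leRHS]mulrC ler_pM2l// => /le_lt_trans; apply.
  rewrite ltr_pdivrMr//; lra.
have [L LP] := choice rowcv.
pose B : 'M[R[i]^o]_n := \matrix_(i, j) L i 0 j.
have rowB i : row i B = L i by apply/rowP => j; rewrite !mxE.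
have hcv h : hcvg (fun k => h *m A k) (h *m B).
  move=> e e0.
  have : hcvg (fun k => \sum_(i < n) h 0 i *: row i (A k)) (\sum_(i < n) h 0 i *: row i B).
    by apply: hcvg_sum => i; apply: hcvgZ; rewrite rowB.
  by move=> /(_ e e0); apply: filterS => k; rewrite !mulmx_sum_row.
exists B => e e0.
have M0 : 0 <= M by apply: le_trans (hnorm_ge0 (G 0%N y)) (GM 0%N y yz).2.
pose C := 16 * M / r ^+ 2 + 1.
have C0 : 0 < C by rewrite ltr_wpDl// divr_ge0 ?mulr_ge0 ?exprn_ge0// ltW.
exists (Num.min (r / 2) (e / C)); first by rewrite lt_min !divr_gt0.
move=> h; rewrite lt_min (ltr_pdivlMr _ _ C0) => /andP[hr hC].
have yhz : hnorm (y + h - z) < rho.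
  have -> : y + h - z = (y - z) + h by rewrite addrAC.
  by apply: le_lt_trans (ler_hnormD _ _) _; rewrite /r in hr; have := hnorm_ge0 h; lra.
have cv : hcvg (fun k => (G k (y + h) + (-1) *: G k y) + (-1) *: (h *m A k))
    ((F (y + h) + (-1) *: F y) + (-1) *: (h *m B)).
  apply: hcvgD; last by apply: hcvgZ; exact: hcv.
  by apply: hcvgD; [exact: Gcv|apply: hcvgZ; exact: Gcv].
have -> : F (y + h) - F y - h *m B = (F (y + h) + (-1) *: F y) + (-1) *: (h *m B) - 0.
  by rewrite !scaleN1r subr0.
apply: (hcvg_le cv) => e' e'0; apply: nearW => k; rewrite subr0 !scaleN1r.
have [h1 _ _] := holo_estimates r0 (GMy k) (AP k) (ltW hr).
apply: le_trans h1 _; rewrite -[leLHS]addr0 lerD ?(ltW e'0)//.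
rewrite expr2 mulrA ler_wpM2r ?hnorm_ge0//.
have := hnorm_ge0 h; rewrite /C in hC *; lra.
Qed.

End SeveralVariables.

Lemma ler_hnorm_norm (R : realType) n (x y : 'Cv[R]_n) :
  `|hnorm x - hnorm y| <= hnorm (x - y).
Proof.
rewrite ler_norml; have := ler_hnormD (x - y) y; have := ler_hnormD (y - x) x.
by rewrite !subrK (hnormBC y x); lra.
Qed.

(** * Maxima on closed Euclidean balls *)

Section Compactness.
Variables (R : realType).

Lemma rnorm_ge0 N (u : 'rV[R]_N) : 0 <= rnorm u.
Proof. exact: sqrtr_ge0. Qed.

Lemma rnorm_sqr N (u : 'rV[R]_N) : rnorm u ^+ 2 = \sum_(i < N) u 0 i ^+ 2.
Proof. by rewrite sqr_sqrtr// sumr_ge0// => i _; exact: sqr_ge0. Qed.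

Lemma rnorm_coord N (u : 'rV[R]_N) i : `|u 0 i| <= rnorm u.
Proof.
rewrite -ler_sqr ?nnegrE ?rnorm_ge0// real_normK ?num_real// rnorm_sqr (bigD1 i)//=.
by rewrite lerDl sumr_ge0// => j _; exact: sqr_ge0.
Qed.

Lemma mx_norm_le_rnorm N (u : 'rV[R]_N) : `|u| <= rnorm u.
Proof.
have -> : `|u| = mx_norm u by [].
rewrite mx_normrE; elim/big_ind: _ => [|x y xu yu|[i j] _].
- exact: rnorm_ge0.
- by rewrite ge_max xu.
- by rewrite /= ord1 rnorm_coord.
Qed.

Lemma rnorm_le_mx_norm N (u : 'rV[R]_N) : rnorm u <= N%:R * `|u|.
Proof.
have coord i : `|u 0 i| <= `|u|.
  by have -> : `|u| = mx_norm u by []; rewrite mx_normrE (le_bigmax _ _ (0 : 'I_1, i)).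
case: N u coord => [|N] u coord.
  by rewrite mul0r /rnorm big_ord0 sqrtr0.
have u0 : 0 <= `|u| by exact: normr_ge0.
rewrite -ler_sqr ?nnegrE ?rnorm_ge0 ?mulr_ge0// rnorm_sqr exprMn.
apply: (@le_trans _ _ (N.+1%:R * `|u| ^+ 2)).
  have -> : N.+1%:R * `|u| ^+ 2 = \sum_(i < N.+1) `|u| ^+ 2.
    by rewrite sumr_const card_ord -[RHS]mulr_natl.
  by apply: ler_sum => i _; rewrite -real_normK ?num_real// ler_sqr ?nnegrE ?coord.
by rewrite ler_wpM2r ?sqr_ge0// expr2 ler_peMl// ler1n.
Qed.

(** Transported to R^(2n), the ball is closed and bounded, hence compact, and the extreme value
    theorem applies. *)
Lemma hclosed_ball_max n (Psi : 'Cv[R]_n -> R) (z0 : 'Cv[R]_n) (rho : R) : 0 <= rho ->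
  (forall z : 'Cv[R]_n, hnorm (z - z0) <= rho -> forall e : R, 0 < e -> exists2 d : R, 0 < d &
    forall y : 'Cv[R]_n, hnorm (y - z) < d -> hnorm (y - z0) <= rho -> `|Psi y - Psi z| < e) ->
  exists2 z : 'Cv[R]_n, hnorm (z - z0) <= rho &
    forall y : 'Cv[R]_n, hnorm (y - z0) <= rho -> Psi y <= Psi z.
Proof.
move=> rho0 Psic.
pose K := [set u : 'rV[R]_(n + n) | hnorm (of_real u - z0) <= rho].
have K0 : K !=set0.
  by exists (to_real z0); rewrite /K /= to_realK subrr hnorm0.
have near_dist (u : 'rV[R]_(n + n)) d : 0 < d ->
    \forall v \near u, hnorm (of_real v - of_real u) < d.
  move=> d0; have N0 : 0 < (n + n)%:R + 1 :> R by rewrite ltr_wpDl.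
  apply/nbhs_normP; exists (d / ((n + n)%:R + 1)); first by rewrite /= divr_gt0.
  move=> v /=; rewrite distrC ltr_pdivlMr// -of_realB hnorm_of_real => uv.
  apply: le_lt_trans (rnorm_le_mx_norm _) _; have := normr_ge0 (v - u); lra.
have Kc : compact K.
  apply: bounded_closed_compact.
    exists (rho + hnorm z0); split; first exact: num_real.
    move=> M HM u; rewrite /K /= => uK; apply: ltW; apply: le_lt_trans HM.
    apply: le_trans (mx_norm_le_rnorm _) _; rewrite -hnorm_of_real.
    rewrite -(subrK z0 (of_real u)); apply: le_trans (ler_hnormD _ _) _.
    by rewrite lerD2r.
  move=> u uK; rewrite /K /= leNgt; apply/negP => ru.
  have d0 : 0 < hnorm (of_real u - z0) - rho by rewrite subr_gt0.
  have [v [Kv vu]] := uK _ (near_dist u _ d0).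
  rewrite /K /= in Kv.
  have := ler_hnorm_dist (of_real u) (of_real v) z0.
  by move: vu; rewrite hnormBC; lra.
have [|u uK umax] := @compact_EVT_max _ _ (fun u => Psi (of_real u)) K K0 Kc.
  apply/subspace_continuousP => u Ku; apply/cvgrPdist_lt => e e0.
  have [d d0 dP] := Psic _ Ku e e0.
  rewrite near_withinE; apply: filterS (near_dist u d d0) => v vd Kv.
  by rewrite distrC; apply: dP.
exists (of_real u); first by move: uK; rewrite inE.
move=> y yr; rewrite -(to_realK y); apply: umax.
by rewrite inE /K /= to_realK.
Qed.

End Compactness.

(** * Regular points, and zeros of perturbed linear maps *)

Section HolomorphicMaps.
Variables (R : realType) (n : nat).
Local Notation E := 'Cv[R]_n.
Implicit Types (F G P : E -> E) (x y z v w h : E) (A B : 'M[R[i]^o]_n).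
Implicit Types (e d M rho : R).

(** Sums up the four maximality inequalities of [regular_point]: the s and k are the values of |.|^2
    and K |P|^2 at the four points, zz and kk those at the maximum, T = t^2, and the parallelogram
    law relates the opposite points. *)
Lemma four_point_arith (s1 s2 s3 s4 k1 k2 k3 k4 q1 q2 zz kk T X c : R) :
  s1 - k1 <= zz - kk -> s2 - k2 <= zz - kk -> s3 - k3 <= zz - kk ->
  s4 - k4 <= zz - kk -> s1 + s2 = 2 * zz + 2 * T -> s3 + s4 = 2 * zz + 2 * T ->
  k1 <= q1 + c -> k2 <= q1 + c -> k3 <= q2 + c -> k4 <= q2 + c ->
  q1 + q2 <= 2 * kk + 2 * X -> T <= X + c.
Proof. lra. Qed.

(* At a maximum point of |z|^2 - K|P z|^2 on the closed ball of radius 1/2,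
   averaging over z + t v, z - t v, z + i t v, z - i t v, with v in the kernel
   of the derivative, gives a contradiction: the mean of |z|^2 increases
   by t^2 |v|^2, that of |P|^2 by O(t^3) only. *)
Lemma regular_point P M (p : nat) (alpha : R) : bounded_holo P 0 2 M ->
  P 0 = 0 -> 0 < alpha -> (forall v, hnorm v < 2 -> alpha * hnorm v ^+ p <= hnorm (P v)) ->
  exists y A, [/\ hnorm y < 1 / 2, has_cdiff P y A & A \in unitmx].
Proof.
move=> PM P0 alpha0 Plow.
have M0 : 0 <= M.
  by apply: le_trans (hnorm_ge0 (P 0)) (PM 0 _).2; rewrite subrr hnorm0.
pose a2 := (alpha * (1 / 2) ^+ p) ^+ 2.
have a20 : 0 < a2 by rewrite exprn_gt0// mulr_gt0// exprn_gt0// divr_gt0.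
(* On the sphere |z| = 1 / 2 one has |P z|^2 >= a2, so Psi <= 1 / 4 - 1 < 0 = Psi 0 there, and the
   maximum is interior. *)
pose K := 1 / a2; have K0 : 0 < K by rewrite divr_gt0.
pose Psi z := hnorm z ^+ 2 - K * hnorm (P z) ^+ 2.
have in2 z : hnorm z <= 1 / 2 -> hnorm (z - 0) < 2 by rewrite subr0; lra.
have sqr_cont (a b e c : R) : 0 <= a <= c -> 0 <= b <= c -> 0 < e -> 
    `|a - b| < e / (2 * c + 1) -> `|a ^+ 2 - b ^+ 2| < e.
  move=> /andP[a0 ac] /andP[b0 bc] e0; rewrite ltr_pdivlMr; last lra.
  move=> h; rewrite subr_sqr normrM [`|a + b|]ger0_norm ?addr_ge0//.
  by have := normr_ge0 (a - b); nra.
have [z zr zmax] : exists2 z, hnorm (z - 0) <= 1 / 2 & forall y, hnorm (y - 0) <= 1 / 2 -> Psi y <= Psi z.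
  apply: hclosed_ball_max; first by rewrite divr_ge0.
  move=> z; rewrite subr0 => zr e e0.
  have [[A PA] _] := PM z (in2 z zr).
  have e2 : 0 < e / 2 by rewrite divr_gt0.
  have ek : 0 < e / 2 / K by rewrite divr_gt0.
  have eM : 0 < e / 2 / K / (2 * M + 1) by rewrite divr_gt0// ltr_wpDl// mulr_ge0.
  have [d d0 dP] := has_cdiff_continuous PA eM.
  exists (Num.min d (e / 2 / (2 * (1 / 2) + 1))).
    by rewrite lt_min d0 !divr_gt0 ?addr_gt0 ?mulr_gt0 ?divr_gt0.
  move=> y; rewrite lt_min subr0 => /andP[yd ye] yr.
  have h1 : `|hnorm y ^+ 2 - hnorm z ^+ 2| < e / 2.
    by apply: (sqr_cont _ _ _ (1 / 2)); rewrite ?hnorm_ge0//; apply: le_lt_trans (ler_hnorm_norm _ _) ye.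
  have h2 : `|hnorm (P y) ^+ 2 - hnorm (P z) ^+ 2| < e / 2 / K.
    apply: (sqr_cont _ _ _ M); rewrite ?hnorm_ge0 ?(PM _ (in2 _ _)).2//.
    exact: le_lt_trans (ler_hnorm_norm _ _) (dP y yd).
  have -> : Psi y - Psi z = (hnorm y ^+ 2 - hnorm z ^+ 2) - K * (hnorm (P y) ^+ 2 - hnorm (P z) ^+ 2).
    by rewrite /Psi; ring.
  apply: le_lt_trans (ler_normB _ _) _; rewrite normrM (ger0_norm (ltW K0)).
  by move: h2; rewrite ltr_pdivlMr// mulrC; lra.
rewrite subr0 in zr.
have zint : hnorm z < 1 / 2.
  rewrite lt_neqAle zr andbT; apply/eqP => zb.
  have := zmax 0; rewrite subrr hnorm0 => /(_ (divr_ge0 ler01 (ler0n _ _))).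
  rewrite /Psi P0 hnorm0 expr0n mulr0 subrr zb => h.
  have h2 : hnorm z < 2 by rewrite zb; lra.
  have := Plow z h2; rewrite zb => h3.
  have : a2 <= hnorm (P z) ^+ 2.
    by rewrite /a2 ler_sqr ?nnegrE ?hnorm_ge0// mulr_ge0 ?exprn_ge0 ?divr_ge0// ltW.
  move=> h4; have : 1 <= K * hnorm (P z) ^+ 2.
    by rewrite /K mulrAC mul1r ler_pdivlMr// mul1r.
  by move: h; rewrite expr_div_n; lra.
have [[A PA] PzM] := PM z (in2 z zr).
case: (boolP (A \in unitmx)) => [Au|Anu]; [by exists z, A|exfalso].
have [v [v1 vA]] : exists v, hnorm v = 1 /\ v *m A = 0.
  have : kermx A != 0 by rewrite kermx_eq0 row_free_unit.
  case/rowV0Pn => v /sub_kermxP vA v0.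
  exists (((hnorm v)^-1%:C)%C *: v); split; last by rewrite -scalemxAl vA scaler0.
  rewrite hnormZ normc_real ger0_norm ?invr_ge0 ?hnorm_ge0// mulVf//.
  by rewrite hnorm_eq0.
have PMz : bounded_holo P z (3 / 2) M.
  by apply: bounded_holo_sub PM _; rewrite subr0; lra.
have [|c [cM cP]] := @slice_taylor _ _ _ _ _ _ v 1 PMz ltr01; first by rewrite v1; lra.
have [c0 c1] := slice_coef01 ltr01 M0 PA cP.
rewrite vA in c1; have {}cM := cM 2%N; rewrite expr1n divr1 in cM.
(* Squaring |P| <= |q| + 2 M t^3 with |q| <= 2 M and t <= 1 adds at most (8 + 4) M^2 t^3. *)
pose C := 12 * M ^+ 2.
have C0 : 0 <= C by rewrite mulr_ge0 ?sqr_ge0.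
pose t : R := Num.min (1 / 2 - hnorm z) (1 / (2 * (K * (M ^+ 2 + C) + 1))).
have D0 : 0 < 2 * (K * (M ^+ 2 + C) + 1).
  by rewrite mulr_gt0// ltr_wpDl// mulr_ge0 ?addr_ge0 ?sqr_ge0// ltW.
have t0 : 0 < t by rewrite lt_min subr_gt0 zint divr_gt0.
have tz : t <= 1 / 2 - hnorm z by rewrite ge_min lexx.
have tD : t * (2 * (K * (M ^+ 2 + C) + 1)) <= 1.
  by rewrite -ler_pdivlMr// ge_min lexx orbT.
have t12 : t <= 1 / 2 by have := hnorm_ge0 z; lra.
have t1 : t <= 1 by lra.
have bound (a b : R[i]) : normc a = t -> a ^+ 2 = b -> 
    hnorm (P (z + a *: v)) ^+ 2 <= hnorm (P z + b *: c 2%N) ^+ 2 + C * t ^+ 3.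
  move=> na ab.
  have := cP 3%N a; rewrite na divr1 => /(_ (le_lt_trans t12 _)) h.
  have {}h := h (ltac:(lra)).
  rewrite !big_ord_recl big_ord0 /= expr0 scale1r addr0 in h.
  rewrite [c (bump 0 0)]c1 scaler0 add0r c0 (_ : a ^+ bump 0 (bump 0 0) = b) // in h.
  pose q : E := P z + b *: c 2%N.
  have qM : hnorm q <= 2 * M.
    apply: le_trans (ler_hnormD _ _) _; rewrite hnormZ -ab normcX na.
    have : t ^+ 2 * hnorm (c 2%N) <= 1 * M.
      by rewrite ler_pM ?exprn_ge0 ?hnorm_ge0 ?(ltW t0)// expr_le1 ?(ltW t0)//; lra.
    by lra.
  have h3 : hnorm (P (z + a *: v)) <= hnorm q + 2 * M * t ^+ 3.
    have -> : P (z + a *: v) = (P (z + a *: v) - q) + q by rewrite subrK.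
    apply: le_trans (ler_hnormD _ _) _; rewrite addrC lerD2l.
    apply: le_trans h _; rewrite ler_pdivrMr; last lra.
    have : 0 <= M * t ^+ 3 by rewrite mulr_ge0 ?exprn_ge0// ltW.
    by nra.
  have t3 : 0 <= t ^+ 3 by rewrite exprn_ge0// ltW.
  have t31 : t ^+ 3 <= 1 by rewrite expr_le1 ?(ltW t0)//; lra.
  have : hnorm (P (z + a *: v)) ^+ 2 <= (hnorm q + 2 * M * t ^+ 3) ^+ 2.
    have q2 : 0 <= hnorm q + 2 * M * t ^+ 3 by apply: le_trans h3; exact: hnorm_ge0.
    by rewrite ler_sqr ?nnegrE ?hnorm_ge0.
  move/le_trans; apply; rewrite sqrrD /C.
  have : hnorm q * (2 * M * t ^+ 3) <= 2 * M * (2 * M * t ^+ 3).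
    by apply: ler_wpM2r qM; apply: mulr_ge0 t3; exact: mulr_ge0 M0.
  have : (2 * M * t ^+ 3) ^+ 2 <= 4 * M ^+ 2 * t ^+ 3.
    rewrite [leLHS](_ : _ = 4 * M ^+ 2 * t ^+ 3 * t ^+ 3); last by ring.
    by apply: ler_piMr t31; apply: mulr_ge0 t3; exact: mulr_ge0 (sqr_ge0 M).
  lra.
have inball a : normc a = t -> hnorm (z + a *: v - 0) <= 1 / 2.
  move=> na; rewrite subr0; apply: le_trans (ler_hnormD _ _) _.
  by rewrite hnormZ na v1; lra.
pose a : R[i] := (t%:C)%C; pose b : R[i] := (0 +i* t)%C.
have na : normc a = t by rewrite normc_real ger0_norm// ltW.
have nb : normc b = t by rewrite /normc /= expr0n add0r sqrtr_sqr ger0_norm// ltW.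
(* The first order terms vanish as v A = 0, so the second order values are P z + t^2 c_2 in the real
   directions and P z - t^2 c_2 in the imaginary ones; by the parallelogram law the mean of their
   squared norms exceeds |P z|^2 by only O(t^4). *)
have b2 : b ^+ 2 = - a ^+ 2.
  by rewrite !expr2; apply/eqP; rewrite eq_complex /=; apply/andP; split; apply/eqP; ring.
have := bound a (a ^+ 2) na erefl; have := bound (- a) (a ^+ 2).
rewrite normcN na sqrrN => /(_ erefl erefl).
have := bound b (- a ^+ 2) nb b2; have := bound (- b) (- a ^+ 2).
rewrite normcN nb sqrrN => /(_ erefl b2) B4 B3 B2 B1.
have Nb : normc (- b) = t by rewrite normcN.
have Na : normc (- a) = t by rewrite normcN.
have := zmax _ (inball a na); have := zmax _ (inball (- a) Na).
have := zmax _ (inball b nb); have := zmax _ (inball (- b) Nb).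
rewrite /Psi => Z4 Z3 Z2 Z1.
have S1 := hnorm_parallelogram z (a *: v); rewrite hnormZ na v1 mulr1 in S1.
have S2 := hnorm_parallelogram z (b *: v); rewrite hnormZ nb v1 mulr1 in S2.
have S3 := hnorm_parallelogram (P z) (a ^+ 2 *: c 2%N).
rewrite hnormZ normcX na in S3.
rewrite !scaleNr in B1 B2 B3 B4 Z1 Z2 Z3 Z4.
have cM2 : (t ^+ 2 * hnorm (c 2%N)) ^+ 2 <= t ^+ 3 * M ^+ 2.
  rewrite exprMn -exprM; apply: ler_pM; rewrite ?exprn_ge0 ?hnorm_ge0 ?(ltW t0)//.
    by rewrite ler_wiXn2l ?(ltW t0).
  by rewrite ler_sqr ?nnegrE ?hnorm_ge0.
have KB (u w q : R) : u <= w + q -> K * u <= K * w + K * q.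
  by move=> uwq; rewrite -mulrDr ler_pM2l.
have {}B1 := KB _ _ _ B1; have {}B2 := KB _ _ _ B2.
have {}B3 := KB _ _ _ B3; have {}B4 := KB _ _ _ B4.
have S4 : K * (hnorm (P z + a ^+ 2 *: c 2%N) ^+ 2) + K * (hnorm (P z - a ^+ 2 *: c 2%N) ^+ 2)
   <= 2 * (K * hnorm (P z) ^+ 2) + 2 * (K * (t ^+ 3 * M ^+ 2)).
  have h5 : hnorm (P z + a ^+ 2 *: c 2%N) ^+ 2 + hnorm (P z - a ^+ 2 *: c 2%N) ^+ 2
     <= 2 * hnorm (P z) ^+ 2 + 2 * (t ^+ 3 * M ^+ 2) by rewrite S3 lerD2l ler_pM2l.
  rewrite -mulrDr; apply: le_trans (ler_wpM2l (ltW K0) h5) _.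
  by rewrite le_eqVlt; apply/orP; left; apply/eqP; ring.
have final : t ^+ 2 <= t ^+ 2 * (t * (K * (M ^+ 2 + C))).
  rewrite [leRHS](_ : _ = K * (t ^+ 3 * M ^+ 2) + K * (C * t ^+ 3)); last by ring.
  exact: four_point_arith Z1 Z2 Z3 Z4 S1 S2 B1 B2 B3 B4 S4.
have : t ^+ 2 * (t * (K * (M ^+ 2 + C))) < t ^+ 2.
  by rewrite gtr_pMr ?exprn_gt0//; clear - tD t0; lra.
by rewrite ltNge final.
Qed.

(* [A] is invertible with [cc |h| <= |h A|]; a minimum point of the norm of
   [(z - y) A + err z] on the closed ball is interior, and there the derivative is
   still invertible, so that the minimum is 0. *)
Lemma perturbed_zero (A : 'M[R[i]^o]_n) (cc kappa : R) y (err : E -> E) :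
  0 < cc -> 0 < kappa -> (forall h, cc * hnorm h <= hnorm (h *m A)) ->
  bounded_holo err y (2 * kappa) (cc * kappa / 8) ->
  exists2 z, hnorm (z - y) < kappa & (z - y) *m A + err z = 0.
Proof.
move=> cc0 kappa0 Alow errM.
pose u z := (z - y) *m A + err z.
have in2 z : hnorm (z - y) <= kappa -> hnorm (z - y) < 2 * kappa by lra.
have ud z : hnorm (z - y) <= kappa -> exists B, has_cdiff u z (A + B) /\
    forall h, hnorm h <= kappa / 2 -> hnorm (h *m B) <= cc / 4 * hnorm h.
  move=> zk; have [[B eB] _] := errM z (in2 z zk); exists B; split.
    by apply: has_cdiffD eB; exact: has_cdiff_linear.
  have zM : bounded_holo err z kappa (cc * kappa / 8) by apply: bounded_holo_sub errM _; lra.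
  move=> h hk; have [_ + _] := holo_estimates kappa0 zM eB hk.
  have -> : 2 * (cc * kappa / 8) / kappa = cc / 4 by field; rewrite gt_eqF.
  by [].
have [z zk zmax] : exists2 z, hnorm (z - y) <= kappa & forall w, hnorm (w - y) <= kappa ->
    - hnorm (u w) <= - hnorm (u z).
  apply: hclosed_ball_max; first exact: ltW.
  move=> z zk e e0; have [B [uB _]] := ud z zk.
  have [d d0 dP] := has_cdiff_continuous uB e0; exists d => // w wd _.
  have -> : - hnorm (u w) - - hnorm (u z) = - (hnorm (u w) - hnorm (u z)) by ring.
  by rewrite normrN; apply: (le_lt_trans (ler_hnorm_norm (u w) (u z))); exact: dP.
(* On the boundary |u| >= cc kappa - cc kappa / 8, whereas at the centre |u y| = |err y| <= cc kappa
   / 8. *)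
have zint : hnorm (z - y) < kappa.
  rewrite lt_neqAle zk andbT; apply/eqP => zb.
  have := zmax y; rewrite subrr hnorm0 lerN2 => /(_ (ltW kappa0)).
  rewrite /u subrr mul0mx add0r.
  have := lerB_hnorm ((z - y) *m A) (err z).
  have := Alow (z - y); rewrite zb.
  have [_ h1] := errM z (in2 z zk).
  have h2 : hnorm (err y) <= cc * kappa / 8.
    by apply: (errM y _).2; rewrite subrr hnorm0 mulr_gt0.
  have := mulr_gt0 cc0 kappa0; lra.
exists z => //; apply/eqP/negPn/negP => uz0; rewrite -/(u z) in uz0.
have [B [uB BM]] := ud z zk.
have Bsmall h : hnorm (h *m B) <= cc / 4 * hnorm h.
  have [->|h0] := eqVneq h 0; first by rewrite mul0mx hnorm0 mulr0.
  rewrite -hnorm_gt0 in h0; pose l : R := kappa / 2 / hnorm h.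
  have l0 : 0 < l by rewrite !divr_gt0.
  have := BM ((l%:C)%C *: h); rewrite -scalemxAl !hnormZ normc_real gtr0_norm//.
  have lk : l * hnorm h = kappa / 2 by rewrite /l mulfVK ?gt_eqF.
  by rewrite lk lexx -lk mulrCA ler_pM2l// => /(_ isT).
have ABu : A + B \in unitmx.
  rewrite -row_free_unit -kermx_eq0; apply/rowV0P => h /sub_kermxP hAB.
  apply/eqP; rewrite -hnorm_eq0 eq_le hnorm_ge0 andbT.
  have := Alow h; have := Bsmall h.
  have -> : h *m A = - (h *m B) by apply/eqP; rewrite -addr_eq0 -mulmxDr hAB.
  rewrite hnormN => h1 h2; have : cc * hnorm h <= cc / 4 * hnorm h by lra.
  by move=> h3; rewrite leNgt; apply/negP => hp; have := mulr_gt0 cc0 hp; lra.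
(* The Newton direction: a step t h replaces u z by (1 - t) u z, up to an error of at most t |u z| /
   2, and so decreases the norm. *)
pose h := - u z *m invmx (A + B).
have hAB : h *m (A + B) = - u z by rewrite mulmxKV.
have nu0 : 0 < hnorm (u z) by rewrite hnorm_gt0.
have h0 : 0 < hnorm h.
  by rewrite hnorm_gt0; apply: contraNneq uz0 => h0; move: hAB; rewrite h0 mul0mx => /eqP; rewrite eq_sym oppr_eq0.
have e0 : 0 < hnorm (u z) / (2 * hnorm h) by rewrite divr_gt0 ?mulr_gt0.
have [d d0 dP] := uB _ e0.
pose t : R := Num.min (1 / 2) (Num.min (d / hnorm h / 2) ((kappa - hnorm (z - y)) / hnorm h)).
have t0 : 0 < t by rewrite !lt_min !divr_gt0 ?subr_gt0.
have t1 : t <= 1 / 2 by rewrite ge_min lexx.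
have td : t * hnorm h < d.
  have : t <= d / hnorm h / 2 by rewrite !ge_min lexx orbT.
  have dh : 0 < d / hnorm h by rewrite divr_gt0.
  by move=> ?; rewrite -ltr_pdivlMr//; lra.
have tk : t * hnorm h <= kappa - hnorm (z - y).
  by rewrite -ler_pdivlMr// !ge_min lexx !orbT.
pose th := (t%:C)%C *: h.
have nth : hnorm th = t * hnorm h by rewrite hnormZ normc_real gtr0_norm.
have := dP th; rewrite nth => /(_ td).
rewrite /th -scalemxAl hAB -/th => h1.
have : hnorm (u (z + th)) <= (1 - t) * hnorm (u z) + hnorm (u z) / (2 * hnorm h) * (t * hnorm h).
  have -> : u (z + th) = ((1 - t)%:C)%C *: u z + (u (z + th) - u z - (t%:C)%C *: - u z).
    rewrite rmorphB rmorph1; move: (u _) (u _) => p q.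
    by apply/rowP => i; rewrite !mxE; ring.
  apply: le_trans (ler_hnormD _ _) _; apply: lerD => //.
  by rewrite hnormZ normc_real ger0_norm//; lra.
have -> : hnorm (u z) / (2 * hnorm h) * (t * hnorm h) = t * hnorm (u z) / 2.
  by field; rewrite gt_eqF.
have zt : hnorm (z + th - y) <= kappa.
  rewrite addrAC; apply: le_trans (ler_hnormD _ _) _; rewrite nth; lra.
have := zmax _ zt; rewrite lerN2.
by have := mulr_gt0 t0 nu0; lra.
Qed.

End HolomorphicMaps.

(** * The leading homogeneous form at a zero *)

Section LeadingForm.
Variables (R : realType) (n : nat).
Local Notation E := 'Cv[R]_n.
Implicit Types (F G P : E -> E) (x y z v w h : E) (A B : 'M[R[i]^o]_n).
Implicit Types (e d M rho : R).

Lemma le_linear_le0 (a C tau : R) : 0 < tau ->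
  (forall t : R, 0 < t -> t <= tau -> a <= C * t) -> a <= 0.
Proof.
move=> tau0 aC; rewrite leNgt; apply/negP => a0.
have C1 : 0 < `|C| + 1 by rewrite ltr_wpDl.
pose t : R := Num.min tau (a / (2 * (`|C| + 1))).
have t0 : 0 < t by rewrite lt_min tau0 divr_gt0 ?mulr_gt0.
have tt : t <= tau by rewrite ge_min lexx.
have ta : t * (2 * (`|C| + 1)) <= a by rewrite -ler_pdivlMr ?mulr_gt0// ge_min lexx orbT.
have := aC t t0 tt; have := ler_norm C; nra.
Qed.

Lemma finite_pos_min (I : finType) (f : I -> R) : (forall i, 0 < f i) ->
  exists2 eta : R, 0 < eta & forall i, eta <= f i.
Proof.
move=> f0; suff [eta e0 eP] : exists2 eta : R, 0 < eta & forall i, i \in enum I -> eta <= f i.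
  by exists eta => // i; apply: eP; rewrite mem_enum.
elim: (enum I) => [|i s [eta e0 eP]]; first by exists 1.
exists (Num.min (f i) eta); first by rewrite lt_min f0.
move=> j; rewrite inE => /orP[/eqP ->|js]; first by rewrite ge_min lexx.
by rewrite ge_min (eP j js) orbT.
Qed.

Lemma exists_unit_vector : (0 < n)%N -> exists v : E, hnorm v = 1.
Proof.
move=> n0; exists (delta_mx 0 (Ordinal n0)).
apply/eqP; rewrite -(eqrXn2 (n := 2)) ?hnorm_ge0// hnorm_sqr (bigD1 (Ordinal n0))//= big1.
  by rewrite mxE !eqxx Normc.normc1 addr0 expr1n.
by move=> j ji; rewrite mxE (negbTE ji) andbF Normc.normc0 expr0n.
Qed.

(** P v is the coefficient of a^p in the expansion of F(x + a s v) in a, where s = rho / 2 makes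
    room for |v| < 2. The two-sided growth of |F|^2 kills the lower coefficients, forces m to be
    even, and bounds P from below. *)
Lemma leading_form F x rho M (m : nat) (c0 C0 t0 : R) : (0 < n)%N -> 0 < rho ->
  bounded_holo F x rho M -> F x = 0 -> (0 < m)%N -> 0 < c0 -> 0 < t0 ->
  (forall h, 0 < hnorm h -> hnorm h < t0 ->
     c0 * hnorm h ^+ m <= hnorm (F (x + h)) ^+ 2 <= C0 * hnorm h ^+ m) ->
  exists (p : nat) (P : E -> E) (alpha : R), [/\ m = p.*2, 0 < alpha,
    bounded_holo P 0 2 (3 * M),
    forall v, hnorm v < 2 -> alpha * hnorm v ^+ p <= hnorm (P v) &
    (forall (a l : R[i]) v, hnorm v < 2 -> normc a <= 1 / 2 -> normc l <= 1 ->
       hnorm (F (x + (a * ((rho / 2)%:C)%C) *: v) - a ^+ p *: P v) <= 2 * M * normc a ^+ p.+1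
       /\ P (l *: v) = l ^+ p *: P v)].
Proof.
move=> n0 rho0 FM Fx m0 c00 t00 growth.
have M0 : 0 <= M.
  by apply: le_trans (hnorm_ge0 (F x)) (FM x _).2; rewrite subrr hnorm0.
pose s : R := rho / 2; have s0 : 0 < s by rewrite divr_gt0.
pose sC : R[i] := (s%:C)%C.
have nsC : normc sC = s by rewrite normc_real gtr0_norm.
have [c cP] : exists c : E -> nat -> E, forall v, hnorm v < 2 ->
   (forall k, hnorm (c v k) <= M) /\
   (forall K a, normc a <= 1 / 2 -> hnorm (F (x + (a * sC) *: v) - \sum_(k < K) a ^+ k *: c v k)
      <= 2 * M * normc a ^+ K).
  suff : forall v, exists c : nat -> E, hnorm v < 2 -> (forall k, hnorm (c k) <= M) /\
   (forall K a, normc a <= 1 / 2 -> hnorm (F (x + (a * sC) *: v) - \sum_(k < K) a ^+ k *: c k)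
      <= 2 * M * normc a ^+ K) by move=> h; have [c cP] := choice h; exists c.
  move=> v; have [v2|v2] := ltP (hnorm v) 2; last by exists (fun=> 0).
  have sv : 1 * hnorm (sC *: v) < rho.
    by rewrite mul1r hnormZ nsC; have : s * hnorm v < s * 2; [rewrite ltr_pM2l|rewrite /s; lra].
  have [c [cM cP]] := slice_taylor FM ltr01 sv.
  exists c => _; split=> [k|K a a12]; first by have := cM k; rewrite expr1n divr1.
  have a1 : normc a < 1 by lra.
  have := cP K a a1; rewrite divr1 scalerA => /le_trans; apply.
  have a0 : 0 <= M * normc a ^+ K by rewrite mulr_ge0 ?exprn_ge0 ?normc_ge0.
  rewrite ler_pdivrMr; last by lra.
  by nra.
have nreal (t : R) : 0 < t -> normc ((t%:C)%C : R[i]) = t by move=> tp; rewrite normc_real gtr0_norm.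
have C00 : 0 <= C0.
  have [v v1] := exists_unit_vector n0.
  pose t := t0 / 2; have tp : 0 < t by rewrite divr_gt0.
  have nt : hnorm ((t%:C)%C *: v) = t by rewrite hnormZ v1 mulr1 nreal.
  have := growth ((t%:C)%C *: v); rewrite nt => /(_ tp) h.
  have tt0 : t < t0 by rewrite /t; lra.
  have /andP[h1 h2] := h tt0.
  have : 0 < C0 * t ^+ m.
    by apply: lt_le_trans (le_trans h1 h2); rewrite mulr_gt0// exprn_gt0.
  by rewrite pmulr_lgt0 ?exprn_gt0// => /ltW.
pose tau : R := Num.min (1 / 2) (t0 / (4 * s)).
have tau0 : 0 < tau by rewrite lt_min !divr_gt0 ?mulr_gt0.
have small (t : R) v : 0 < t -> t <= tau -> hnorm v < 2 -> v != 0 ->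
   c0 * (t * s * hnorm v) ^+ m <= hnorm (F (x + ((t%:C)%C * sC) *: v)) ^+ 2
      <= C0 * (t * s * hnorm v) ^+ m.
  move=> tp tt v2 v0.
  have nh : hnorm (((t%:C)%C * sC) *: v) = t * s * hnorm v.
    by rewrite hnormZ Normc.normcM nreal// nsC.
  have := growth (((t%:C)%C * sC) *: v); rewrite nh; apply.
    by rewrite !mulr_gt0 ?hnorm_gt0.
  have ts : t * (4 * s) <= t0 by rewrite -ler_pdivlMr ?mulr_gt0// (le_trans tt)// ge_min lexx orbT.
  have : t * s * hnorm v < t * s * 2 by rewrite ltr_pM2l ?mulr_gt0.
  lra.
have small_up (t : R) v : 0 < t -> t <= tau -> hnorm v < 2 ->
   hnorm (F (x + ((t%:C)%C * sC) *: v)) ^+ 2 <= C0 * (2 * s) ^+ m * t ^+ m.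
  move=> tp tt v2; have [->|v0] := eqVneq v 0.
    by rewrite scaler0 addr0 Fx hnorm0 expr0n; pos.
  have /andP[_ h] := small t v tp tt v2 v0; apply: le_trans h _.
  rewrite -(mulrA C0) ler_wpM2l// -exprMn; apply: lerXn2r; rewrite ?nnegrE; [pos|pos|].
  have -> : 2 * s * t = t * s * 2 by ring.
  by apply: ler_wpM2l (ltW v2); exact: mulr_ge0 (ltW tp) (ltW s0).
have tau12 (t : R) : t <= tau -> t <= 1 / 2 by move=> tt; apply: le_trans tt _; rewrite ge_min lexx.
(* With the lower terms gone, t^k |c v k| <= |F| + O(t^(k+1)), while |F|^2 = O(t^m) and m >= 2 k +
   1; squaring and dividing by t^(2k) gives |c v k|^2 = O(t). *)
have vanish k : (k.*2 < m)%N -> forall v, hnorm v < 2 -> c v k = 0.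
  elim/ltn_ind: k => k IH km v v2.
  apply/eqP; rewrite -hnorm_eq0 -sqrf_eq0 eq_le sqr_ge0 andbT.
  apply: (@le_linear_le0 _ (2 * (C0 * (2 * s) ^+ m) + 8 * M ^+ 2) tau tau0) => t tp tt.
  have t12 := tau12 t tt.
  have t2 : normc ((t%:C)%C : R[i]) <= 1 / 2 by rewrite nreal.
  have := (cP v v2).2 k.+1 _ t2; rewrite nreal// big_ord_recr /= big1 => [|j _]; last first.
    by rewrite IH ?scaler0// (leq_ltn_trans _ km)// leq_double ltnW.
  rewrite add0r; have := small_up t v tp tt v2.
  set u := F _; set q := c v k => h1 h2.
  have h3 : t ^+ k * hnorm q <= hnorm u + 2 * M * t ^+ k.+1.
    rewrite -{1}(nreal t tp) -normcX -hnormZ.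
    have -> : ((t%:C)%C : R[i]) ^+ k *: q = u - (u - ((t%:C)%C : R[i]) ^+ k *: q).
      by rewrite opprB addrC subrK.
    by apply: le_trans (ler_hnormB _ _) _; rewrite lerD2l.
  have tk : 0 < t ^+ k by rewrite exprn_gt0.
  have h4 : (t ^+ k * hnorm q) ^+ 2 <= 2 * hnorm u ^+ 2 + 2 * (2 * M * t ^+ k.+1) ^+ 2.
    apply: (@le_trans _ _ ((hnorm u + 2 * M * t ^+ k.+1) ^+ 2)).
      by rewrite ler_sqr ?nnegrE ?(le_trans _ h3)// mulr_ge0 ?hnorm_ge0 ?(ltW tk).
    have := sqr_ge0 (hnorm u - 2 * M * t ^+ k.+1); rewrite sqrrB sqrrD; lra.
  have t1 : t <= 1 by lra.
  have h5 : t ^+ m <= t ^+ k ^+ 2 * t.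
    by rewrite -exprM muln2 -exprSr ler_wiXn2l ?(ltW tp).
  have h6 : (2 * M * t ^+ k.+1) ^+ 2 <= 4 * M ^+ 2 * (t ^+ k ^+ 2 * t).
    have -> : (2 * M * t ^+ k.+1) ^+ 2 = 4 * M ^+ 2 * (t ^+ k ^+ 2 * t) * t.
      by rewrite [t ^+ k.+1]exprSr; ring.
    by rewrite ler_piMr//; pos.
  rewrite -(ler_pM2l (exprn_gt0 2 tk)) -exprMn; apply: le_trans h4 _.
  have h7 : C0 * (2 * s) ^+ m * t ^+ m <= C0 * (2 * s) ^+ m * (t ^+ k ^+ 2 * t).
    by apply: ler_wpM2l h5; pos.
  have h8 := le_trans h1 h7.
  rewrite [leRHS](_ : _ = 2 * (C0 * (2 * s) ^+ m * (t ^+ k ^+ 2 * t)) +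
     2 * (4 * M ^+ 2 * (t ^+ k ^+ 2 * t))); last by ring.
  by rewrite lerD ?ler_pM2l.
(* Rounding up leaves m = 2 p or m = 2 p - 1, and all coefficients below p vanish in both cases;
   parity is settled afterwards. *)
pose p := uphalf m; pose P v := c v p.
have pm : (m <= p.*2)%N by rewrite /p uphalfE; clear; lia.
have pS : (p.*2 <= m.+1)%N by rewrite /p uphalfE; clear; lia.
have p0 : (0 < p)%N by move: pm m0; clear; lia.
have low j : (j < p)%N -> forall v, hnorm v < 2 -> c v j = 0.
  by move=> jp v v2; apply: vanish => //; move: jp pS; clear; lia.
have approx a v : hnorm v < 2 -> normc a <= 1 / 2 ->
   hnorm (F (x + (a * sC) *: v) - a ^+ p *: P v) <= 2 * M * normc a ^+ p.+1.
  move=> v2 a12; have := (cP v v2).2 p.+1 a a12.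
  by rewrite big_ord_recr /= big1 ?add0r// => j _; rewrite low// scaler0.
have Fp a v : hnorm v < 2 -> normc a <= 1 / 2 ->
   hnorm (F (x + (a * sC) *: v)) <= 2 * M * normc a ^+ p.
  move=> v2 a12; have := (cP v v2).2 p a a12.
  by rewrite big1 ?subr0// => j _; rewrite low// scaler0.
(* For odd m, |F| = O(t^p) would give |F|^2 = O(t^(m+1)), against the lower bound c0 |h|^m. *)
have mp : m = p.*2.
  apply/eqP; rewrite eqn_leq pm /= leqNgt; apply/negP => mlt.
  have pE : p.*2 = m.+1 by move: pS mlt; clear; lia.
  have [v v1] := exists_unit_vector n0.
  have v2 : hnorm v < 2 by rewrite v1; lra.
  have v0 : v != 0 by rewrite -hnorm_gt0 v1.
  have : c0 * s ^+ m <= 0.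
    apply: (@le_linear_le0 _ (4 * M ^+ 2) tau tau0) => t tp tt.
    have /andP[h1 _] := small t v tp tt v2 v0; rewrite v1 mulr1 in h1.
    have t2 : normc ((t%:C)%C : R[i]) <= 1 / 2 by rewrite nreal// tau12.
    have h2 := Fp _ v v2 t2; rewrite nreal// in h2.
    have h3 : hnorm (F (x + ((t%:C)%C * sC) *: v)) ^+ 2 <= (2 * M * t ^+ p) ^+ 2.
      by rewrite ler_sqr ?nnegrE ?hnorm_ge0// (le_trans _ h2)// hnorm_ge0.
    have tm : 0 < t ^+ m by rewrite exprn_gt0.
    rewrite -(ler_pM2l tm); have := le_trans h1 h3.
    have -> : (2 * M * t ^+ p) ^+ 2 = t ^+ m * (4 * M ^+ 2 * t).
      by rewrite exprMn -exprM muln2 pE [t ^+ m.+1]exprSr; ring.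
    by rewrite exprMn mulrCA.
  by rewrite leNgt mulr_gt0// exprn_gt0.
have nP v : hnorm v < 2 -> hnorm (P v) <= M by move=> v2; exact: (cP v v2).1.
(* The same value of F is expanded once along l v with parameter t and once along v with parameter t
   l. *)
have hom l v : hnorm v < 2 -> normc l <= 1 -> P (l *: v) = l ^+ p *: P v.
  move=> v2 l1; apply/eqP; rewrite -subr_eq0 -hnorm_eq0 eq_le hnorm_ge0 andbT.
  have lv2 : hnorm (l *: v) < 2.
    by rewrite hnormZ; apply: le_lt_trans v2; rewrite ler_piMl ?hnorm_ge0.
  apply: (@le_linear_le0 _ (4 * M) tau tau0) => t tp tt.
  have t2 : normc ((t%:C)%C : R[i]) <= 1 / 2 by rewrite nreal// tau12.
  have tl2 : normc ((t%:C)%C * l : R[i]) <= 1 / 2.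
    by rewrite Normc.normcM; apply: le_trans t2; rewrite ler_piMr ?normc_ge0.
  have h1 := approx _ _ lv2 t2; have h2 := approx _ _ v2 tl2.
  have eqF : ((t%:C)%C * sC) *: (l *: v) = ((t%:C)%C * l * sC) *: v.
    by rewrite scalerA; congr (_ *: _); ring.
  rewrite eqF nreal// in h1.
  have {}h2 : hnorm (F (x + ((t%:C)%C * l * sC) *: v) - ((t%:C)%C * l) ^+ p *: P v)
      <= 2 * M * t ^+ p.+1.
    apply: le_trans h2 _; rewrite Normc.normcM nreal// ler_wpM2l ?mulr_ge0//.
    apply: lerXn2r; rewrite ?nnegrE ?mulr_ge0 ?normc_ge0 ?(ltW tp)//.
    by rewrite ler_piMr// ltW.
  have tk : 0 < t ^+ p by rewrite exprn_gt0.
  rewrite -(ler_pM2l tk) -{1}(nreal t tp) -normcX -hnormZ scalerBr scalerA -exprMn.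
  move: h1 h2; set u := F _; set a1 := _ *: P (l *: v); set a2 := _ *: P v => h1 h2.
  have -> : a1 - a2 = (u - a2) - (u - a1) by rewrite opprB [RHS]addrC addrA subrK.
  apply: le_trans (ler_hnormB _ _) _.
  rewrite [leRHS](_ : _ = 2 * M * t ^+ p.+1 + 2 * M * t ^+ p.+1); last by rewrite exprSr; ring.
  exact: lerD h2 h1.
pose alpha : R := Num.sqrt c0 * s ^+ p.
have alpha0 : 0 < alpha by rewrite mulr_gt0 ?exprn_gt0 ?sqrtr_gt0.
exists p, P, alpha; split => //.
(* P is holomorphic as the uniform limit of the rescaled maps v -> t^-p F(x + t s v) along t =
   2^-(k+1). *)
- pose tk k : R := 1 / 2 ^+ k.+1.
  have tk0 k : 0 < tk k by rewrite divr_gt0 ?exprn_gt0.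
  have tk2 k : tk k <= 1 / 2.
    by rewrite /tk ler_wpM2l// lef_pV2 ?posrE ?exprn_gt0// exprS ler_peMr// exprn_ege1// ler1n.
  pose G k v := (((tk k)%:C)%C : R[i]) ^- p *: F (x + ((((tk k)%:C)%C : R[i]) * sC) *: v) - 0.
  have GP k v : hnorm (v - 0) < 2 -> hnorm (G k v - P v) <= 2 * M * tk k.
    rewrite subr0 => v2.
    have t2 : normc (((tk k)%:C)%C : R[i]) <= 1 / 2 by rewrite nreal.
    have tp : 0 < tk k ^+ p by rewrite exprn_gt0.
    rewrite /G subr0 -(ler_pM2l tp) -{1}(nreal _ (tk0 k)) -normcX -hnormZ scalerBr.
    have -> (q : E) : (((tk k)%:C)%C : R[i]) ^+ p *: ((((tk k)%:C)%C : R[i]) ^- p *: q) = q.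
      rewrite scalerA [X in X *: _](_ : _ = 1) ?scale1r//.
      by apply: (@mulfV R[i]); rewrite expf_neq0// -normc_gt0 nreal.
    have := approx _ v v2 t2; rewrite nreal// => /le_trans; apply.
    by rewrite le_eqVlt; apply/orP; left; apply/eqP; rewrite exprSr; ring.
  apply: (@holo_limit _ _ G P 0 2 (3 * M) (fun k => 2 * M * tk k)).
  + move=> k y y2; split; last first.
      rewrite -[G k y](subrK (P y)); apply: le_trans (ler_hnormD _ _) _.
      have := GP k y y2; have := nP y; rewrite -{1}[y]subr0 => /(_ y2).
      have : M * tk k <= M * (1 / 2) by rewrite ler_wpM2l.
      lra.
    have yin : hnorm (x + ((((tk k)%:C)%C : R[i]) * sC) *: y - x) < rho.
      rewrite addrC addrA addNr add0r hnormZ Normc.normcM nreal// nsC.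
      have : s * hnorm y < rho.
        by rewrite subr0 in y2; have : s * hnorm y < s * 2; [rewrite ltr_pM2l|rewrite /s; lra].
      move=> h; apply: le_lt_trans h; rewrite -mulrA ler_piMl; [by []|pos|].
      by have := tk2 k; lra.
    have [[A FA] _] := FM _ yin.
    by eexists; apply: has_cdiff_affine FA.
  + by move=> k y; exact: GP.
  + move=> e e0; have [j jP] := half_pow_small (2 * M) e0.
    exists j => // k /= jk; apply: le_lt_trans jP.
    rewrite /tk mulrA mulr1; apply: ler_wpM2l; first by rewrite mulr_ge0.
    by rewrite lef_pV2 ?posrE ?exprn_gt0// ler_eXn2l ?ltr1n// (leq_trans jk).
- move=> v v2; have [->|v0] := eqVneq v 0.
    by rewrite hnorm0 expr0n gtn_eqF// mulr0 hnorm_ge0.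
  rewrite -subr_le0; apply: (@le_linear_le0 _ (2 * M) tau tau0) => t tp tt.
  have t2 : normc ((t%:C)%C : R[i]) <= 1 / 2 by rewrite nreal// tau12.
  have /andP[h1 _] := small t v tp tt v2 v0.
  have := approx _ v v2 t2; rewrite nreal//; set u := F _ => h2.
  have tk : 0 < t ^+ p by rewrite exprn_gt0.
  have h3 : t ^+ p * (alpha * hnorm v ^+ p) <= hnorm u.
    have l0 : 0 <= t ^+ p * (alpha * hnorm v ^+ p).
      apply: mulr_ge0 (ltW tk) _; apply: mulr_ge0 (ltW alpha0) _.
      exact: exprn_ge0 (hnorm_ge0 v).
    rewrite -ler_sqr ?nnegrE ?hnorm_ge0//.
    apply: le_trans h1; rewrite le_eqVlt; apply/orP; left; apply/eqP.
    rewrite /alpha mp -muln2 exprM !exprMn sqr_sqrtr ?(ltW c00)//.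
    by ring.
  have h4 : hnorm u <= t ^+ p * hnorm (P v) + 2 * M * t ^+ p.+1.
    rewrite -{1}(nreal t tp) -normcX -hnormZ -[u](subrK (((t%:C)%C : R[i]) ^+ p *: P v)).
    by apply: le_trans (ler_hnormD _ _) _; rewrite addrC lerD2l.
  by rewrite -(ler_pM2l tk) mulrBr; move: h3 h4; rewrite exprSr; clear; lra.
- by move=> a l v v2 a12 l1; split; [exact: approx|exact: hom].
Qed.

End LeadingForm.

(** * Existence of p preimages near a zero of order p *)

Section Preim.
Variables (R : realType) (n : nat).
Local Notation E := 'Cv[R]_n.
Implicit Types (F G P : E -> E) (x y z v w h : E) (A B : 'M[R[i]^o]_n).
Implicit Types (e d M rho : R).
Lemma exists_small3 (a b c : R) : 0 < a -> 0 < b -> 0 < c ->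
  exists t : R, [/\ 0 < t, t <= a, t <= b & t <= c].
Proof.
move=> a0 b0 c0; exists (Num.min a (Num.min b c)); split.
- by rewrite !lt_min a0 b0.
- by rewrite ge_min lexx.
- by rewrite !ge_min lexx orbT.
- by rewrite !ge_min lexx !orbT.
Qed.

Lemma has_cdiff_scaled_sub (G : E -> E) u y z (l : R[i]) A B :
  has_cdiff G (l *: z) B ->
  has_cdiff (fun w => G (l *: w) - u - (w - y) *m A) z (l *: B - A).
Proof.
move=> GB e e0; have GB0 : has_cdiff G (0 + l *: z) B by rewrite add0r.
have [d d0 dP] := has_cdiff_affine (1 : R[i]) u GB0 e0.
exists d; first exact: d0.
move=> h hd; have := dP h hd.
rewrite !scale1r !add0r mul1r mulmxBr.
have -> : (z + h - y) *m A = (z - y) *m A + h *m A by rewrite -mulmxDl addrAC.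
move: (G _) (G _) (_ *m A) (h *m A) (h *m _) => q1 q2 q3 q4 q5.
congr (hnorm _ <= _); apply/rowP => i; rewrite !mxE; ring.
Qed.

Lemma cexp_pow (y : R) k : cexp 0 y ^+ k = cexp 0 (y * k%:R).
Proof.
elim: k => [|k IH].
  by rewrite expr0 mulr0 /cexp expR0 cos0 sin0 !mul1r.
by rewrite exprS IH -cexpD addr0 -natr1 mulrDr mulr1 addrC.
Qed.

(* If z_j solves G_t (xi^j z) = u near y0, with xi a primitive p-th root of
   unity and G_t z = t^-p F (x + t z) close to its limit P, then the points
   xi^j z_j are p distinct solutions of G_t = u, as P (xi z) = P z. *)
Lemma many_preimages F x rho M (m : nat) (c0 C0 t0 : R) : (0 < n)%N -> 0 < rho ->
  bounded_holo F x rho M -> F x = 0 -> (0 < m)%N -> 0 < c0 -> 0 < t0 ->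
  (forall h, 0 < hnorm h -> hnorm h < t0 ->
     c0 * hnorm h ^+ m <= hnorm (F (x + h)) ^+ 2 <= C0 * hnorm h ^+ m) ->
  exists2 p : nat, m = p.*2 & forall delta beta : R, 0 < delta -> 0 < beta ->
  exists W (sigma : R), 0 < sigma /\ forall w, hnorm (w - W) < sigma ->
    hnorm w < beta /\ exists s : seq E, [/\ uniq s, size s = p &
      forall z, z \in s -> hnorm (z - x) < delta /\ F z = w].
Proof.
move=> n0 rho0 FM Fx m0 c00 t00 growth.
have M0 : 0 <= M.
  by apply: le_trans (hnorm_ge0 (F x)) (FM x _).2; rewrite subrr hnorm0.
have [p [P [alpha [mp alpha0 PM Plow PP]]]] :=
  leading_form n0 rho0 FM Fx m0 c00 t00 growth.
exists p => // delta beta delta0 beta0.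
have p0 : (0 < p)%N by rewrite mp double_gt0 in m0.
pose s : R := rho / 2; have s0 : 0 < s by rewrite divr_gt0.
pose sC : R[i] := (s%:C)%C.
have nsC : normc sC = s by rewrite normc_real gtr0_norm.
have half0 : normc (0 : R[i]) <= 1 / 2 by rewrite Normc.normc0 divr_ge0.
have one1 : normc (1 : R[i]) <= 1 by rewrite Normc.normc1.
have zero2 : hnorm (0 : E) < 2 by rewrite hnorm0.
have P0 : P 0 = 0.
  have z1 : normc (0 : R[i]) <= 1 by rewrite Normc.normc0.
  have := (PP 0 0 0 zero2 half0 z1).2; rewrite scaler0 => ->.
  by rewrite expr0n gtn_eqF// scale0r.
have [y0 [A [y0h PA Au]]] := regular_point PM P0 alpha0 Plow.
have y02 : hnorm y0 < 2 by lra.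
have [cc cc0 Alow] : exists2 cc : R, 0 < cc & forall h, cc * hnorm h <= hnorm (h *m A).
  set S := \sum_(i < n) hnorm (row i (invmx A)).
  have S0 : 0 < S + 1 by rewrite ltr_wpDl ?sum_hnorm_row_ge0.
  exists (1 / (S + 1)) => [|h]; first by rewrite divr_gt0.
  have := hnorm_mulmx_le (invmx A) (h *m A); rewrite mulmxK// -/S => h1.
  rewrite mulrAC mul1r ler_pdivrMr//; apply: le_trans h1 _.
  by rewrite ler_wpM2l ?hnorm_ge0// lerDl.
have nreal (t : R) : 0 < t -> normc ((t%:C)%C : R[i]) = t by move=> tp; rewrite normc_real gtr0_norm.
pose xi : R[i] := cexp 0 (pi *+ 2 / p%:R).
have pR0 : 0 < p%:R :> R by rewrite ltr0n.
have nxi j : normc (xi ^+ j) = 1 by rewrite normcX normc_cexp expR0 expr1n.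
have xip : xi ^+ p = 1.
  rewrite cexp_pow mulfVK ?gt_eqF// -[pi *+ 2]add0r cexp_periodic.
  by rewrite /cexp expR0 cos0 sin0 !mul1r.
have xi1 j : (0 < j)%N -> (j < p)%N -> xi ^+ j != 1.
  move=> j0 jp; apply/eqP; rewrite cexp_pow => -[]; rewrite expR0 mul1r => c1 _.
  have pi2 : 0 < pi *+ 2 :> R by rewrite pmulrn_lgt0 ?pi_gt0.
  have a0 : 0 < pi *+ 2 / p%:R * j%:R :> R by rewrite mulr_gt0 ?divr_gt0 ?ltr0n.
  have a1 : pi *+ 2 / p%:R * j%:R < pi *+ 2 :> R.
    by rewrite mulrAC -mulrA gtr_pMr// ltr_pdivrMr// mul1r ltr_nat.
  have := cos_eq1 c1; rewrite ger0_norm ?(ltW a0)// => /(_ (ltW a1)).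
  by case=> [h|[h|h]]; move: a0 a1; rewrite h; clear; lra.
(* For p > 1 homogeneity makes P vanish to second order at 0, so its derivative there cannot be the
   invertible A. With y0 nonzero, the points xi^j y0 are distinct. *)
have y0n0 : (1 < p)%N -> y0 != 0.
  move=> p1; apply/eqP => y00; have [v v1] := exists_unit_vector R n0.
  have v2 : hnorm v < 2 by rewrite v1; lra.
  have : cc / 2 <= 0.
    have e0 : 0 < cc / 2 by rewrite divr_gt0.
    have [d d0 dP] := PA _ e0.
    pose tau : R := Num.min 1 (d / 2).
    have tau0 : 0 < tau by rewrite lt_min ltr01 divr_gt0.
    apply: (@le_linear_le0 _ _ (3 * M) tau tau0) => t tp tt.
    have t1 : t <= 1 by apply: le_trans tt _; rewrite ge_min lexx.
    have td : t < d.
      have : t <= d / 2 by apply: le_trans tt _; rewrite ge_min lexx orbT.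
      by move: d0; clear; lra.
    have nth : hnorm ((t%:C)%C *: v) = t by rewrite hnormZ nreal// v1 mulr1.
    have := dP ((t%:C)%C *: v); rewrite nth y00 add0r P0 subr0 => /(_ td) h1.
    have h2 := Alow ((t%:C)%C *: v); rewrite nth in h2.
    have h3 : hnorm (P ((t%:C)%C *: v)) <= t * t * (3 * M).
      have nt1 : normc ((t%:C)%C : R[i]) <= 1 by rewrite nreal.
      rewrite (PP 0 _ v v2 half0 nt1).2.
      rewrite hnormZ normcX nreal// ler_pM ?exprn_ge0 ?hnorm_ge0 ?(ltW tp)//.
        by rewrite -expr2 ler_wiXn2l ?(ltW tp).
      by apply: (PM v _).2; rewrite subr0.
    have h4 : hnorm (((t%:C)%C *: v) *m A) <= cc / 2 * t + t * t * (3 * M).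
      rewrite -(subrK (P ((t%:C)%C *: v)) (((t%:C)%C *: v) *m A)).
      by apply: le_trans (ler_hnormD _ _) _; rewrite hnormBC lerD.
    by rewrite -(ler_pM2l tp); move: (le_trans h2 h4); clear; lra.
  by rewrite leNgt divr_gt0.
have [eta eta0 etaP] : exists2 eta : R, 0 < eta & forall i j : 'I_p, i != j ->
    eta <= hnorm ((xi ^+ i - xi ^+ j) *: y0).
  pose f (ij : 'I_p * 'I_p) : R :=
    if ij.1 == ij.2 then 1 else hnorm ((xi ^+ ij.1 - xi ^+ ij.2) *: y0).
  have [|eta e0 eP] := @finite_pos_min _ _ f.
    move=> [i j]; rewrite /f /=; case: eqP => // /eqP ij.
    have ijn : (i != j :> nat) by [].
    have p1 : (1 < p)%N.
      move: (ltn_ord i) (ltn_ord j) ijn; move: (nat_of_ord i) (nat_of_ord j) => k l.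
      by clear; lia.
    rewrite hnormZ; apply: mulr_gt0; last by rewrite hnorm_gt0; exact: y0n0.
    rewrite normc_gt0 subr_eq0.
    wlog ij' : i j ij ijn / (i < j)%N.
      move=> wl; have [lt|lt|eq] := ltngtP i j; [exact: wl| |by rewrite eq eqxx in ijn].
      by rewrite eq_sym; apply: wl; rewrite // eq_sym.
    have := xi1 (j - i)%N; rewrite subn_gt0 => /(_ ij') h.
    have jip : (j - i < p)%N by rewrite (leq_ltn_trans (leq_subr _ _)).
    apply: contra (h jip) => /eqP xij; apply/eqP.
    have xin0 : xi ^+ i != 0 by rewrite -normc_gt0 nxi.
    by apply: (mulfI xin0); rewrite -exprD subnKC ?mulr1 ?(ltnW ij').
  by exists eta => // i j /negbTE ij; have := eP (i, j); rewrite /f /= ij.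
have M1 : 0 < M + 1 by rewrite ltr_wpDl.
have KM0 : 0 < 48 * (96 * (M + 1)) by rewrite mulr_gt0 ?mulr_gt0 ?ltr0n.
(* The conditions in turn keep the balls inside the domain, bound the quadratic error 48 M (2
   kappa)^2 of P by cc kappa / 24, and keep the perturbed points apart. *)
have [kappa [kappa0 k4 kc ke]] : exists kappa : R, [/\ 0 < kappa, kappa <= 1 / 4,
    kappa <= cc / (48 * (96 * (M + 1))) & kappa <= eta / 4].
  by apply: exists_small3; [exact: divr_gt0|exact: divr_gt0|exact: divr_gt0].
rewrite ler_pdivlMr// in kc.
(* One third of the error cc kappa / 8 allowed by [perturbed_zero]: b bounds each of |G - P|, the
   quadratic error of P and |u - P y0|. *)
have [b bE b0] : exists2 b : R, b = cc * kappa / 24 & 0 < b.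
  by exists (cc * kappa / 24); rewrite // divr_gt0 ?mulr_gt0.
have D0 : 0 < 3 * M + b + 1 by move: M0 b0; clear; lra.
have M20 : 0 < 2 * M + 1 by move: M0; clear; lra.
have [t [tp t12 tb td tbe]] : exists t : R, [/\ 0 < t, t <= 1 / 2, t * (2 * M + 1) <= b,
    t * (2 * s) <= delta & t * (2 * (3 * M + b + 1)) <= beta].
  have s20 : 0 < 2 * s by rewrite mulr_gt0.
  have D20 : 0 < 2 * (3 * M + b + 1) by rewrite mulr_gt0.
  exists (Num.min (1 / 2) (Num.min (b / (2 * M + 1))
    (Num.min (delta / (2 * s)) (beta / (2 * (3 * M + b + 1)))))); split.
  - by rewrite !lt_min !divr_gt0.
  - by rewrite ge_min lexx.
  - by rewrite -ler_pdivlMr// !ge_min lexx !orbT.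
  - by rewrite -ler_pdivlMr// !ge_min lexx !orbT.
  - by rewrite -ler_pdivlMr// !ge_min lexx !orbT.
have {}tb : 2 * M * t <= b by move: tb tp; clear; lra.
pose tC : R[i] := (t%:C)%C; have ntC : normc tC = t by rewrite nreal.
have tC0 : tC != 0 by rewrite -normc_gt0 ntC.
have tk : 0 < t ^+ p by rewrite exprn_gt0.
have tt1 : t ^+ p <= t by rewrite -[leRHS]expr1 ler_wiXn2l ?(ltW tp)//; move: t12; clear; lra.
have canc (q : E) : tC ^+ p *: (tC ^- p *: q) = q.
  by rewrite scalerA [X in X *: _](_ : _ = 1) ?scale1r//; apply: (@mulfV R[i]); rewrite expf_neq0.
(* Divided by t^p, this ball of values w becomes the ball of radius b around P y0. *)
exists (tC ^+ p *: P y0), (t ^+ p * b); split; first by rewrite mulr_gt0.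
move=> w; pose u := tC ^- p *: w.
have wu : w = tC ^+ p *: u by rewrite canc.
rewrite wu -scalerBr hnormZ normcX ntC ltr_pM2l// => uP.
have Py0 : hnorm (P y0) <= 3 * M by apply: (PM y0 _).2; rewrite subr0.
have nu : hnorm u <= 3 * M + b.
  by rewrite -(subrK (P y0) u); apply: le_trans (ler_hnormD _ _) _; rewrite addrC lerD// ltW.
split.
  rewrite hnormZ normcX ntC; apply: le_lt_trans (_ : t * (3 * M + b) < _).
    by rewrite ler_pM ?hnorm_ge0 ?(ltW tk).
  by move: tp tbe (mulr_gt0 tp D0); clear; lra.
have PM1 : bounded_holo P y0 1 (3 * M).
  by apply: bounded_holo_sub PM _; rewrite subr0; move: y0h; clear; lra.
pose G z := tC ^- p *: F (x + (tC * sC) *: z) - 0.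
have GP z : hnorm z < 2 -> hnorm (G z - P z) <= b.
  move=> z2; rewrite /G subr0 -(ler_pM2l tk) -{1}ntC -normcX -hnormZ scalerBr canc.
  have := (PP tC 1 z z2); rewrite ntC => /(_ t12 one1) [h _].
  apply: le_trans h _; rewrite [t ^+ p.+1]exprSr mulrCA -mulrA; apply: ler_wpM2l; first exact: ltW.
  by rewrite mulrA.
have sol (j : 'I_p) : exists2 z, hnorm (z - y0) < kappa & F (x + (tC * sC) *: (xi ^+ j *: z)) = w.
  pose err z := G (xi ^+ j *: z) - u - (z - y0) *m A.
  have errM : bounded_holo err y0 (2 * kappa) (cc * kappa / 8).
    move=> z zy.
    have z2 : hnorm z < 2.
      by rewrite -(subrK y0 z); apply: le_lt_trans (ler_hnormD _ _) _; move: zy y0h k4; clear; lra.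
    have xz2 : hnorm (xi ^+ j *: z) < 2 by rewrite hnormZ nxi mul1r.
    split.
      have zin : hnorm (x + (tC * sC) *: (xi ^+ j *: z) - x) < rho.
        rewrite addrC addrA addNr add0r hnormZ Normc.normcM ntC nsC.
        have : t * s * hnorm (xi ^+ j *: z) < t * s * 2 by rewrite ltr_pM2l ?mulr_gt0.
        by rewrite /s => h; apply: lt_le_trans h _; move: t12 rho0; clear; nra.
      have [[B FB] _] := FM _ zin.
      have GB : has_cdiff G (xi ^+ j *: z) ((tC ^- p * (tC * sC)) *: B).
        exact: has_cdiff_affine FB.
      by eexists; exact: has_cdiff_scaled_sub GB.
    have hom : P (xi ^+ j *: z) = P z.
      have nx1 : normc (xi ^+ j) <= 1 by rewrite nxi.
      rewrite (PP 0 _ z z2 half0 nx1).2.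
      by rewrite -exprM mulnC exprM xip expr1n scale1r.
    have z12 : hnorm (z - y0) <= 1 / 2 by move: zy k4; clear; lra.
    have [h1 _ _] := holo_estimates ltr01 PM1 PA z12; rewrite subrKC expr1n divr1 in h1.
    have h2 := GP _ xz2; rewrite hom in h2.
    have -> : err z = (G (xi ^+ j *: z) - P z) + (P z - P y0 - (z - y0) *m A) - (u - P y0).
      rewrite /err; move: (G _) (P z) (_ *m A) => q1 q2 q3.
      by apply/rowP => i; rewrite !mxE; ring.
    apply: le_trans (ler_hnormB _ _) _.
    have h3 := ler_hnormD (G (xi ^+ j *: z) - P z) (P z - P y0 - (z - y0) *m A).
    have h4 : 16 * (3 * M) * hnorm (z - y0) ^+ 2 <= b.
      have h5 : hnorm (z - y0) ^+ 2 <= (2 * kappa) ^+ 2.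
        by rewrite ler_sqr ?nnegrE ?hnorm_ge0 ?mulr_ge0 ?(ltW kappa0)// ltW.
      apply: le_trans (ler_wpM2l _ h5) _; first by rewrite !mulr_ge0.
      have h6 : kappa * (48 * (96 * (M + 1))) * kappa <= cc * kappa by rewrite ler_pM2r.
      rewrite bE; have kk := mulr_gt0 kappa0 kappa0; clear - h6 kk M0; nra.
    rewrite bE in h2 h4 uP; clear - h1 h2 h3 h4 uP; lra.
  have [z zy zero] := perturbed_zero cc0 kappa0 Alow errM.
  exists z => //; move: zero; rewrite /err addrC subrK => /eqP.
  by rewrite subr_eq0 /G subr0 => /eqP h; rewrite wu -h canc.
have {}sol j : exists z, hnorm (z - y0) < kappa /\ F (x + (tC * sC) *: (xi ^+ (j : 'I_p) *: z)) = w.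
  by have [z] := sol j; exists z.
have [z zP] := choice sol.
pose pt (j : 'I_p) := x + (tC * sC) *: (xi ^+ j *: z j).
have tsC0 : tC * sC != 0 by rewrite mulf_neq0// -normc_gt0 nsC.
have pt_inj : injective pt.
  move=> i j /addrI /(scalerI tsC0) ij; apply/eqP/negPn/negP => nij.
  have := etaP i j nij; apply/negP; rewrite -ltNge.
  have -> : (xi ^+ i - xi ^+ j) *: y0 = xi ^+ j *: (z j - y0) - xi ^+ i *: (z i - y0).
    rewrite !scalerBr ij scalerBl.
    move: (xi ^+ i *: y0) (xi ^+ j *: y0) (xi ^+ j *: z j) => q1 q2 q3.
    by apply/rowP => k; rewrite !mxE; ring.
  apply: le_lt_trans (ler_hnormB _ _) _; rewrite !hnormZ !nxi !mul1r.
  by move: (zP i).1 (zP j).1 ke eta0; clear; lra.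
exists (map pt (enum 'I_p)); split.
- by rewrite map_inj_uniq ?enum_uniq.
- by rewrite size_map size_enum_ord.
- move=> q /mapP[j _ ->]; split; last by rewrite /pt (zP j).2 -wu.
  rewrite /pt addrC addrA addNr add0r !hnormZ Normc.normcM ntC nsC nxi mul1r.
  have z1 : hnorm (z j) < 1.
    rewrite -(subrK y0 (z j)); apply: le_lt_trans (ler_hnormD _ _) _.
    by move: (zP j).1 y0h k4; clear; lra.
  have : t * s * hnorm (z j) < t * s * 1 by rewrite ltr_pM2l ?mulr_gt0.
  by move: (mulr_gt0 tp s0) td; clear; lra.
Qed.

End Preim.

(** * Cells of a grid and recovery of integers from residues *)

Section Cells.
Variable R : realType.

Lemma eq_of_mod (b i j : nat) : i = j %[mod b] -> (i < j + b)%N -> (j < i + b)%N -> i = j.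
Proof.
wlog ij : i j / (i <= j)%N => [wl|] e h1 h2.
  by have [ij|ij] := leqP i j; [exact: wl|apply/esym; apply: wl; rewrite // ltnW].
apply/eqP; rewrite eqn_leq ij /= leqNgt; apply/negP => lt.
have : (b %| j - i)%N by rewrite -eqn_mod_dvd// e.
move=> /dvdn_leq; rewrite subn_gt0 => /(_ lt); rewrite leqNgt => /negP; apply.
by rewrite ltn_subLR.
Qed.

Lemma ltn_of_ler (s C a b : R) (i j B : nat) : 0 < s -> s * `|i%:R - j%:R| <= s * C ->
  C <= B%:R -> (i < j + B.+1)%N /\ (j < i + B.+1)%N.
Proof.
move=> s0; rewrite ler_pM2l// => h CB; have {}h := le_trans h CB.
have h1 := le_trans (ler_norm _) h; rewrite distrC in h; have h2 := le_trans (ler_norm _) h.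
by rewrite !addnS !ltnS -!(ler_nat R) !natrD -!lerBlDl.
Qed.

Lemma interval_cells (d : R) k : 0 < d -> exists c : R -> 'I_k.+1,
  forall u v, `|u| < d -> `|v| < d -> c u = c v -> `|u - v| <= 2 * d / k.+1%:R.
Proof.
move=> d0; have K0 : 0 < k.+1%:R :> R by rewrite ltr0n.
pose X u := (u + d) * k.+1%:R / (2 * d).
have d20 : 0 < 2 * d by rewrite mulr_gt0.
have XP u : `|u| < d -> (Num.truncn (X u) < k.+1)%N /\
    (Num.truncn (X u))%:R <= X u < (Num.truncn (X u)).+1%:R.
  rewrite ltr_norml => /andP[u1 u2].
  have X0 : 0 <= X u by rewrite divr_ge0 ?(ltW d20)// mulr_ge0 ?(ltW K0)//; lra.
  have h := truncn_itv X0; split => //; rewrite -(ltr_nat R).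
  apply: le_lt_trans (andP h).1 _; rewrite ltr_pdivrMr// mulrC ltr_pM2l//; lra.
exists (fun u => inord (Num.truncn (X u))) => u v /XP[u1 u2] /XP[v1 v2] /(congr1 val).
rewrite /= !inordK// => e; rewrite e in u2.
have : `|X u - X v| < 1.
  by move: u2 v2; rewrite -natr1 ltr_norml; clear; lra.
have -> : X u - X v = (u - v) * (k.+1%:R / (2 * d)) by rewrite /X; ring.
rewrite normrM [X in _ * X]gtr0_norm ?divr_gt0// mulrA ltr_pdivrMr// mul1r => /ltW.
by rewrite -ler_pdivlMr.
Qed.

Lemma normr_Re_le (z : R[i]) : `|complex.Re z| <= normc z.
Proof. by rewrite -ler_sqr ?nnegrE ?normc_ge0// normc_sqr real_normK ?num_real// lerDl sqr_ge0. Qed.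

Lemma normr_Im_le (z : R[i]) : `|complex.Im z| <= normc z.
Proof. by rewrite -ler_sqr ?nnegrE ?normc_ge0// normc_sqr real_normK ?num_real// lerDr sqr_ge0. Qed.

(** The real and imaginary parts of each coordinate are put into k + 1 intervals. Used twice: to
    localise critical points in the Sard argument and to cut omega into small pieces. *)
Lemma ball_cells n (x : 'Cv[R]_n) (d : R) k : 0 < d ->
  exists cell : 'Cv[R]_n -> {ffun 'I_n -> 'I_k.+1 * 'I_k.+1}, forall y z,
  hnorm (y - x) < d -> hnorm (z - x) < d -> cell y = cell z ->
  hnorm (y - z) <= 4 * n%:R * d / k.+1%:R.
Proof.
move=> d0; have [c cP] := interval_cells k d0.
exists (fun y => [ffun i => (c (complex.Re ((y - x) 0 i)), c (complex.Im ((y - x) 0 i)))]).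
move=> y z yx zx /ffunP yz; apply: le_trans (hnorm_le_sum _) _.
rewrite [leRHS](_ : _ = \sum_(i < n) (2 * (2 * d / k.+1%:R))); last first.
  by rewrite sumr_const card_ord -[RHS]mulr_natl; ring.
apply: ler_sum => i _; have := yz i; rewrite !ffunE => -[e1 e2].
have lt w (wx : hnorm (w - x) < d) : normc ((w - x) 0 i) < d.
  exact: le_lt_trans (normc_coord _ _) wx.
have := cP _ _ (le_lt_trans (normr_Re_le _) (lt y yx)) (le_lt_trans (normr_Re_le _) (lt z zx)) e1.
have := cP _ _ (le_lt_trans (normr_Im_le _) (lt y yx)) (le_lt_trans (normr_Im_le _) (lt z zx)) e2.
have -> : (y - z) 0 i = (y - x) 0 i - (z - x) 0 i by rewrite !mxE; ring.
move: ((y - x) 0 i) ((z - x) 0 i) => [a1 b1] [a2 b2] h1 h2.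
by apply: le_trans (normc_le_ReIm _) _; rewrite [leRHS]mulr_natl mulr2n; exact: lerD h2 h1.
Qed.

Lemma exists_nat_ge (a : R) : exists k : nat, a <= k%:R.
Proof. by exists (Num.truncn a).+1; rewrite ltW// truncnS_gt. Qed.

End Cells.

(** * Regular values by counting grid points *)

Section Sard.
Variables (R : realType) (n : nat).
Local Notation E := 'Cv[R]_n.+1.
Implicit Types (F : E -> E) (x y z w : E) (A : 'M[R[i]^o]_n.+1).
Implicit Types (d L M rho sigma : R).

(* At a critical point some coordinate i0 of F is, to first order, a
   combination of the others. In a cell of side 1/K the critical values
   therefore meet O(K^(2n)) points of a grid of step 1/K^2 in C^(n+1), against
   K^(4n+4) grid points and K^(2n+2) cells. *)
Lemma regular_value_pigeonhole F x w0 d sigma L : 0 < d -> 0 < sigma -> 0 <= L ->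
  (forall y z, hnorm (y - x) < d -> hnorm (z - x) < d ->
     hnorm (F y - F z) <= L * hnorm (y - z)) ->
  exists2 w, hnorm (w - w0) < sigma & forall z, hnorm (z - x) < d -> F z = w ->
    forall (i0 : 'I_n.+1) (l : 'I_n.+1 -> R[i]), l i0 = 1 ->
    ~ (forall y, hnorm (y - x) < d ->
         normc (\sum_i (F y 0 i - F z 0 i) * l i) <= L * hnorm (y - z) ^+ 2).
Proof.
move=> d0 sigma0 L0 lip; apply: contrapT => noW.
have crit w : hnorm (w - w0) < sigma -> exists zi : E * 'I_n.+1,
   [/\ hnorm (zi.1 - x) < d, F zi.1 = w & exists2 l : 'I_n.+1 -> R[i], l zi.2 = 1 &
     forall y, hnorm (y - x) < d ->
       normc (\sum_i (F y 0 i - F zi.1 0 i) * l i) <= L * hnorm (y - zi.1) ^+ 2].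
  move=> ww; apply: contrapT => h; apply: noW; exists w => // z zx zw i0 l l1 lP.
  by apply: h; exists (z, i0); split => //; exists l.
have N0 : 0 < n.+1%:R :> R by rewrite ltr0n.
have [s1 s1E s10] : exists2 s1 : R, s1 * (4 * n.+1%:R) = sigma & 0 < s1.
  by exists (sigma / (4 * n.+1%:R)); rewrite ?divr_gt0 ?mulr_gt0// mulfVK// gt_eqF// mulr_gt0.
have [Q QE Q0] : exists2 Q : R, Q = 4 * n.+1%:R * d & 0 <= Q.
  by exists (4 * n.+1%:R * d) => //; rewrite ?mulr_ge0// ltW.
have [C1 C1P] := exists_nat_ge (L * Q / s1).
have [C2 C2P] := exists_nat_ge (L * Q ^+ 2 / s1).
rewrite ler_pdivrMr// in C1P; rewrite ler_pdivrMr// in C2P.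
(* C3 gathers all factors of the final count that do not involve K; K = C3 + 1 makes C3 < K^2, which
   decides the comparison. *)
pose B := C1.+1; pose C3 := (n.+1 * (B * B) ^ n * (C2.+1 * C2.+1))%N.
have [k kE] : exists k, k = C3 by exists C3.
pose K := k.+1; pose T := (K * K)%N; pose b := (C1 * K).+1; pose b' := C2.+1.
have K0 : 0 < K%:R :> R by rewrite ltr0n.
have [s sE s0] : exists2 s : R, s * K%:R ^+ 2 = s1 & 0 < s.
  by exists (s1 / K%:R ^+ 2); rewrite ?divr_gt0 ?exprn_gt0// mulfVK// gt_eqF// exprn_gt0.
pose wg (g : {ffun 'I_n.+1 -> 'I_T * 'I_T}) : E :=
  w0 + \row_i ((s * (g i).1%:R) +i* (s * (g i).2%:R))%C.
have sT (j : 'I_T) : `|s * j%:R| <= s1.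
  rewrite normrM gtr0_norm// normr_nat -sE ler_pM2l// expr2 -natrM ler_nat.
  exact: ltnW (ltn_ord j).
have wgin g : hnorm (wg g - w0) < sigma.
  rewrite /wg addrC addrA addNr add0r; apply: le_lt_trans (hnorm_le_sum _) _.
  apply: (@le_lt_trans _ _ (\sum_(i < n.+1) (s1 + s1))).
    by apply: ler_sum => i _; rewrite mxE; apply: le_trans (normc_le_ReIm _) _; exact: lerD (sT _) (sT _).
  by rewrite sumr_const card_ord -mulr_natr -s1E; have := mulr_gt0 s10 N0; clear; lra.
have [zi ziP] := choice (fun g => crit (wg g) (wgin g)).
have [cell cellP] := ball_cells x k d0.
have md (a m : nat) : (a %% m.+1 < m.+1)%N by rewrite ltn_mod.
(* Within one cell, values differ by at most C1 K grid steps in every coordinate, and by at most C2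
   in the coordinate i0 once the others agree. Residues modulo C1 K + 1 and C2 + 1 thus determine
   the grid point. *)
pose code g := (cell (zi g).1, (zi g).2,
  [ffun i : 'I_n => (Ordinal (md (g (lift (zi g).2 i)).1 (C1 * K)%N),
                     Ordinal (md (g (lift (zi g).2 i)).2 (C1 * K)%N))],
  (Ordinal (md (g (zi g).2).1 C2), Ordinal (md (g (zi g).2).2 C2))).
have dwg g g' i : wg g 0 i - wg g' 0 i =
   ((s * ((g i).1%:R - (g' i).1%:R)) +i* (s * ((g i).2%:R - (g' i).2%:R)))%C.
  by rewrite !mxE; case: (w0 0 i) => a1 a2; congr (_ +i* _)%C => /=; ring.
have coord g g' i (C : R) (m : nat) : normc (wg g 0 i - wg g' 0 i) <= s * C -> C <= m%:R ->
   [/\ (g i).1 = (g' i).1 %[mod m.+1] -> (g i).1 = (g' i).1 &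
       (g i).2 = (g' i).2 %[mod m.+1] -> (g i).2 = (g' i).2].
  move=> h Cm; rewrite dwg in h.
  have h1 := le_trans (normr_Re_le _) h; have h2 := le_trans (normr_Im_le _) h.
  rewrite /= normrM (gtr0_norm s0) in h1; rewrite /= normrM (gtr0_norm s0) in h2.
  have [l1 l2] := ltn_of_ler 0 0 s0 h1 Cm; have [l3 l4] := ltn_of_ler 0 0 s0 h2 Cm.
  by split=> e; apply/val_inj; apply: eq_of_mod e _ _.
have code_inj : injective code.
  move=> g g' [e1 e2 e3 e4 e5].
  have [zx Fz [l l1 lP]] := ziP g; have [zx' Fz' _] := ziP g'.
  rewrite -e2 in e3 e4 e5; move: zx Fz l1 lP zx' Fz' e1 e3 e4 e5.
  move: (zi g).1 (zi g').1 (zi g).2 => z z' i0 zx Fz l1 lP zx' Fz' e1 e3 e4 e5.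
  have zz := cellP _ _ zx zx' e1; rewrite -QE -/K in zz.
  have off i : i != i0 -> g i = g' i.
    rewrite eq_sym => /unlift_some[j -> _].
    have /(coord g g' (lift i0 j)) : normc (wg g 0 (lift i0 j) - wg g' 0 (lift i0 j)) <=
        s * (L * Q / s1 * K%:R).
      have := normc_coord (wg g - wg g') (lift i0 j); rewrite !mxE => /le_trans; apply.
      rewrite -Fz -Fz'; apply: le_trans (lip _ _ zx zx') _.
      rewrite [leRHS](_ : _ = L * (Q / K%:R)); first by rewrite ler_wpM2l.
      by rewrite -sE; field; rewrite !gt_eqF.
    have C1K : L * Q / s1 * K%:R <= (C1 * K)%:R.
      by rewrite natrM ler_wpM2r ?(ltW K0)// ler_pdivrMr.
    move=> /(_ _ C1K) [f1 f2]; have /ffunP/(_ j) := e3; rewrite !ffunE => -[m1 m2].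
    by rewrite (surjective_pairing (g _)) (f1 m1) (f2 m2) -surjective_pairing.
  have on : g i0 = g' i0.
    have /(coord g' g i0) : normc (wg g' 0 i0 - wg g 0 i0) <= s * (L * Q ^+ 2 / s1).
      have := lP _ zx'; rewrite (bigD1 i0)//= big1 ?addr0 => [|i i0i]; last first.
        by rewrite Fz Fz' dwg off// !subrr mulr0 mul0r.
      rewrite l1 mulr1 Fz Fz' hnormBC => /le_trans; apply.
      rewrite [leRHS](_ : _ = L * (Q / K%:R) ^+ 2); last by rewrite -sE; field; rewrite !gt_eqF.
      by rewrite ler_wpM2l// lerXn2r ?nnegrE ?hnorm_ge0 ?divr_ge0// ltW.
    have C2K : L * Q ^+ 2 / s1 <= C2%:R by rewrite ler_pdivrMr.
    move=> /(_ _ C2K) [f1 f2].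
    by rewrite (surjective_pairing (g _)) -(f1 (esym e4)) -(f2 (esym e5)) -surjective_pairing.
  by apply/ffunP => i; have [->|/off] := eqVneq i i0.
have := leq_card code code_inj; rewrite !card_prod !card_ffun !card_prod !card_ord.
apply/negP; rewrite -ltnNge.
have bB : (b <= B * K)%N by rewrite /b /B mulSn addnC -addn1 leq_add2l.
have h1 : ((b * b) ^ n <= (B * B) ^ n * (K * K) ^ n)%N.
  have [e|n0] := posnP n; first by rewrite e.
  by rewrite -expnMn mulnACA leq_exp2r// leq_mul.
have C3K : (C3 < K * K)%N by rewrite -kE (leq_trans (ltnSn k))// leq_pmulr.
have KK0 : (0 < (K * K) ^ n)%N by rewrite expn_gt0.
apply: (@leq_ltn_trans ((K * K) ^ n.+1 * n.+1 * ((B * B) ^ n * (K * K) ^ n) * (C2.+1 * C2.+1))).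
  by rewrite leq_mul2r leq_mul2l h1 !orbT.
have -> : ((K * K) ^ n.+1 * n.+1 * ((B * B) ^ n * (K * K) ^ n) * (C2.+1 * C2.+1) =
   (K * K) ^ n.+1 * (C3 * (K * K) ^ n))%N by rewrite /C3; ring.
have -> : ((T * T) ^ n.+1 = (K * K) ^ n.+1 * (K * K * (K * K) ^ n))%N by rewrite expnMn -expnS.
by rewrite ltn_pmul2l ?expn_gt0// ltn_pmul2r.
Qed.



(** If the derivative at z is singular, a vector v with A v^T = 0, divided by its entry of largest
    modulus, gives weights l with l i0 = 1 and |l i| <= 1 such that the sum of the l i F_i has zero
    derivative at z. Its increments are then quadratic, which the pigeonhole lemma excludes. *)
Lemma regular_value_dense F x rho M w0 d sigma : 0 < rho -> bounded_holo F x rho M ->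
  0 < d -> d <= rho / 8 -> 0 < sigma ->
  exists2 w, hnorm (w - w0) < sigma &
    forall z A, hnorm (z - x) < d -> F z = w -> has_cdiff F z A -> A \in unitmx.
Proof.
move=> rho0 FM d0 dr sigma0.
have M0 : 0 <= M.
  by apply: le_trans (hnorm_ge0 (F x)) (FM x _).2; rewrite subrr hnorm0.
have r20 : 0 < rho / 2 by rewrite divr_gt0.
have N0 : 0 < n.+1%:R :> R by rewrite ltr0n.
pose a1 := 16 * M / (rho / 2) ^+ 2; pose a2 := 4 * M / (rho / 2).
have a10 : 0 <= a1 by rewrite divr_ge0 ?mulr_ge0 ?exprn_ge0// ltW.
have a20 : 0 <= a2 by rewrite divr_ge0 ?mulr_ge0// ltW.
have zM z : hnorm (z - x) < d -> bounded_holo F z (rho / 2) M.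
  by move=> zx; apply: bounded_holo_sub FM _; clear - zx dr rho0; lra.
have yz4 y z : hnorm (y - x) < d -> hnorm (z - x) < d -> hnorm (y - z) <= rho / 2 / 2.
  move=> yx zx; apply: le_trans (ler_hnorm_dist _ x _) _; rewrite [X in _ + X]hnormBC.
  by clear - yx zx dr rho0; lra.
have L0 : 0 <= n.+1%:R * a1 + a2 by rewrite addr_ge0// mulr_ge0.
have [|w ww wP] := regular_value_pigeonhole (F := F) (x := x) w0 d0 sigma0 L0.
  move=> y z yx zx; have zr : hnorm (z - z) < rho / 2 by rewrite subrr hnorm0.
  have [[A FA] _] := zM z zx z zr.
  have [_ _] := holo_estimates r20 (zM z zx) FA (yz4 y z yx zx).
  rewrite subrKC -/a2 => /le_trans; apply; rewrite ler_wpM2r ?hnorm_ge0// lerDr.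
  exact: mulr_ge0 (ltW N0) a10.
exists w => // z A zx zw FA; rewrite unitmxE unitfE; apply/negP => /eqP detA.
have /det0P[v v0 vA] : \det (A : 'M[R[i]]_n.+1)^T == 0 by rewrite det_tr; apply/eqP.
have [i0 _ i0P] := @Order.TotalTheory.arg_maxP _ _ _ ord0 xpredT (fun i => normc (v 0 i)) isT.
have vi0 : v 0 i0 != 0.
  apply: contra v0 => /eqP vi; apply/eqP/rowP => i; rewrite mxE; apply/eqP.
  by rewrite -normc_eq0 eq_le normc_ge0 andbT; have := i0P i isT; rewrite vi Normc.normc0.
have nv0 : 0 < normc (v 0 i0) by rewrite normc_gt0.
apply: (wP z zx zw i0 (fun i => v 0 i / v 0 i0)) => [|y yx]; first exact: mulfV.
have [h1 _ _] := holo_estimates r20 (zM z zx) FA (yz4 y z yx zx).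
rewrite subrKC -/a1 in h1; set D := F y - F z - _ in h1.
have -> : \sum_i (F y 0 i - F z 0 i) * (v 0 i / v 0 i0) = \sum_i D 0 i * (v 0 i / v 0 i0).
  apply/eqP; rewrite -subr_eq0 -sumrB.
  have -> : \sum_i ((F y 0 i - F z 0 i) * (v 0 i / v 0 i0) - D 0 i * (v 0 i / v 0 i0)) =
     (\sum_i ((y - z) *m A) 0 i * v 0 i) / v 0 i0.
    rewrite mulr_suml; apply: eq_bigr => i _; rewrite /D; move: ((y - z) *m A) => B.
    by rewrite !mxE; ring.
  have : (((y - z) : 'rV[R[i]]_n.+1) *m (A : 'M[R[i]]_n.+1)) *m v^T = 0.
    by rewrite -mulmxA -[A]trmxK -trmx_mul vA trmx0 mulmx0.
  move=> /matrixP/(_ 0 0); rewrite mxE [in RHS]mxE => h.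
  rewrite [X in X / _](_ : _ = 0) ?mul0r// -[RHS]h.
  by apply: eq_bigr => i _; rewrite [v^T _ _]mxE.
apply: (@le_trans _ _ (\sum_(i < n.+1) hnorm D)).
  elim/big_ind2: _ => [|a b c e ab ce|i _]; first by rewrite Normc.normc0.
    by apply: le_trans (le_normcD _ _) _; exact: lerD.
  rewrite Normc.normcM; apply: (@le_trans _ _ (normc (D 0 i) * 1)); last first.
    by rewrite mulr1; exact: normc_coord.
  apply: ler_wpM2l; first exact: normc_ge0.
  rewrite Normc.normcM; have -> : normc (v 0 i0)^-1 = (normc (v 0 i0))^-1.
    apply: (mulfI (lt0r_neq0 nv0)); rewrite -Normc.normcM mulfV// mulfV ?gt_eqF//.
    exact: Normc.normc1.
  by rewrite ler_pdivrMr// mul1r; exact: i0P.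
rewrite sumr_const card_ord -[leLHS]mulr_natl.
apply: (@le_trans _ _ (n.+1%:R * (a1 * hnorm (y - z) ^+ 2))); first by rewrite ler_wpM2l// ltW.
by rewrite mulrA ler_wpM2r ?exprn_ge0 ?hnorm_ge0// lerDl.
Qed.

End Sard.

(** * The real Jacobian determinant of a complex linear map *)

Section RealJacobian.
Variables (R : realType).

(** With A = P + i Q acting on row vectors, (u + i v) A = (u P - v Q) + i (u Q + v P). *)
Definition real_block n (A : 'M[R[i]]_n) : 'M[R]_(n + n) :=
  block_mx (map_mx (@complex.Re R) A) (map_mx (@complex.Im R) A)
           (- map_mx (@complex.Im R) A) (map_mx (@complex.Re R) A).

Lemma to_real_mulmx n (A : 'M[R[i]]_n) (h : 'Cv[R]_n) :
  to_real (h *m (A : 'M[R[i]^o]_n)) = to_real h *m real_block A.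
Proof.
have ReM (a b : R[i]) : complex.Re (a * b) = complex.Re a * complex.Re b - complex.Im a * complex.Im b.
  by case: a => ? ?; case: b.
have ImM (a b : R[i]) : complex.Im (a * b) = complex.Re a * complex.Im b + complex.Im a * complex.Re b.
  by case: a => ? ?; case: b.
rewrite /to_real /real_block mul_row_block; congr row_mx; apply/rowP => i; rewrite !mxE.
  rewrite (raddf_sum (@complex.Re R)) -big_split /=; apply: eq_bigr => j _.
  by rewrite !mxE ReM mulrN.
rewrite (raddf_sum (@complex.Im R)) -big_split /=; apply: eq_bigr => j _.
by rewrite !mxE ImM.
Qed.

(* Over C, [[P, Q], [-Q, P]] is similar by unitriangular matrices to
   [[P - iQ, 0], [-Q, P + iQ]]. *)
Lemma det_real_block n (A : 'M[R[i]]_n) : ((\det (real_block A))%:C)%C = (normc (\det A) ^+ 2)%:C%C.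
Proof.
have normcE (a : R[i]) : ((normc a ^+ 2)%:C)%C = (a^*)%C * a.
  by rewrite normc_sqr; case: a => a b; apply/eqP; rewrite eq_complex /=; apply/andP; split; apply/eqP; ring.
pose P := map_mx (fun a : R[i] => ((complex.Re a)%:C)%C) A.
pose Q := map_mx (fun a : R[i] => ((complex.Im a)%:C)%C) A.
have AE : P + ci *: Q = A.
  apply/matrixP => i j; rewrite !mxE; case: (A i j) => a b.
  by apply/eqP; rewrite eq_complex /=; apply/andP; split; apply/eqP; ring.
have AcE : P - ci *: Q = map_mx (@conjc R) A.
  apply/matrixP => i j; rewrite !mxE; case: (A i j) => a b.
  by apply/eqP; rewrite eq_complex /=; apply/andP; split; apply/eqP; ring.
rewrite normcE -det_map_mx -det_map_mx.
have -> : map_mx (real_complex R) (real_block A) = block_mx P Q (- Q) P.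
  rewrite /real_block map_block_mx; congr block_mx; apply/matrixP => i j; rewrite !mxE//.
  by apply/eqP; rewrite eq_complex /= oppr0 !eqxx.
have ii : ci * ci = -1 :> R[i].
  by apply/eqP; rewrite eq_complex /=; apply/andP; split; apply/eqP; ring.
pose U : 'M[R[i]]_(n + n) := block_mx 1%:M (ci%:M) 0 1%:M.
pose V : 'M[R[i]]_(n + n) := block_mx 1%:M ((- ci)%:M) 0 1%:M.
have detU : \det U = 1 by rewrite det_ublock !det1 mulr1.
have detV : \det V = 1 by rewrite det_ublock !det1 mulr1.
rewrite -[LHS]mulr1 -detV -[LHS]mul1r -detU mulrA -!det_mulmx.
have -> : U *m block_mx P Q (- Q) P *m V = block_mx (map_mx (@conjc R) A) 0 (- Q) A.
  rewrite /U /V !mulmx_block !mul1mx !mul0mx !mulmx1 !mulmx0 !addr0 !add0r.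
  rewrite !mul_scalar_mx !mul_mx_scalar; congr block_mx.
  - by rewrite scalerN.
  - move: P Q {AE AcE} => P Q; apply/matrixP => i j; rewrite !mxE.
    rewrite (_ : _ + _ = (1 + ci * ci) * Q i j); last by ring.
    by rewrite ii subrr mul0r.
  - by rewrite scalerN scaleNr opprK addrC.
by rewrite det_lblock det_mulmx.
Qed.

Lemma det_real_block_gt0 n (A : 'M[R[i]^o]_n) : A \in unitmx ->
  0 < \det (real_block A).
Proof.
move=> Au; have [] := det_real_block (A : 'M[R[i]]_n) => ->.
by rewrite exprn_gt0// normc_gt0 -unitfE -unitmxE.
Qed.

End RealJacobian.

(** * Lower bound for the local degree *)

Section LocalDegree.
Variables (R : realType) (n : nat).
Local Notation E := 'Cv[R]_n.+1.
Local Notation V := 'rV[R]_(n.+1 + n.+1).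
Implicit Types (F : E -> E) (x y z w : E) (A : 'M[R[i]^o]_n.+1) (u : V).

Lemma to_real_norm_le z : `|to_real z| <= hnorm z.
Proof. by rewrite -rnorm_to_real; exact: mx_norm_le_rnorm. Qed.

Lemma hnorm_of_real_le u : hnorm (of_real u) <= (n.+1 + n.+1)%:R * `|u|.
Proof. by rewrite hnorm_of_real; exact: rnorm_le_mx_norm. Qed.

Lemma mulmx_real_block_continuous A :
  continuous (mulmxr (real_block (A : 'M[R[i]]_n.+1)) : V -> V).
Proof.
move=> u B /nbhs_normP[e /= e0 eB].
have N0 : 0 < (n.+1 + n.+1)%:R :> R by rewrite ltr0n.
set S := \sum_(i < n.+1) hnorm (row i A).
have S0 : 0 < S + 1 by rewrite ltr_wpDl ?sum_hnorm_row_ge0.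
have D0 : 0 < (n.+1 + n.+1)%:R * (S + 1) by rewrite mulr_gt0.
apply: (iffRL (@nbhs_normP R V _ _)); exists (e / ((n.+1 + n.+1)%:R * (S + 1))); first by rewrite /= divr_gt0.
move=> v /=; rewrite ltr_pdivlMr// => uv; apply: eB; rewrite /= -mulmxBl -[u - v]of_realK -to_real_mulmx.
apply: le_lt_trans (to_real_norm_le _) _; apply: le_lt_trans (hnorm_mulmx_le _ _) _.
rewrite -/S; apply: le_lt_trans uv; rewrite mulrA [X in _ <= X * _]mulrC.
apply: ler_pM; [exact: hnorm_ge0|exact: sum_hnorm_row_ge0|exact: hnorm_of_real_le|].
by rewrite lerDl.
Qed.

Lemma jacobian_real_map F z A : has_cdiff F z A ->
  jacobian (real_map F) (to_real z) = real_block (A : 'M[R[i]]_n.+1).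
Proof.
move=> FA; rewrite /jacobian.
suff -> : 'd (real_map F) (to_real z) = mulmxr (real_block (A : 'M[R[i]]_n.+1)) :> (V -> V).
  by apply/row_matrixP => i; rewrite !rowE mul_rV_lin1.
apply: diff_unique; first exact: mulmx_real_block_continuous.
apply/eqaddoP => e e0.
have N0 : 0 < (n.+1 + n.+1)%:R :> R by rewrite ltr0n.
have e1 : 0 < e / (n.+1 + n.+1)%:R by rewrite divr_gt0.
have [d d0 dP] := FA _ e1.
apply: (iffRL (@nbhs_norm0P R V _)); exists (d / (n.+1 + n.+1)%:R); first by rewrite /= divr_gt0.
move=> u /=; rewrite ltr_pdivlMr// => ud.
have uN := hnorm_of_real_le u.
have {}ud : hnorm (of_real u) < d by apply: le_lt_trans uN _; rewrite mulrC.
have h := dP _ ud.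
have -> : (real_map F \o shift (to_real z) - (cst (real_map F (to_real z)) +
     mulmxr (real_block (A : 'M[R[i]]_n.+1)))) u =
   to_real (F (z + of_real u) - F z - of_real u *m A).
  rewrite -[LHS]/(real_map F (u + to_real z) - (real_map F (to_real z) +
     u *m real_block (A : 'M[R[i]]_n.+1))).
  rewrite /real_map of_realD to_realK [z + _]addrC !to_realB to_real_mulmx of_realK.
  by rewrite opprD addrA.
apply: le_trans (to_real_norm_le _) _; apply: le_trans h _.
by rewrite mulrAC ler_pdivrMr// -mulrA ler_wpM2l ?(ltW e0)// mulrC.
Qed.

(** The neighbourhood of F x in which the degree formula holds depends on delta, so the preimages
    must be available for all delta and beta. A regular value w of the resulting ball has only
    preimages of sign 1: mu is their number, and p of them are known. *)
Lemma local_degree_ge F x rho M (p : nat) mu : 0 < rho -> bounded_holo F x rho M ->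
  F x = 0 -> local_degree (real_map F) (to_real x) mu ->
  (forall delta beta : R, 0 < delta -> 0 < beta ->
    exists W (sigma : R), 0 < sigma /\ forall w, hnorm (w - W) < sigma ->
      hnorm w < beta /\ exists s : seq E, [/\ uniq s, size s = p &
        forall z, z \in s -> hnorm (z - x) < delta /\ F z = w]) ->
  p%:Z <= mu.
Proof.
move=> rho0 FM Fx [e /= e0 eP] pre.
pose delta : R := Num.min (e / 2) (rho / 8).
have delta0 : 0 < delta by rewrite lt_min !divr_gt0.
have de : delta < e by rewrite gt_min; apply/orP; left; clear - e0; lra.
have dr : delta <= rho / 8 by rewrite ge_min lexx orbT.
have din : ball_ Num.norm 0 e delta by rewrite /ball_ /= sub0r normrN gtr0_norm.
have /nbhs_normP[b /= b0 bP] := eP delta din delta0.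
have [W [sigma [sigma0 wP]]] := pre delta b delta0 b0.
have [w wW reg] := regular_value_dense W rho0 FM delta0 dr sigma0.
have [wb [s [s_uniq <- sP]]] := wP w wW.
have det_gt0 (y : V) : rnorm (y - to_real x) < delta -> real_map F y = to_real w ->
    0 < \det (jacobian (real_map F) y).
  move=> yx' yw; rewrite -[y]of_realK.
  have yx : hnorm (of_real y - x) < delta by rewrite -rnorm_to_real to_realB of_realK.
  have zw : F (of_real y) = w by rewrite -[RHS]to_realK -yw /real_map to_realK.
  have yrho : hnorm (of_real y - x) < rho by apply: lt_le_trans yx _; clear - dr rho0; lra.
  have [[A FA] _] := FM _ yrho.
  by rewrite (jacobian_real_map FA) det_real_block_gt0// (reg _ _ yx zw FA).
have [|y [yx yw]|t [t_uniq tP ->]] := bP (to_real w) _.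
- rewrite /ball_ /= /real_map to_realK Fx -to_realB sub0r.
  by apply: le_lt_trans (to_real_norm_le _) _; rewrite hnormN.
- by rewrite gt_eqF// det_gt0.
have -> : \sum_(y <- t) sgz (\det (jacobian (real_map F) y)) = (size t)%:Z.
  rewrite big_seq (eq_bigr (fun=> 1)); last first.
    by move=> y /tP[yx yw]; apply/eqP; rewrite sgz_cp0 det_gt0.
  by rewrite -big_seq big_const_seq count_predT iter_addr_0 natz.
rewrite lez_nat -(size_map (@to_real R n.+1)); apply: uniq_leq_size.
  by rewrite map_inj_uniq//; exact: can_inj (@to_realK R n.+1).
move=> _ /mapP[z /sP[zx zw] ->]; apply/tP.
by rewrite -to_realB rnorm_to_real /real_map to_realK zw.
Qed.

End LocalDegree.

(** * Finite subadditivity of the Hausdorff measure *)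

Section Hausdorff.
Variables (R : realType) (n : nat).
Local Notation E := 'Cv[R]_n.
Implicit Types (A B S : set E) (d b : R).
Local Open Scope ereal_scope.

Lemma hdiam_ge0 A : 0 <= hdiam A.
Proof. by apply: ereal_sup_ubound; left. Qed.

Lemma hdiam_le A (D : \bar R) : 0 <= D ->
  (forall x y, A x -> A y -> (hnorm (x - y))%:E <= D) -> hdiam A <= D.
Proof.
move=> D0 AD; apply: ge_ereal_sup => _ [->//|[x Ax [y Ay <-]]]; exact: AD.
Qed.

Lemma le_hdiam A x y : A x -> A y -> (hnorm (x - y))%:E <= hdiam A.
Proof. by move=> Ax Ay; apply: ereal_sup_ubound; right; exists x => //; exists y. Qed.

Definition covers A (delta : R) : set (nat -> set E) :=
  [set U | A `<=` \bigcup_i U i /\ forall i, hdiam (U i) <= delta%:E].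

Definition cover_sum d (U : nat -> set E) : \bar R := \sum_(0 <= i <oo) hdiam (U i) `^ d.

Lemma cover_sum_ge0 d U : 0 <= cover_sum d U.
Proof. by apply: nneseries_ge0 => i _ _; exact: poweR_ge0. Qed.

Lemma hausdorff_le d A (H : \bar R) :
  (forall delta : R, (0 < delta)%R ->
     ereal_inf [set cover_sum d U | U in covers A delta] <= H) -> hausdorff d A <= H.
Proof. by move=> AH; apply: ge_ereal_sup => _ [delta delta0 <-]; exact: AH. Qed.

Lemma le_hausdorff d A (delta : R) : (0 < delta)%R ->
  ereal_inf [set cover_sum d U | U in covers A delta] <= hausdorff d A.
Proof. by move=> delta0; apply: ereal_sup_ubound; exists delta. Qed.

Lemma hausdorffS d A B : A `<=` B -> hausdorff d A <= hausdorff d B.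
Proof.
move=> AB; apply: hausdorff_le => delta delta0; apply: le_trans (le_hausdorff d B delta0).
apply: ereal_inf_le_tmp => _ [U [BU Ud] <-]; exists U => //; split => //.
exact: subset_trans BU.
Qed.

(** A covers itself, followed by empty sets; every term is 0^d, which is 0 because d > 0. *)
Lemma hausdorff_hdiam0 d A : (0 < d)%R -> hdiam A <= 0 -> hausdorff d A <= 0.
Proof.
move=> d0 A0; apply: hausdorff_le => delta delta0.
pose U (i : nat) : set E := if i is 0%N then A else set0.
have U0 i : hdiam (U i) = 0.
  apply/eqP; rewrite eq_le hdiam_ge0 andbT; case: i => [//|i]; exact: hdiam_le.
apply: (@le_trans _ _ (cover_sum d U)).
  apply: ereal_inf_lbound; exists U => //; split.
    by move=> x Ax; exists 0%N.
  by move=> i; rewrite U0 lee_fin ltW.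
by rewrite /cover_sum eseries0// => i _ _; rewrite U0 poweR0r// gt_eqF.
Qed.

(** The first 2k terms of the interleaved cover are the first k terms of U and of V. Since terms are
    nonnegative, its partial sum up to k is at most the one up to 2k. *)
Lemma cover_sum_interleave d U V :
  cover_sum d (fun i => if odd i then V i./2 else U i./2) <= cover_sum d U + cover_sum d V.
Proof.
set W := fun i => _; pose f U (i : nat) := hdiam ((U : nat -> set E) i) `^ d.
have f0 U' i : 0 <= f U' i by exact: poweR_ge0.
have partial k : \sum_(0 <= i < k.*2) f W i = \sum_(0 <= i < k) f U i + \sum_(0 <= i < k) f V i.
  elim: k => [|k IH]; first by rewrite !big_geq// adde0.
  rewrite doubleS !big_nat_recr//= IH /f /W /= odd_double doubleK uphalf_double.
  by rewrite -addeA addeACA.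
have le_lim U' k : \sum_(0 <= i < k) f U' i <= cover_sum d U'.
  by apply: nneseries_lim_ge => i _ _.
apply: lime_le; first by apply: is_cvg_nneseries => i _ _; exact: f0.
apply: nearW => k; apply: (@le_trans _ _ (\sum_(0 <= i < k.*2) f W i)).
  rewrite (@big_cat_nat _ _ _ k 0 k.*2)//=; last by rewrite -addnn leq_addr.
  by rewrite leeDl//; apply: sume_ge0.
by rewrite partial leeD.
Qed.

Lemma hausdorffU d A B : hausdorff d (A `|` B) <= hausdorff d A + hausdorff d B.
Proof.
apply: hausdorff_le => delta delta0.
set a := ereal_inf [set cover_sum d U | U in covers A delta].
set b := ereal_inf [set cover_sum d U | U in covers B delta].
apply: (@le_trans _ _ (a + b)); last by rewrite leeD// le_hausdorff.
have a0 : 0 <= a by apply: le_ereal_inf_tmp => _ [U _ <-]; exact: cover_sum_ge0.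
have b0 : 0 <= b by apply: le_ereal_inf_tmp => _ [U _ <-]; exact: cover_sum_ge0.
have [->|ay] := eqVneq a +oo; first by rewrite addye ?leey// gt_eqF// (lt_le_trans _ b0).
have [->|bY] := eqVneq b +oo; first by rewrite addey ?leey// gt_eqF// (lt_le_trans _ a0).
have af : a \is a fin_num by rewrite ge0_fin_numE// ltey.
have bf : b \is a fin_num by rewrite ge0_fin_numE// ltey.
apply/lee_addgt0Pr => e e0; have e2 : (0 < e / 2)%R by rewrite divr_gt0.
have [_ [U [AU Ud] <-] Ua] := lb_ereal_inf_adherent e2 af.
have [_ [V [BV Vd] <-] Vb] := lb_ereal_inf_adherent e2 bf.
apply: (@le_trans _ _ (cover_sum d U + cover_sum d V)); last first.
  have -> : a + b + e%:E = (a + (e / 2)%:E) + (b + (e / 2)%:E).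
    by rewrite addeACA -EFinD -splitr.
  by rewrite leeD// ltW.
apply: le_trans (cover_sum_interleave d U V); apply: ereal_inf_lbound.
eexists; last by reflexivity.
split=> [x [/AU[i _ Ui]|/BV[i _ Vi]]|i]; last by case: ifP.
- by exists i.*2 => //; rewrite odd_double doubleK.
- by exists i.*2.+1 => //=; rewrite odd_double uphalf_double.
Qed.

Lemma hausdorff_cover (T : eqType) d (s : seq T) (S : T -> set E) A b : (0 < d)%R ->
  (forall j, j \in s -> hausdorff d (A `&` S j) <= b%:E) ->
  (forall x, A x -> exists2 j, j \in s & S j x) ->
  hausdorff d A <= ((size s)%:R * b)%:E.
Proof.
move=> d0 Sb AS.
have -> : A = A `&` [set x | exists2 j, j \in s & S j x].
  by apply/seteqP; split=> [x Ax|x []//]; split=> //; exact: AS.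
elim: s Sb {AS} => [|j s IH] Sb.
  apply: (@le_trans _ _ 0); last by rewrite mul0r.
  by apply: hausdorff_hdiam0 => //; apply: hdiam_le => // x y [_ []].
apply: (@le_trans _ _ (hausdorff d ((A `&` S j) `|` (A `&` [set x | exists2 j, j \in s & S j x])))).
  apply: hausdorffS => x [Ax /= [i + Sx]]; rewrite inE => /orP[/eqP ij|si].
    by left; rewrite -ij.
  by right; split => //; exists i.
apply: le_trans (hausdorffU _ _ _) _.
rewrite /= -natr1 mulrDl mul1r addrC EFinD leeD//.
  by apply: IH => i si; apply: Sb; rewrite inE si orbT.
by apply: Sb; rewrite mem_head.
Qed.

End Hausdorff.

(** * From differentiability and ellipticity to two-sided growth at a zero *)

Section EllipticGrowth.
Variables (R : realType) (n : nat).
Local Notation E := 'Cv[R]_n.+1.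
Implicit Types (F : E -> E) (x y z w h v : E) (A : 'M[R[i]^o]_n.+1).
Implicit Types (M rho e t : R).

(** The norm takes values in R[i] and is read off through balls, which are defined entrywise; hence
    the strict inequality. *)
Lemma norm_lt_coord v t : (`|v| < ((t%:C)%C : R[i])) <-> (0 < t /\ forall i, normc (v 0 i) < t).
Proof.
have normE (a : R[i]^o) : `|a| = (normc (a : R[i]))%:C%C by exact: normrE_normc.
split=> [vt|[t0 vt]].
  have t0 : 0 < t by rewrite -ltcR; apply: le_lt_trans vt.
  split=> // i; have : ball (0 : E) ((t%:C)%C : R[i]) v by rewrite -ball_normE /ball_ /= sub0r normrN.
  by move=> [_ /(_ 0 i)]; rewrite -ball_normE /ball_ /= mxE sub0r normrN normE ltcR.
have : ball (0 : E) ((t%:C)%C : R[i]) v.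
  split; first by rewrite -[0]/((0%:C)%C : R[i]) ltcR.
  by move=> i j; rewrite -ball_normE /ball_ /= mxE sub0r normrN normE ltcR ord1.
by rewrite -ball_normE /ball_ /= sub0r normrN.
Qed.

Lemma differentiable_has_cdiff F z : differentiable F z -> exists A, has_cdiff F z A.
Proof.
move=> /differentiable_near Fd; exists (lin1_mx ('d F z)) => e e0.
have N0 : 0 < n.+1%:R :> R by rewrite ltr0n.
have e1 : 0 < e / n.+1%:R by rewrite divr_gt0.
have e1C : 0 < (((e / n.+1%:R)%:C)%C : R[i]) by rewrite -[0]/((0%:C)%C : R[i]) ltcR.
have /nbhs_norm0P[d /= d0 dP] := Fd _ e1C.
have dE : d = ((complex.Re d)%:C)%C.
  move: d0; clear; case: d => a b; rewrite ltcE /= => /andP[/eqP h _].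
  by apply/eqP; rewrite eq_complex /= eqxx /=; apply/eqP; first [exact: h | exact: esym h].
have d0' : 0 < complex.Re d by rewrite -ltcR -dE.
exists (complex.Re d) => // h hd.
have hdN : `|h| < d.
  by rewrite dE; apply/norm_lt_coord; split => // i; exact: le_lt_trans (normc_coord _ _) hd.
have := dP h hdN; rewrite [h + z]addrC mul_rV_lin1; set v := F _ - _ - _ => vh.
have vi i : normc (v 0 i) <= e / n.+1%:R * hnorm h.
  (* Only strict bounds pass through [norm_lt_coord], so |h| is replaced by the slightly larger
     t. *)
  apply/ler_addgt0Pr => eta eta0.
  pose t := hnorm h + eta / (e / n.+1%:R).
  have ht : hnorm h < t by rewrite ltrDl divr_gt0.
  have htN : `|h| < ((t%:C)%C : R[i]).
    apply/norm_lt_coord; split; first exact: le_lt_trans (hnorm_ge0 _) ht.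
    by move=> j; exact: le_lt_trans (normc_coord _ _) ht.
  have vt : `|v| < (((e / n.+1%:R * t)%:C)%C : R[i]).
    by apply: le_lt_trans vh _; rewrite [ltRHS](rmorphM (real_complex R)) /= ltr_pM2l.
  have [_ /(_ i)] := (norm_lt_coord _ _).1 vt.
  by rewrite /t mulrDr [_ * (eta / _)]mulrC mulfVK ?gt_eqF// => /ltW.
apply: le_trans (hnorm_le_sum _) _; apply: le_trans (ler_sum _ (fun i _ => vi i)) _.
by rewrite sumr_const card_ord -[leLHS]mulr_natl mulrA [_ * (e / _)]mulrC mulfVK ?gt_eqF.
Qed.

(** The lower bound is the expansion with error (inf g) / 2. For the upper bound, g must be bounded
    on the sphere: this comes from |F| <= M at one fixed radius. *)
Lemma elliptic_growth F x rho M : 0 < rho -> bounded_holo F x rho M ->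
  elliptic_zero (sqr_hnorm_map F) (to_real x) ->
  exists (m : nat) (c0 C0 t0 : R), [/\ (0 < m)%N, 0 < c0, 0 < t0 & forall h,
    0 < hnorm h -> hnorm h < t0 ->
    c0 * hnorm h ^+ m <= hnorm (F (x + h)) ^+ 2 <= C0 * hnorm h ^+ m].
Proof.
move=> rho0 FM [h0 [m [g [ginf gnear]]]].
have Fx : F x = 0.
  by apply/eqP; move: h0; rewrite /sqr_hnorm_map to_realK => /eqP; rewrite sqrf_eq0 hnorm_eq0.
have [g0 g00 g0P] : exists2 g0 : R, 0 < g0 & forall theta, rnorm theta = 1 -> g0 <= g theta.
  have lb theta : rnorm theta = 1 ->
     (ereal_inf [set (g theta)%:E | theta in [set v | rnorm v = 1%R]] <= (g theta)%:E)%E.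
    by move=> t1; apply: ereal_inf_lbound; exists theta.
  (* An infimum equal to +oo leaves no unit vector at all, and any positive g0, here 1, will do. *)
  move: ginf lb; case: ereal_inf => [q| |] // q0 lb.
    by exists q => // theta /lb; rewrite lee_fin.
  by exists 1 => // theta /lb.
have polar h : 0 < hnorm h -> exists theta, rnorm theta = 1 /\
    sqr_hnorm_map F (to_real x + hnorm h *: theta) = hnorm (F (x + h)) ^+ 2.
  move=> hp; exists (to_real (((hnorm h)^-1%:C)%C *: h)); split.
    by rewrite rnorm_to_real hnormZ normc_real gtr0_norm ?invr_gt0// mulVf// gt_eqF.
  rewrite to_realZ scalerA mulfV ?gt_eqF// scale1r -to_realD /sqr_hnorm_map.
  by rewrite to_realK.
have near eps : 0 < eps -> exists2 t1, 0 < t1 & forall t theta, 0 < t -> t < t1 ->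
    rnorm theta = 1 -> `|sqr_hnorm_map F (to_real x + t *: theta) - t ^+ m * g theta| <= eps * t ^+ m.
  move=> e0; have [t1 /= t10 P] := gnear eps e0; exists t1 => // t theta tp tt th1.
  by apply: P => //; rewrite /ball_ /= sub0r normrN gtr0_norm.
have g20 : 0 < g0 / 2 by rewrite divr_gt0.
have [t1 t10 t1P] := near _ g20; have [t2 t20 t2P] := near _ ltr01.
have [t3 [t3p t32 t3r _]] := exists_small3 (divr_gt0 t20 (ltr0Sn R 1)) (divr_gt0 rho0 (ltr0Sn R 1)) ltr01.
have t3m : 0 < t3 ^+ m by rewrite exprn_gt0.
have gub theta : rnorm theta = 1 -> g theta <= (M ^+ 2 + t3 ^+ m) / t3 ^+ m.
  move=> th1; rewrite ler_pdivlMr//.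
  have t3t2 : t3 < t2 by move: t32; clear - t20; lra.
  have := t2P t3 theta t3p t3t2 th1; rewrite mul1r => /(le_trans (ler_norm _)) => h1.
  have : sqr_hnorm_map F (to_real x + t3 *: theta) <= M ^+ 2.
    rewrite /sqr_hnorm_map ler_sqr ?nnegrE ?hnorm_ge0//.
      apply: (FM _ _).2; rewrite of_realD to_realK of_realZ addrC addrA addNr add0r.
      rewrite hnormZ hnorm_of_real th1 mulr1 normc_real gtr0_norm//.
      by move: t3r; clear - rho0; lra.
    by apply: le_trans (hnorm_ge0 (F x)) (FM x _).2; rewrite subrr hnorm0.
  have := t2P t3 theta t3p t3t2 th1; rewrite mul1r ler_norml => /andP[h2 _].
  by move: h2; rewrite [g theta * _]mulrC; clear; lra.
exists m, (g0 / 2), ((M ^+ 2 + t3 ^+ m) / t3 ^+ m + 1), (Num.min t1 t2).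
have bounds h : 0 < hnorm h -> hnorm h < Num.min t1 t2 ->
    g0 / 2 * hnorm h ^+ m <= hnorm (F (x + h)) ^+ 2 <=
    ((M ^+ 2 + t3 ^+ m) / t3 ^+ m + 1) * hnorm h ^+ m.
  move=> hp; rewrite lt_min => /andP[ht1 ht2].
  have [theta [th1 thE]] := polar h hp; have hm : 0 < hnorm h ^+ m by rewrite exprn_gt0.
  have := t1P _ _ hp ht1 th1; have := t2P _ _ hp ht2 th1; rewrite thE mul1r !ler_norml.
  have gl := g0P _ th1; have gu := gub _ th1.
  have glm := ler_wpM2l (ltW hm) gl; have gum := ler_wpM2l (ltW hm) gu.
  move: glm gum; rewrite [_ * ((M ^+ 2 + _) / _)]mulrC.
  move=> glm gum /andP[_ b2] /andP[b3 _]; rewrite mulrDl mul1r.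
  by apply/andP; split; move: glm gum b2 b3; clear; lra.
split => //; last by rewrite lt_min t10.
(* For m = 0 the lower bound would keep |F|^2 above g0 / 2 near x, against continuity and F x =
   0. *)
rewrite lt0n; apply/eqP => m0; rewrite m0 in bounds.
have T0 : 0 < Num.min t1 t2 by rewrite lt_min t10.
pose e := Num.min 1 (g0 / 2); have e0 : 0 < e by rewrite lt_min ltr01.
have xr : hnorm (x - x) < rho by rewrite subrr hnorm0.
have [[A FA] _] := FM x xr; have [d d0 dP] := has_cdiff_continuous FA e0.
have [v v1] := @exists_unit_vector R n.+1 isT.
have [q [q0 qd qT _]] := exists_small3 (divr_gt0 d0 (ltr0Sn R 1)) (divr_gt0 T0 (ltr0Sn R 1)) ltr01.
have nq : hnorm (((q%:C)%C : R[i]) *: v) = q by rewrite hnormZ v1 mulr1 normc_real gtr0_norm.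
have qd' : q < d by move: qd; clear - d0; lra.
have qT' : q < Num.min t1 t2 by move: qT; clear - T0; lra.
have := bounds (((q%:C)%C : R[i]) *: v); rewrite nq expr0 mulr1 => /(_ q0 qT')/andP[h1 _].
have := dP (x + ((q%:C)%C : R[i]) *: v); rewrite addrC addrA addNr add0r nq => /(_ qd').
rewrite Fx subr0 lt_min => /andP[h2 h3]; move: h1; apply/negP; rewrite -ltNge.
by apply: le_lt_trans h3; rewrite expr2 ler_piMr ?hnorm_ge0// ltW.
Qed.

Lemma elliptic_zero_order F x rho M mu : 0 < rho -> bounded_holo F x rho M ->
  elliptic_zero (sqr_hnorm_map F) (to_real x) -> local_degree (real_map F) (to_real x) mu ->
  exists (p : nat) (c C t0 : R), [/\ (0 < p)%N, p%:Z <= mu, 0 < c, 0 < t0 & forall z,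
    hnorm (z - x) < t0 ->
    c * hnorm (z - x) ^+ p <= hnorm (F z) <= C * hnorm (z - x) ^+ p].
Proof.
move=> rho0 FM ell deg; have [m [c0 [C0 [t0 [m0 c00 t00 growth]]]]] := elliptic_growth rho0 FM ell.
have Fx : F x = 0.
  by apply/eqP; move: ell.1; rewrite /sqr_hnorm_map to_realK => /eqP; rewrite sqrf_eq0 hnorm_eq0.
have [p mp pre] := many_preimages (ltn0Sn n) rho0 FM Fx m0 c00 t00 growth.
have p0 : (0 < p)%N by rewrite mp double_gt0 in m0.
exists p, (Num.sqrt c0), (Num.sqrt C0), t0; split => //.
- exact: local_degree_ge rho0 FM Fx deg pre.
- by rewrite sqrtr_gt0.
move=> z zt; have [->|zx] := eqVneq z x.
  by rewrite subrr Fx hnorm0 expr0n gtn_eqF// !mulr0 lexx.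
have zp : 0 < hnorm (z - x) by rewrite hnorm_gt0 subr_eq0.
have := growth (z - x) zp zt; rewrite subrKC mp -muln2 exprM => /andP[h1 h2].
have zm : 0 < (hnorm (z - x) ^+ p) ^+ 2 by rewrite !exprn_gt0.
have C00 : 0 <= C0.
  rewrite -(ler_pM2r zm) mul0r; apply: le_trans h2; exact: sqr_ge0.
have q0 : 0 <= hnorm (z - x) ^+ p by rewrite exprn_ge0 ?hnorm_ge0.
apply/andP; split.
  rewrite -ler_sqr ?nnegrE ?hnorm_ge0 ?mulr_ge0 ?sqrtr_ge0//.
  by rewrite exprMn sqr_sqrtr ?(ltW c00).
rewrite -ler_sqr ?nnegrE ?hnorm_ge0 ?mulr_ge0 ?sqrtr_ge0//.
by rewrite exprMn [Num.sqrt C0 ^+ 2]sqr_sqrtr.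
Qed.

End EllipticGrowth.

(** * Comparison of |F| with the product of distances to the zeros *)

Section ZeroProduct.
Variables (R : realType) (n : nat).
Local Notation E := 'Cv[R]_n.+1.
Implicit Types (F : E -> E) (x y z : E) (A : 'M[R[i]^o]_n.+1) (s : seq E) (p : E -> nat).

Definition zero_prod s p z : R := \prod_(b <- s) hnorm (z - b) ^+ p b.

Lemma seq_uniform (T : eqType) (l : seq T) (P : T -> R -> Prop) :
  (forall a t t', P a t -> 0 < t' -> t' <= t -> P a t') ->
  (forall a, a \in l -> exists2 t, 0 < t & P a t) ->
  exists2 t, 0 < t & forall a, a \in l -> P a t.
Proof.
move=> Pdown; elim: l => [|a l IH] Pl; first by exists 1.
have [t0 t00 Pt0] : exists2 t, 0 < t & P a t by apply: Pl; rewrite mem_head.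
have [t1 t10 Pt1] : exists2 t, 0 < t & forall a, a \in l -> P a t.
  by apply: IH => b bl; apply: Pl; rewrite inE bl orbT.
have m0 : 0 < Num.min t0 t1 by rewrite lt_min t00.
exists (Num.min t0 t1) => // b; rewrite inE => /orP[/eqP ->|/Pt1 Pb].
  by apply: Pdown Pt0 m0 _; rewrite ge_min lexx.
by apply: Pdown Pb m0 _; rewrite ge_min lexx orbT.
Qed.

(** Within eta of a zero b, both sides are comparable to |z - b|^(p b), the other factors lying
    between [Lo] and 1. Farther away, both are bounded above by 1 and below by positive
    constants. *)
Lemma zero_prod_bounds F s p : uniq s -> (forall b, b \in s -> hnorm b < 1 / 2) ->
  (forall z, hnorm z <= 1 / 2 -> exists A, has_cdiff F z A) ->
  (forall z, hnorm z <= 1 / 2 -> hnorm (F z) <= 1) ->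
  (forall z, hnorm z <= 1 / 2 -> F z = 0 -> z \in s) ->
  (forall b, b \in s -> exists c C t0 : R, [/\ 0 < c, 0 < t0 & forall z, hnorm (z - b) < t0 ->
     c * hnorm (z - b) ^+ p b <= hnorm (F z) <= C * hnorm (z - b) ^+ p b]) ->
  exists2 K : R, 1 <= K & forall z, hnorm z <= 1 / 2 ->
    hnorm (F z) <= K * zero_prod s p z /\ zero_prod s p z <= K * hnorm (F z).
Proof.
move=> s_uniq s12 Fd F1 F0 Fs.
pose P b (t : R) := [/\ t <= 1, (forall c, c \in s -> c != b -> 2 * t <= hnorm (c - b)) &
  forall z, hnorm (z - b) < t -> t * hnorm (z - b) ^+ p b <= hnorm (F z) /\
    t * hnorm (F z) <= hnorm (z - b) ^+ p b].
have Pdown b t t' : P b t -> 0 < t' -> t' <= t -> P b t'.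
  move=> [t1 sep loc] t'0 t't; split; first exact: le_trans t1.
    by move=> c cs cb; apply: le_trans (sep c cs cb); rewrite ler_pM2l.
  move=> z zt; have [h1 h2] := loc z (lt_le_trans zt t't); split.
    by apply: le_trans h1; rewrite ler_wpM2r ?exprn_ge0 ?hnorm_ge0.
  by apply: le_trans h2; rewrite ler_wpM2r ?hnorm_ge0.
have [eta eta0 etaP] : exists2 eta, 0 < eta & forall b, b \in s -> P b eta.
  apply: seq_uniform Pdown _ => b bs; have [c [C [t0 [c0 t00 loc]]]] := Fs b bs.
  have [t1 t10 sep] : exists2 t1, 0 < t1 & forall a, a \in s -> a != b -> 2 * t1 <= hnorm (a - b).
    apply: (@seq_uniform _ s (fun a t => a != b -> 2 * t <= hnorm (a - b))).
      by move=> a t t' h _ t't ab; apply: le_trans (h ab); rewrite ler_pM2l.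
    move=> a _; have [->|ab] := eqVneq a b; first by exists 1.
    have ab0 : 0 < hnorm (a - b) by rewrite hnorm_gt0 subr_eq0.
    by exists (hnorm (a - b) / 2) => [|_]; [rewrite divr_gt0|rewrite mulrC mulfVK].
  have C1 : 0 < `|C| + 1 by rewrite ltr_wpDl.
  have iC1 : 0 < 1 / (`|C| + 1) by rewrite divr_gt0.
  have [u [u0 uc ut0 ut1]] := exists_small3 c0 t00 t10.
  have [t [tp tu tle1 tC]] := exists_small3 u0 ltr01 iC1.
  exists t => //; split => //.
    by move=> a as_ ab; apply: le_trans (sep a as_ ab); rewrite ler_pM2l// (le_trans tu).
  move=> z zt; have /loc/andP[h1 h2] : hnorm (z - b) < t0 by apply: lt_le_trans zt (le_trans tu ut0).
  have q0 : 0 <= hnorm (z - b) ^+ p b by rewrite exprn_ge0 ?hnorm_ge0.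
  split; first by apply: le_trans h1; rewrite ler_wpM2r// (le_trans tu).
  rewrite ler_pdivlMr// in tC; apply: le_trans (ler_wpM2l (ltW tp) h2) _.
  rewrite mulrA ler_piMl//; apply: le_trans tC; rewrite ler_pM2l//.
  by apply: le_trans (ler_norm _) _; rewrite lerDl.
pose Lo : R := \prod_(b <- s) eta ^+ p b.
have Lo0 : 0 < Lo by apply: prodr_gt0 => b _; exact: exprn_gt0.
have fac z b : hnorm z <= 1 / 2 -> b \in s -> 0 <= hnorm (z - b) ^+ p b <= 1.
  move=> z12 /s12 b12; rewrite exprn_ge0 ?hnorm_ge0//= exprn_ile1 ?hnorm_ge0//.
  by apply: le_trans (ler_hnormB _ _) _; move: z12 b12; clear; lra.
(* The bumps make psi positive on the whole closed ball and vanish off the eta-balls. The minimum of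
   psi therefore bounds |F| from below there, using compactness of the ball only. *)
pose psi z := hnorm (F z) + \sum_(b <- s) Num.max 0 (eta - hnorm (z - b)).
have sum0 z : 0 <= \sum_(b <- s) Num.max 0 (eta - hnorm (z - b)).
  by apply: sumr_ge0 => b _; rewrite le_max lexx.
have [m0 m00 m0P] : exists2 m0 : R, 0 < m0 & forall z, hnorm z <= 1 / 2 -> m0 <= psi z.
  have half0 : 0 <= 1 / 2 :> R by rewrite divr_ge0.
  have [|zm zm12 zmP] := @hclosed_ball_max R n.+1 (fun z => - psi z) 0 (1 / 2) half0.
    move=> z; rewrite subr0 => z12 e e0; have [A FA] := Fd z z12.
    have e2 : 0 < e / 2 by rewrite divr_gt0.
    have [d1 d10 d1P] := has_cdiff_continuous FA e2.
    have q0 : 0 < (size s).+1%:R :> R by rewrite ltr0n.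
    have e3 : 0 < e / 2 / (size s).+1%:R by rewrite divr_gt0.
    have [d [d0 dd1 dd2 _]] := exists_small3 d10 e3 ltr01.
    exists d => // y yd _; have h1 := d1P y (lt_le_trans yd dd1).
    have h2 : `|\sum_(b <- s) Num.max 0 (eta - hnorm (y - b)) -
                \sum_(b <- s) Num.max 0 (eta - hnorm (z - b))| <= (size s)%:R * hnorm (y - z).
      rewrite -sumrB; apply: le_trans (ler_norm_sum _ _ _) _.
      have -> : (size s)%:R * hnorm (y - z) = \sum_(b <- s) hnorm (y - z).
        by rewrite big_const_seq count_predT iter_addr_0 mulr_natl.
      apply: ler_sum => b _; have := ler_hnorm_norm (y - b) (z - b).
      rewrite opprB addrA subrK !ler_norml => /andP[h3 h4].
      have h5 := hnorm_ge0 (y - z).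
      by case: (leP 0 (eta - hnorm (y - b))); case: (leP 0 (eta - hnorm (z - b)));
        move: h3 h4 h5; clear => h3 h4 h5 h6 h7; apply/andP; split; lra.
    have h3 : (size s)%:R * hnorm (y - z) < e / 2.
      apply: (@le_lt_trans _ _ ((size s).+1%:R * hnorm (y - z))).
        by rewrite ler_wpM2r ?hnorm_ge0// ler_nat.
      by rewrite mulrC -ltr_pdivlMr// (lt_le_trans yd).
    have h4 := ler_hnorm_norm (F y) (F z).
    rewrite /psi; set S1 := (\sum_(b <- s) Num.max 0 (eta - hnorm (y - b))) in h2 *.
    set S2 := (\sum_(b <- s) Num.max 0 (eta - hnorm (z - b))) in h2 *.
    move: h1 h2 h3 h4; rewrite !ler_norml ltr_norml.
    move: (hnorm (F y)) (hnorm (F z)) (hnorm (F y - F z)) ((size s)%:R * hnorm (y - z)) S1 S2.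
    clear => q1 q2 q3 q4 S1 S2 h1 /andP[h2 h3] h4 /andP[h5 h6].
    by apply/andP; split; lra.
  rewrite subr0 in zm12; exists (psi zm); last first.
    by move=> z z12; rewrite -lerN2; apply: zmP; rewrite subr0.
  rewrite /psi; have [F0z|Fz] := eqVneq (F zm) 0; last by rewrite ltr_pwDl// hnorm_gt0.
  rewrite F0z hnorm0 add0r (big_rem zm) ?F0//= subrr hnorm0 subr0 ltr_pwDl//.
    by rewrite lt_max eta0 orbT.
  by apply: sumr_ge0 => b _; rewrite le_max lexx.
have eL0 : 0 < eta * Lo by rewrite mulr_gt0.
have ieL : 0 < 1 / (eta * Lo) by rewrite divr_gt0.
have im0 : 0 < 1 / m0 by rewrite divr_gt0.
pose K := 1 + 1 / (eta * Lo) + 1 / m0.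
have mulK (e u v : R) : 0 < e -> 1 / e <= K -> 0 <= v -> e * u <= v -> u <= K * v.
  move=> e0 eK v0 uv; apply: le_trans (ler_wpM2r v0 eK).
  by rewrite mulrAC mul1r ler_pdivlMr// mulrC.
have K1 : 1 / (eta * Lo) <= K by rewrite /K; move: im0 ieL; clear; lra.
have K2 : 1 / m0 <= K by rewrite /K; move: im0 ieL; clear; lra.
exists K; first by rewrite /K; move: im0 ieL; clear; lra.
move=> z z12; have /andP[prod0 prod1] : 0 <= zero_prod s p z <= 1.
  rewrite /zero_prod big_seq; elim/big_ind: _ => [|a b /andP[a0 a1] /andP[b0 b1]|b bs].
  - by rewrite ler01 lexx.
  - by rewrite mulr_ge0// mulr_ile1.
  - exact: fac.
have [[b bs zb]|far] := pselect (exists2 b, b \in s & hnorm (z - b) < eta).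
  have [eta1 sep loc] := etaP b bs; have [h1 h2] := loc z zb.
  have q0 : 0 <= hnorm (z - b) ^+ p b by rewrite exprn_ge0 ?hnorm_ge0.
  have prodE : zero_prod s p z = hnorm (z - b) ^+ p b * \prod_(a <- s | a != b) hnorm (z - a) ^+ p a.
    by rewrite /zero_prod (bigD1_seq b).
  have rest1 : 0 <= \prod_(a <- s | a != b) hnorm (z - a) ^+ p a <= 1.
    rewrite big_seq_cond; elim/big_ind: _ => [|a c /andP[a0 a1] /andP[b0 b1]|a /andP[as_ _]].
    - by rewrite ler01 lexx.
    - by rewrite mulr_ge0// mulr_ile1.
    - exact: fac.
  have restL : Lo <= \prod_(a <- s | a != b) hnorm (z - a) ^+ p a.
    apply: (@le_trans _ _ (\prod_(a <- s | a != b) eta ^+ p a)).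
      rewrite /Lo (bigD1_seq b)//= ler_piMl ?exprn_ile1 ?(ltW eta0)//.
      by apply: prodr_ge0 => a _; rewrite exprn_ge0 ?(ltW eta0).
    rewrite big_seq_cond [leRHS]big_seq_cond; apply: ler_prod => a /andP[as_ ab].
    rewrite exprn_ge0 ?(ltW eta0)//= lerXn2r ?nnegrE ?hnorm_ge0 ?(ltW eta0)//.
    have := sep a as_ ab; have := ler_hnorm_dist a z b; rewrite (hnormBC a z).
    by move: zb; clear; lra.
  have lower : Lo * hnorm (z - b) ^+ p b <= zero_prod s p z by rewrite prodE mulrC ler_wpM2l.
  have upper : zero_prod s p z <= hnorm (z - b) ^+ p b by rewrite prodE ler_piMr// (andP rest1).2.
  split; apply: (mulK (eta * Lo)) => //; rewrite ?hnorm_ge0//.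
    by rewrite mulrAC mulrC; apply: le_trans lower; rewrite ler_pM2l.
  have Lo1 : Lo <= 1 by apply: le_trans restL (andP rest1).2.
  apply: le_trans h1; rewrite -mulrA ler_pM2l//; apply: le_trans upper.
  by rewrite ler_piMl.
have {}far b : b \in s -> eta <= hnorm (z - b).
  by move=> bs; rewrite leNgt; apply/negP => zb; apply: far; exists b.
have prodL : Lo <= zero_prod s p z.
  rewrite /Lo /zero_prod big_seq [leRHS]big_seq; apply: ler_prod => b bs.
  by rewrite exprn_ge0 ?(ltW eta0)//= lerXn2r ?nnegrE ?hnorm_ge0 ?(ltW eta0)// far.
split.
  (* The bound eta <= 1 is obtained from a zero; without zeros the product is 1 and K >= 1
     suffices. *)
  have [s0|[b bs]] : s = [::] \/ exists b, b \in s.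
  - by case: (s) => [|b l]; [left|right; exists b; rewrite mem_head].
  - rewrite /zero_prod s0 big_nil mulr1; apply: le_trans (F1 z z12) _.
    by rewrite /K; move: im0 ieL; clear; lra.
  apply: (mulK (eta * Lo)) => //; apply: le_trans prodL.
  have [eta1 _ _] := etaP b bs.
  rewrite mulrAC ler_piMl ?(ltW Lo0)// mulr_ile1 ?hnorm_ge0 ?(ltW eta0)//.
  exact: F1.
apply: (mulK m0) => //; rewrite ?hnorm_ge0//.
apply: (@le_trans _ _ m0); first by rewrite ler_piMr// ltW.
have := m0P z z12; rewrite /psi big_seq big1 ?addr0// => b bs.
by apply/max_idPl; rewrite subr_le0 far.
Qed.

End ZeroProduct.

(** * A point of omega far from all zeros *)

Section FarPoint.
Variables (R : realType) (n : nat).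
Local Notation E := 'Cv[R]_n.+1.
Implicit Types (omega : set E) (s : seq E).

(** With 16 (n + 1) intervals per real coordinate, the cells of a ball of radius 2 D have diameter
    at most D / 2, so each piece of omega lies in the ball of radius D around any of its points. *)
Definition cell_number : nat := ((16 * n.+1) * (16 * n.+1)) ^ n.+1.

(* Covering omega by cell_number balls of radius diam omega gives
   eps <= cell_number * a * (diam omega)^d, so that delta <= diam omega; the
   balls B(b, delta / 2), b in s, then carry too little measure to cover omega. *)
Lemma class_A_far_point (d a eps t : R) omega s :
  let Q : R := (cell_number + size s).+1%:R in
  let delta := (eps / (Q * a)) `^ (1 / d) in
  0 < d -> 0 < a -> 0 < eps -> 0 < t -> class_A d a omega ->
  (eps%:E <= hausdorff d omega)%E ->
  (forall y z, omega y -> omega z -> hnorm (y - z) <= t) ->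
  delta <= t /\ exists2 y, omega y & forall b, b \in s -> delta / 2 <= hnorm (y - b).
Proof.
move=> Q delta d0 a0 eps0 t0 [_ omA] Heps diam.
have Q0 : 0 < Q by rewrite ltr0n.
have hd : (hdiam omega <= t%:E)%E.
  by apply: hdiam_le => [|y z yo zo]; rewrite lee_fin ?(ltW t0)//; exact: diam.
have hfin : hdiam omega \is a fin_num.
  by rewrite ge0_fin_numE ?hdiam_ge0// (le_lt_trans hd)// ltry.
have [D DE] : exists D : R, hdiam omega = D%:E by exists (fine (hdiam omega)); rewrite fineK.
have Dt : D <= t by rewrite -lee_fin -DE.
have posH (S : set E) : (hdiam S <= 0)%E -> (hausdorff d S <= 0)%E by exact: hausdorff_hdiam0.
have notH0 : ~ (hausdorff d omega <= 0)%E.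
  by move=> /(le_trans Heps); rewrite lee_fin leNgt eps0.
have D0 : 0 < D.
  by rewrite ltNge; apply/negP => D0; apply/notH0/posH; rewrite DE lee_fin.
have [y0 y0o] : exists y, omega y.
  apply: contrapT => no; apply/notH0/posH; apply: hdiam_le => // y z yo.
  by exfalso; apply: no; exists y.
have empty (S : set E) : ~ (exists y, S y) -> (hausdorff d S <= 0)%E.
  by move=> no; apply/posH/hdiam_le => // y z yo; exfalso; apply: no; exists y.
have le_om y z : omega y -> omega z -> hnorm (y - z) <= D.
  by move=> yo zo; rewrite -lee_fin -DE; exact: le_hdiam.
have D20 : 0 < 2 * D by rewrite mulr_gt0.
have k1 : ((16 * n.+1).-1.+1 = 16 * n.+1)%N by rewrite prednK.
have [cell cellP] := ball_cells y0 (16 * n.+1).-1 D20.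
have in_ball y : omega y -> hnorm (y - y0) < 2 * D.
  by move=> yo; apply: le_lt_trans (le_om _ _ yo y0o) _; move: D0; clear; lra.
have epsD : eps <= Q * a * D `^ d.
  have : (hausdorff d omega <= ((size (enum {ffun 'I_n.+1 -> 'I_(16 * n.+1).-1.+1 *
      'I_(16 * n.+1).-1.+1}))%:R * (a * D `^ d))%:E)%E.
    apply: (@hausdorff_cover R n.+1 _ d _ (fun c => [set z | omega z /\ cell z = c])) => //.
      move=> c _; have [[y [yo yc]]|no] := pselect (exists y, omega y /\ cell y = c).
        apply: le_trans (omA y D yo D0 _); last by rewrite DE.
        apply: hausdorffS => z [zo [_ zc]]; split => //.
        rewrite /hball /=; apply: le_lt_trans (cellP z y (in_ball _ zo) (in_ball _ yo) _) _.
          by rewrite zc yc.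
        rewrite k1 natrM ltr_pdivrMr ?mulr_gt0 ?ltr0n//.
        have : 0 < n.+1%:R * D by rewrite mulr_gt0 ?ltr0n.
        by clear; lra.
      apply: (@le_trans _ _ 0%E); last by rewrite lee_fin mulr_ge0 ?powR_ge0// ltW.
      by apply: empty => -[y [yo [_ yc]]]; apply: no; exists y.
    by move=> z zo; exists (cell z); rewrite ?mem_enum.
  rewrite -cardE card_ffun card_prod !card_ord k1 => /(le_trans Heps); rewrite lee_fin => /le_trans.
  apply; rewrite mulrA ler_wpM2r ?powR_ge0// ler_wpM2r ?(ltW a0)// /Q /cell_number ler_nat.
  by rewrite -addnS leq_addr.
have Qa0 : 0 < Q * a by rewrite mulr_gt0.
have v0 : 0 < eps / (Q * a) by rewrite divr_gt0.
have delta0 : 0 < delta by rewrite powR_gt0.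
have deltad : delta `^ d = eps / (Q * a).
  by rewrite -powRrM mulrAC mul1r mulfV ?gt_eqF// powRr1// ltW.
(* This puts delta in the range of radii controlled by the class A; it uses that Q exceeds
   [cell_number]. *)
have deltaD : delta <= D.
  have -> : D = (D `^ d) `^ (1 / d).
    by rewrite -powRrM mulrA mulr1 mulfV ?gt_eqF// powRr1// ltW.
  apply: ge0_ler_powR; rewrite ?nnegrE ?powR_ge0 ?(ltW v0)//; first by rewrite divr_ge0// ltW.
  by rewrite ler_pdivrMr// mulrC.
split; first exact: le_trans Dt.
apply: contrapT => no.
have cover y : omega y -> exists2 b, b \in s & hball b (delta / 2) y.
  move=> yo; apply: contrapT => nob; apply: no; exists y => // b bs.
  by rewrite leNgt; apply/negP => yb; apply: nob; exists b.
have : (hausdorff d omega <= ((size s)%:R * (a * delta `^ d))%:E)%E.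
  apply: hausdorff_cover cover => // b _.
  have [[y [yo yb]]|nob] := pselect (exists y, omega y /\ hball b (delta / 2) y).
    apply: le_trans (omA y delta yo delta0 _); last by rewrite DE lee_fin.
    apply: hausdorffS => z [zo zb]; split => //; move: zb yb; rewrite /hball /= => zb yb.
    apply: le_lt_trans (ler_hnorm_dist z b y) _; rewrite (hnormBC b y).
    by move: zb yb; clear; lra.
  apply: (@le_trans _ _ 0%E); last by rewrite lee_fin mulr_ge0 ?powR_ge0// ltW.
  by apply: empty => -[y [yo yb]]; apply: nob; exists y.
move=> /(le_trans Heps); rewrite lee_fin deltad; apply/negP; rewrite -ltNge.
(* A cover by the zeros would leave measure at most (size s) eps / Q, less than eps because Q
   exceeds the number of zeros. *)
have -> : (size s)%:R * (a * (eps / (Q * a))) = (size s)%:R * eps / Q.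
  by field; rewrite !gt_eqF.
rewrite ltr_pdivrMr// mulrC ltr_pM2l// /Q ltr_nat.
by rewrite ltnS leq_addl.
Qed.

End FarPoint.

(** * Orders of the zeros and scaling of the product *)

Section ZeroOrders.
Variables (R : realType) (n : nat).
Local Notation E := 'Cv[R]_n.+1.
Implicit Types (F : E -> E).

Lemma lognorm_neq0 F z (M : R) : ((- M)%:E <= lognorm F z)%E -> F z != 0.
Proof. by apply: contraTN => /eqP Fz; rewrite /lognorm Fz hnorm0 /= lexx. Qed.

Lemma lognorm_le0 F z : (lognorm F z <= 0)%E -> hnorm (F z) <= 1.
Proof. by rewrite /lognorm lne_le0 lee_fin. Qed.

Lemma zero_prod_comparison (r : R) F k : 1 / 2 < r -> holomorphic_on (hball 0 r) F ->
  (exists M : R, [/\ 0 < M,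
      (ereal_sup [set lognorm F z | z in hball 0 r] <= 0)%E &
      ((- M)%:E <= ereal_inf [set lognorm F z | z in hsphere 0 (1 / 2)])%E]) ->
  (forall z, hball 0 r z -> hnorm (F z) ^+ 2 = 0 ->
      elliptic_zero (sqr_hnorm_map F) (to_real z)) ->
  zero_count F (hball 0 (1 / 2)) k ->
  exists (s : seq E) (p : E -> nat) (K : R), [/\ (\sum_(b <- s) p b <= k)%N, 1 <= K &
    forall z, hnorm z <= 1 / 2 ->
      hnorm (F z) <= K * zero_prod s p z /\ zero_prod s p z <= K * hnorm (F z)].
Proof.
move=> hr holF [M [M0 supF infF]] ellF [s [mu [s_uniq s_zero s_deg kE]]].
have ballE (t : R) z : hball 0 t z = (hnorm z < t) by rewrite /hball /= subr0.
have Fr z : hnorm z < r -> (exists A, has_cdiff F z A) /\ hnorm (F z) <= 1.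
  move=> zr; have zb : hball 0 r z by rewrite ballE.
  split; first exact: differentiable_has_cdiff (holF z zb).
  by apply: lognorm_le0; apply: le_trans supF; apply: ereal_sup_ubound; exists z.
have rho0 : 0 < r - 1 / 2 by rewrite subr_gt0.
have FM z : hnorm z <= 1 / 2 -> bounded_holo F z (r - 1 / 2) 1.
  move=> z12 y yz; apply: Fr; rewrite -(subrK z y).
  by apply: le_lt_trans (ler_hnormD _ _) _; move: z12 yz; clear; lra.
have zr (z : E) : hnorm z <= 1 / 2 -> hnorm z < r by move=> z12; exact: le_lt_trans hr.
have s12 b : b \in s -> hnorm b < 1 / 2 by move=> /s_zero[]; rewrite ballE.
have ord b : exists q : nat, b \in s -> q%:Z <= mu b /\
    exists c C t0 : R, [/\ 0 < c, 0 < t0 & forall z, hnorm (z - b) < t0 ->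
     c * hnorm (z - b) ^+ q <= hnorm (F z) <= C * hnorm (z - b) ^+ q].
  have [bs|] := boolP (b \in s); last by exists 0%N.
  have b12 := ltW (s12 b bs); have [_ Fb] := (s_zero b).1 bs.
  have ell : elliptic_zero (sqr_hnorm_map F) (to_real b).
    by apply: ellF; [rewrite ballE; exact: zr|rewrite Fb hnorm0 expr0n].
  have [q [c [C [t0 [_ qmu c0 t00 loc]]]]] :=
    elliptic_zero_order rho0 (FM b b12) ell (s_deg b bs).
  by exists q => _; split => //; exists c, C, t0; split.
have [p pP] := choice ord.
have [|||b bs|K K1 KP] := @zero_prod_bounds R n F s p s_uniq s12.
- by move=> z z12; have [] := Fr z (zr z z12).
- by move=> z z12; have [] := Fr z (zr z z12).
(* [s] lists the zeros in the open ball; on the sphere the lower bound - M excludes zeros. *)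
- move=> z; rewrite le_eqVlt => /orP[/eqP z12|z12] Fz; last by apply/s_zero; rewrite ballE.
  have : ((- M)%:E <= lognorm F z)%E.
    apply: le_trans infF _; apply: ereal_inf_lbound; exists z => //.
    by rewrite /hsphere /= subr0.
  by move=> /lognorm_neq0; rewrite Fz eqxx.
- by have [_] := pP b bs.
exists s, p, K; split => //.
rewrite -lez_nat kE (big_morph Posz PoszD (erefl 0%:Z)).
by rewrite big_seq [leRHS]big_seq; apply: ler_sum => b bs; have [] := pP b bs.
Qed.

(** The comparison is made factor by factor and yields X to the sum of the p b; X >= 1 allows this
    exponent to be raised to k. *)
Lemma zero_prod_scale (s : seq E) (p : E -> nat) (X : R) (k : nat) z y : 1 <= X ->
  (\sum_(b <- s) p b <= k)%N ->
  (forall b, b \in s -> hnorm (z - b) <= X * hnorm (y - b)) ->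
  zero_prod s p z <= X ^+ k * zero_prod s p y.
Proof.
move=> X1 pk zy; have X0 : 0 <= X by apply: le_trans X1.
have prod0 w : 0 <= zero_prod s p w by apply: prodr_ge0 => b _; rewrite exprn_ge0 ?hnorm_ge0.
apply: (@le_trans _ _ (X ^+ (\sum_(b <- s) p b) * zero_prod s p y)); last first.
  by rewrite ler_wpM2r// ler_weXn2l.
rewrite (big_morph (fun m => X ^+ m) (exprD X) (expr0 X)) /zero_prod -big_split /=.
rewrite big_seq [leRHS]big_seq; apply: ler_prod => b bs.
rewrite exprn_ge0 ?hnorm_ge0//= -exprMn lerXn2r ?nnegrE ?mulr_ge0 ?hnorm_ge0//.
exact: zy.
Qed.

End ZeroOrders.

(** * The final estimate, with a constant independent of d *)

Lemma powR_le_expR (R : realType) (Q d : R) : 0 < Q -> 0 < d -> (Q * d) `^ (1 / d) <= expR Q.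
Proof.
move=> Q0 d0; have Qd0 : 0 < Q * d by rewrite mulr_gt0.
rewrite /powR gt_eqF// ler_expR mulrAC mul1r ler_pdivrMr//.
rewrite -ler_expR lnK ?posrE//; apply: le_trans (expR_ge1Dx _).
by rewrite lerDr.
Qed.

Theorem theorem1p6 (R : realType) (n : nat) (hn : (2 <= n)%N)
    (r : R) (hr : 1 / 2 < r) (F : 'Cv[R]_n -> 'Cv[R]_n)
    (holF : holomorphic_on (hball 0 r) F)
    (boundF : exists M : R, [/\ 0 < M,
      (ereal_sup [set lognorm F z | z in hball 0 r] <= 0)%E &
      ((- M)%:E <= ereal_inf [set lognorm F z | z in hsphere 0 (1 / 2)])%E])
    (ellF : forall z, hball 0 r z -> hnorm (F z) ^+ 2 = 0 ->
      elliptic_zero (sqr_hnorm_map F) (to_real z))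
    (k : nat) (hk : zero_count F (hball 0 (1 / 2)) k) (k_gt0 : (0 < k)%N) :
  exists2 c : R, 0 < c &
    forall (x : 'Cv[R]_n) (t d a eps : R) (omega : set 'Cv[R]_n),
      0 < t -> 0 < d -> 0 < a -> 0 < eps ->
      omega `<=` hball x t ->
      class_A d a omega ->
      (eps%:E <= hausdorff d omega)%E ->
      hball x (4 * r ^+ 2 * t) `<=` hball 0 (1 / 2) ->
      (ereal_sup [set lognorm F z | z in hball x t]
       <= ereal_sup [set lognorm F z | z in omega]
          + (k%:R * ln (16 * expR 1 * r * t * a `^ (1 / d)
                        / (c * (d * eps) `^ (1 / d))))%:E)%E.
Proof.
case: n hn F holF boundF ellF hk => [//|n] hn F holF boundF ellF hk.
have [s [p [K [pk K1 KP]]]] := zero_prod_comparison hr holF boundF ellF hk.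
have K0 : 0 < K by apply: lt_le_trans K1.
have r0 : 0 < r by apply: lt_trans hr; rewrite divr_gt0.
pose Q : R := (cell_number n + size s).+1%:R.
have Q0 : 0 < Q by rewrite ltr0n.
have L0 : 0 < 6 * (K * K) * expR Q by rewrite !mulr_gt0 ?expR_gt0.
have er0 : 0 < 16 * expR 1 * r by rewrite !mulr_gt0 ?expR_gt0.
(* Chosen so that 16 e r / c = 6 K^2 e^Q: one factor K for each comparison of |F| with the product,
   6 from the ratio of distances, and e^Q for (Q d)^(1/d). *)
exists (16 * expR 1 * r / (6 * (K * K) * expR Q)); first by rewrite divr_gt0.
move=> x t d a eps omega t0 d0 a0 eps0 om_ball omA Heps sub.
set X := 16 * expR 1 * r * t * a `^ (1 / d) / _.
have t4 : t < 4 * r ^+ 2 * t.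
  rewrite ltr_pMl//; move: hr; clear; nra.
have in12 z : hball x t z -> hnorm z <= 1 / 2.
  move=> zx; have /sub : hball x (4 * r ^+ 2 * t) z by exact: lt_trans t4.
  by rewrite /hball /= subr0 => /ltW.
have diam2 z y : hball x t z -> hball x t y -> hnorm (z - y) <= 2 * t.
  rewrite /hball /= => zx yx; apply: le_trans (ler_hnorm_dist z x y) _.
  by rewrite (hnormBC x y); move: zx yx; clear; lra.
have t20 : 0 < 2 * t by rewrite mulr_gt0.
have [|dt [y yo yfar]] := class_A_far_point s d0 a0 eps0 t20 omA Heps.
  by move=> z y zo yo; apply: diam2; exact: om_ball.
move: dt yfar; rewrite -/Q; set delta := _ `^ _ => dt yfar.
have Qa0 : 0 < Q * a by rewrite mulr_gt0.
have delta0 : 0 < delta by rewrite powR_gt0// divr_gt0.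
have de0 : 0 < (d * eps) `^ (1 / d) by rewrite powR_gt0// mulr_gt0.
have ad0 : 0 < a `^ (1 / d) by rewrite powR_gt0.
have XE : X = 6 * (K * K) * expR Q * t * a `^ (1 / d) / (d * eps) `^ (1 / d).
  rewrite /X; move: er0 L0 de0; move: (16 * expR 1 * r) (6 * (K * K) * expR Q) => u v u0 v0 w0.
  by field; rewrite !gt_eqF.
have X0 : 0 < X by rewrite XE divr_gt0// !mulr_gt0 ?expR_gt0.
have deltaE : delta * ((Q * d) `^ (1 / d) * a `^ (1 / d)) = (d * eps) `^ (1 / d).
  have Qd0 : 0 < Q * d by rewrite mulr_gt0.
  have v0 : 0 < eps / (Q * a) by rewrite divr_gt0.
  have Qda0 : 0 < Q * d * a by rewrite mulr_gt0.
  rewrite -(powRM _ (ltW Qd0) (ltW a0)) -(powRM _ (ltW v0) (ltW Qda0)).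
  by congr (_ `^ _); field; rewrite !gt_eqF.
have X6 : K * K * (6 * t / delta) <= X.
  have Qd0 : 0 < (Q * d) `^ (1 / d) by rewrite powR_gt0// mulr_gt0.
  rewrite XE -deltaE.
  have -> : K * K * (6 * t / delta) = 6 * (K * K) * (Q * d) `^ (1 / d) * t * a `^ (1 / d) /
      (delta * ((Q * d) `^ (1 / d) * a `^ (1 / d))) by field; rewrite !gt_eqF.
  rewrite ler_wpM2r ?invr_ge0 ?mulr_ge0 ?(ltW delta0) ?(ltW Qd0) ?(ltW ad0)//.
  rewrite ler_wpM2r ?(ltW ad0)// ler_wpM2r ?(ltW t0)// ler_wpM2l ?powR_le_expR//.
  by rewrite !mulr_ge0// ltW.
have X1 : 1 <= 6 * t / delta.
  by rewrite ler_pdivlMr// mul1r; move: dt t0; clear; lra.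
have key z : hball x t z -> hnorm (F z) <= X ^+ k * hnorm (F y).
  move=> zx; have [Fz _] := KP z (in12 z zx); have [_ Fy] := KP y (in12 y (om_ball y yo)).
  have scale := zero_prod_scale (z := z) (y := y) X1 pk.
  have {}scale : zero_prod s p z <= (6 * t / delta) ^+ k * zero_prod s p y.
    (* Here |z - b| <= 2 t + |y - b|. From |y - b| >= delta / 2 the first term is at most (4 t /
       delta) |y - b|, and from delta <= 2 t the second is at most (2 t / delta) |y - b|. *)
    apply: scale => b bs; apply: le_trans (ler_hnorm_dist z y b) _.
    have zy := diam2 z y zx (om_ball y yo); have yb := yfar b bs.
    rewrite mulrAC ler_pdivlMr//; move: zy yb dt t0 delta0 (hnorm_ge0 (y - b)).
    by move: (hnorm (z - y)) (hnorm (y - b)) => q1 q2; clear; nra.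
  have Xk0 : 0 <= (6 * t / delta) ^+ k by rewrite exprn_ge0// (le_trans _ X1).
  apply: le_trans Fz _; apply: (@le_trans _ _ (K * ((6 * t / delta) ^+ k * (K * hnorm (F y))))).
    by rewrite ler_pM2l//; apply: le_trans scale _; rewrite ler_wpM2l.
  rewrite (_ : _ * _ = K * K * (6 * t / delta) ^+ k * hnorm (F y)); last by ring.
  rewrite ler_wpM2r ?hnorm_ge0//; apply: (@le_trans _ _ ((K * K * (6 * t / delta)) ^+ k)).
    (* K^2 <= (K^2)^k because k > 0 and K >= 1: this absorbs the comparison constants into the k-th
       power. *)
    rewrite [leRHS]exprMn ler_wpM2r// -[leLHS]expr1; apply: ler_weXn2l => //.
    by rewrite mulr_ege1.
  have Y0 : 0 <= K * K * (6 * t / delta).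
    by apply: mulr_ge0 (le_trans ler01 X1); exact: mulr_ge0 (ltW K0) (ltW K0).
  by apply: lerXn2r; rewrite ?nnegrE// ltW.
apply: ge_ereal_sup => _ [z zx <-].
apply: (@le_trans _ _ (lognorm F y + (k%:R * ln X)%:E)%E); last first.
  by rewrite leeD2r//; apply: ereal_sup_ubound; exists y.
(* At a zero the left side is -oo. Otherwise [key] forces F y to be nonzero, and both logarithms are
   finite. *)
have [Fz|Fz] := eqVneq (F z) 0.
  by rewrite /lognorm Fz hnorm0 /= lexx leNye.
have nFz : 0 < hnorm (F z) by rewrite hnorm_gt0.
have Xk : 0 < X ^+ k by rewrite exprn_gt0.
have nFy : 0 < hnorm (F y) by rewrite -(pmulr_rgt0 _ Xk); apply: lt_le_trans (key z zx).
rewrite /lognorm !lne_EFin// -EFinD lee_fin.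
have -> : k%:R * ln X = ln (X ^+ k) by rewrite lnXn// mulr_natl.
rewrite -lnM ?posrE// ler_ln ?posrE ?mulr_gt0//.
by rewrite mulrC; exact: key.
Qed.
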